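(* Let $\mathcal G$ be a network, let $\dot x=f(x)$ be a $\mathcal G$-admissible ODE, and let $\mathbb X=\{x(t)\}$ be a strongly hyperbolic periodic orbit of this ODE. Suppose that $\mathbb X$ has a locally rigid synchrony pattern on a non-empty open interval of time, that is, there are a non-empty open interval $J\subseteq\mathbb R$ and a colouring $\bowtie$ of the nodes such that $\bowtie$ is a locally rigid synchrony pattern for $\mathbb X$ at $x(t_0)$ for all $t_0\in J$. Then $\bowtie$ is balanced.
   Context: Networks. A network $\mathcal G$ has a finite set of nodes $\mathcal C=\{1,\dots,n\}$ with an equivalence relation $\sim_C$ (node-type), a finite set of arrows $\mathcal A$ with an equivalence relation $\sim_A$ (arrow-type), and head and tail maps $\mathcal H,\mathcal T:\mathcal A\to\mathcal C$ (multiple arrows and self-loops allowed). The input set of $c$ is $I(c)=\{a:\mathcal H(a)=c\}$. $B(c,d)$ is the set of input isomorphisms: bijections $\beta:I(c)\to I(d)$ with $a\sim_A\beta(a)$ for all $a$, where also $c\sim_C d$. Write $c\sim_I d$ (input equivalent) if $B(c,d)\ne\emptyset$. Networks are irredundant: two nodes (arrows) have the same type iff they are related by an input isomorphism. Admissible maps. Each node has a node space $P_c=\mathbb R^{k_c}$; $P=\prod_cP_c$. It is required that $P_i=P_j$ whenever $i\sim_S j$ (state equivalence), where $\sim_S$ is the equivalence relation generated by $\mathcal H(e)\sim_S\mathcal H(\beta(e))$, $\mathcal T(e)\sim_S\mathcal T(\beta(e))$ for all $\beta\in B(c,d)$, $e\in I(c)$. If $I(c)=\{i_1,\dots,i_\nu\}$,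 put $T(c)=(\mathcal T(i_1),\dots,\mathcal T(i_\nu))$, $x_{T(c)}=(x_{\mathcal T(i_1)},\dots,x_{\mathcal T(i_\nu)})$, and $P_{T(c)}=\prod_jP_{\mathcal T(i_j)}$. A smooth ($C^\infty$) map $f:P\to P$ is admissible if $f_c(x)=\hat f_c(x_c,x_{T(c)})$ with $\hat f_c:P_c\times P_{T(c)}\to P_c$ smooth, and for all $\beta\in B(c,d)$: $\hat f_d(x_d,x_{T(d)})\equiv\hat f_c(x_d,\beta^*x_{T(d)})$ on $P_d\times P_{T(d)}$, where $\beta^*x_{T(d)}=(x_{\mathcal T(\beta(i_1))},\dots,x_{\mathcal T(\beta(i_\nu))})$. An admissible ODE is $\dot x=f(x)$ with $f$ admissible. Perturbations. The norm on $P$ is $\|x\|=\max_c\|x_c\|$ (Euclidean norms), and $\|p\|_1=\sup_{x}\max(\|p(x)\|,\|\mathrm Dp(x)\|)$. A perturbation is a smooth admissible $p$ with $\|p\|_1<\infty$. A periodic orbit is non-constant; it is hyperbolic if $1$ is a simple Floquet multiplier and no other multiplier lies on the unit circle. For $\mathbb X$ hyperbolic of period $T$ and $\|p\|_1$ small, $\dot x=f(x)+p(x)$ has a unique periodic orbit $\tilde{\mathbb X}=\{\tilde x(t)\}$ near $\mathbb X$ with period $\tilde T$ near $T$; its time parametrisation is fixed by requiring $\tilde x(t_0)$ to lie on a fixed Poincaré section transverse to $\mathbb X$ at $x(t_0)$. Colourings. A colouring is an equivalence relation $\bowtie$ on $\mathcal C$ with $c\bowtie d\Rightarrow c\sim_S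 d$. It is balanced if whenever $c\bowtie d$ there is $\beta\in B(c,d)$ with $\mathcal T(e)\bowtie\mathcal T(\beta(e))$ for all $e\in I(c)$. It is a locally rigid synchrony pattern for a hyperbolic $\mathbb X$ at $x(t_0)$ if there are $\varepsilon>0$, $t^*>0$ such that for all perturbations $p$ with $\|p\|_1<\varepsilon$, $\tilde{\mathbb X}$ is hyperbolic and $\tilde x_c(t)=\tilde x_d(t)\iff c\bowtie d$ for all $|t-t_0|<t^*$. Strong hyperbolicity. Given a colouring $\bowtie$ and a set $\mathcal R$ of representatives of its classes, let $[c]\in\mathcal R$ be the representative of $c$ and $[T(c)]=([\mathcal T(i_1)],\dots,[\mathcal T(i_\nu)])$. The induced ODE on $P^{\mathcal R}=\prod_{r\in\mathcal R}P_r$ is $\dot x_r=\hat f_r(x_r,x_{[T(r)]})$, $r\in\mathcal R$; the induced orbit is $\mathbb X^{\mathcal R}=\{(x_r(t))_{r\in\mathcal R}\}$. $\mathbb X$ is strongly hyperbolic for $\bowtie$ if $\mathbb X$ is hyperbolic and there is $\mathcal R$ such that, if necessary after an arbitrarily small admissible perturbation of $f$ (replacing $f,\mathbb X$ by $f+p,\tilde{\mathbb X}$), the induced orbit is a hyperbolic periodic orbit of the induced ODE. $\mathbb X$ is strongly hyperbolic if it is strongly hyperbolic for every colouring $\bowtie$. *)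

(* Defs.v *)
From HB Require Import structures.
From mathcomp Require Import all_boot all_order all_algebra.
From mathcomp Require Import all_classical all_reals all_analysis.
From mathcomp Require Import complex.

Set Implicit Arguments.
Unset Strict Implicit.
Unset Printing Implicit Defensive.

Import Order.TTheory GRing.Theory Num.Theory.
Import numFieldNormedType.Exports.

Local Open Scope classical_set_scope.
Local Open Scope ring_scope.

(** * Networks *)

Record network := Network {
  node : finType;
  arrow : finType;
  node_type : rel node;
  arrow_type : rel arrow;
  head : arrow -> node;
  tail : arrow -> node;
  node_typeP : equivalence_rel node_type;
  arrow_typeP : equivalence_rel arrow_type }.

(* The input set I(c); multiple arrows and self-loops are allowed. *)
Definition inputs (G : network) (c : node G) : finType :=
  {e : arrow G | head e == c}.

Definition arr (G : network) (c : node G) (e : inputs c) : arrow G := sval e.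

Definition input_iso (G : network) (c d : node G) (b : inputs c -> inputs d) :
    Prop :=
  [/\ node_type c d, bijective b
    & forall e : inputs c, arrow_type (arr e) (arr (b e))].

Definition input_equiv (G : network) (c d : node G) : Prop :=
  exists b : inputs c -> inputs d, input_iso b.

Definition irredundant (G : network) : Prop :=
  (forall c d : node G, node_type c d <-> input_equiv c d) /\
  (forall a a' : arrow G, arrow_type a a' <->
     exists (c d : node G) (b : inputs c -> inputs d) (e : inputs c),
       [/\ input_iso b, arr e = a & arr (b e) = a']).

Inductive state_equiv (G : network) : node G -> node G -> Prop :=
| state_equiv_head c d (b : inputs c -> inputs d) (e : inputs c) :
    input_iso b -> state_equiv (head (arr e)) (head (arr (b e)))
| state_equiv_tail c d (b : inputs c -> inputs d) (e : inputs c) :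
    input_iso b -> state_equiv (tail (arr e)) (tail (arr (b e)))
| state_equiv_refl c : state_equiv c c
| state_equiv_sym c d : state_equiv c d -> state_equiv d c
| state_equiv_trans c d e :
    state_equiv c d -> state_equiv d e -> state_equiv c e.

(** * Colourings *)

Definition colouring (G : network) (col : rel (node G)) : Prop :=
  equivalence_rel col /\ forall c d, col c d -> state_equiv c d.

Definition balanced (G : network) (col : rel (node G)) : Prop :=
  forall c d, col c d -> exists b : inputs c -> inputs d,
    input_iso b /\ forall e, col (tail (arr e)) (tail (arr (b e))).

(* [Rs] contains exactly one element of each colour class; [rep c] is [c],
   the element of [Rs] with the colour of c. *)
Definition representatives (G : network) (col : rel (node G))
    (Rs : {set node G}) (rep : node G -> {r | r \in Rs}) : Prop :=
  forall c, col c (sval (rep c)) /\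
    forall r, r \in Rs -> col c r -> r = sval (rep c).

(** * Finite products of Euclidean spaces *)

(* The product over i : I of the spaces R^(k i), as a space of row vectors, so
   that it carries the library's normed module structure. *)
Definition total_dim (I : finType) (k : I -> nat) : nat :=
  \sum_(j < #|I|) k (enum_val j).

Notation prodsp R k := 'rV[R]_(total_dim k).

Definition pack (R : realType) (I : finType) (k : I -> nat)
    (u : forall i, 'rV[R]_(k i)) : prodsp R k :=
  \mxrow_(j < #|I|) u (enum_val j).

Definition fcoord (R : realType) (I : finType) (k : I -> nat)
    (x : prodsp R k) (i : I) : 'rV[R]_(k i) :=
  castmx (erefl, congr1 k (enum_rankK i)) (submxrow x (enum_rank i)).

(* Identification of R^m with R^n for m = n (and 0 if m <> n, a case which
   [node_spaces] below excludes wherever [tr] occurs). *)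
Definition tr (R : realType) (m n : nat) (u : 'rV[R]_m) : 'rV[R]_n :=
  conform_mx (0 : 'rV[R]_n) u.

(** * Smooth maps *)

(* In finite dimension, f is C^(m+1) iff it is differentiable and all its
   directional derivatives are C^m. *)
Fixpoint Ck (R : realType) (V W : normedModType R) (m : nat) (f : V -> W) :
    Prop :=
  if m is m'.+1 then
    (forall x, differentiable f x) /\ forall v, Ck m' (fun x => 'D_v f x)
  else continuous f.

Definition smooth (R : realType) (V W : normedModType R) (f : V -> W) : Prop :=
  forall m, Ck m f.

(** * Periodic orbits and hyperbolicity *)

(* x is a periodic solution with minimal period T; in particular it is not
   constant. *)
Definition periodic_orbit (R : realType) (N : nat)
    (F : 'rV[R]_N -> 'rV[R]_N) (x : R -> 'rV[R]_N) (T : R) : Prop :=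
  [/\ forall t : R, is_derive t 1 x (F (x t)),
      0 < T, forall t, x (t + T) = x t
    & forall s, 0 < s < T -> ~ (forall t, x (t + s) = x t)].

(* Vectors are rows, so the variational equation reads v' = v *m 'J F (x t). *)
Definition monodromy (R : realType) (N : nat)
    (F : 'rV[R]_N -> 'rV[R]_N) (x : R -> 'rV[R]_N) (T : R) (M : 'M[R]_N) :
    Prop :=
  exists Y : R -> 'M[R]_N,
    [/\ Y 0 = 1%:M, forall t : R, is_derive t 1 Y (Y t *m 'J F (x t))
      & Y T = M].

(* The Floquet multipliers are the roots in R[i], counted with multiplicity,
   of the characteristic polynomial of the monodromy matrix. *)
Definition hyperbolic (R : realType) (N : nat)
    (F : 'rV[R]_N -> 'rV[R]_N) (x : R -> 'rV[R]_N) (T : R) : Prop :=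
  periodic_orbit F x T /\
  exists M : 'M[R]_N, monodromy F x T M /\
    let chi : {poly R[i]} := map_poly (real_complex R) (char_poly M) in
    mup 1 chi = 1%N /\ forall z : R[i], root chi z -> `|z| = 1 -> z = 1.

(** * Admissible maps *)

(* [k c] is the dimension of the node space P_c.  The third clause matters only
   for nodes without inputs, which state equivalence does not relate; the
   pullback condition in [admissible_components] makes sense for them only if
   it holds. *)
Definition node_spaces (G : network) (k : node G -> nat) : Prop :=
  [/\ forall c, (0 < k c)%N,
      forall c d, state_equiv c d -> k c = k d
    & forall c d : node G, input_equiv c d -> k c = k d].

Notation state R k := (prodsp R k).

Definition tail_dim (G : network) (k : node G -> nat) (c : node G)
    (e : inputs c) : nat := k (tail (arr e)).

(* The space P_T(c): one factor for each input arrow of c, so that arrows with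
   the same tail have independent entries. *)
Notation input_state R k c := (prodsp R (@tail_dim _ k c)).

Definition tail_states (R : realType) (G : network) (k : node G -> nat)
    (x : state R k) (c : node G) : input_state R k c :=
  pack (fun e : inputs c => fcoord x (tail (arr e)) : 'rV[R]_(tail_dim k e)).

Definition pullback (R : realType) (G : network) (k : node G -> nat)
    (c d : node G) (b : inputs c -> inputs d) (y : input_state R k d) :
    input_state R k c :=
  pack (fun e : inputs c => tr (tail_dim k e) (fcoord y (b e))).

Notation components R k :=
  (forall c, 'rV[R]_(k c) * input_state R k c -> 'rV[R]_(k c)).

Definition admissible_components (R : realType) (G : network)
    (k : node G -> nat) (fh : components R k) (f : state R k -> state R k) :
    Prop :=
  [/\ forall c, smooth (fh c),
      forall x c, fcoord (f x) c = fh c (fcoord x c, tail_states x c)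
    & forall (c d : node G) (b : inputs c -> inputs d), input_iso b ->
        forall (u : 'rV[R]_(k d)) (y : input_state R k d),
          fh d (u, y) = tr (k d) (fh c (tr (k c) u, pullback b y))].

Definition admissible (R : realType) (G : network) (k : node G -> nat)
    (f : state R k -> state R k) : Prop :=
  smooth f /\ exists fh, admissible_components fh f.

(** * Perturbations *)

Definition eucl_norm (R : realType) (m : nat) (u : 'rV[R]_m) : R :=
  Num.sqrt (\sum_j u 0 j ^+ 2).

Definition state_norm (R : realType) (G : network) (k : node G -> nat)
    (x : state R k) : R :=
  \big[Num.max/0]_(c : node G) eucl_norm (fcoord x c).

Definition op_norm (R : realType) (G : network) (k : node G -> nat)
    (A : state R k -> state R k) : \bar R :=
  ereal_sup [set (state_norm (A v))%:E | v in [set v | state_norm v <= 1]].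

Definition C1_norm (R : realType) (G : network) (k : node G -> nat)
    (p : state R k -> state R k) : \bar R :=
  ereal_sup (range (fun x => maxe (state_norm (p x))%:E (op_norm ('d p x)))).

Definition perturbation (R : realType) (G : network) (k : node G -> nat)
    (p : state R k -> state R k) : Prop :=
  admissible p /\ (C1_norm p < +oo)%E.

Definition near_orbit (R : realType) (G : network) (k : node G -> nat)
    (delta : R) (x : R -> state R k) (T : R) (y : R -> state R k) (S : R) :
    Prop :=
  `|S - T| < delta /\ forall t, exists s, state_norm (y t - x s) < delta.

(* A Poincare section at z: the zero set, near z, of a smooth function g. *)
Definition transverse_section (R : realType) (G : network)
    (k : node G -> nat) (f : state R k -> state R k) (z : state R k)
    (g : state R k -> R) : Prop :=
  [/\ smooth g, g z = 0 & 'd g z (f z) <> 0].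

(* y, of minimal period S, is a periodic orbit of f + p close to x, of period
   close to T, whose time parametrisation is fixed by the section g. *)
Definition perturbed_orbit (R : realType) (G : network) (k : node G -> nat)
    (f : state R k -> state R k) (x : R -> state R k) (T t0 : R)
    (g : state R k -> R) (delta : R) (p : state R k -> state R k)
    (y : R -> state R k) (S : R) : Prop :=
  [/\ periodic_orbit (f \+ p) y S, near_orbit delta x T y S,
      g (y t0) = 0 & state_norm (y t0 - x t0) < delta].

(** * Local rigidity *)

(* x_c = x_d *)
Definition synchronous (R : realType) (G : network) (k : node G -> nat)
    (x : state R k) (c d : node G) : Prop :=
  k c = k d /\ fcoord x c = tr (k c) (fcoord x d).

(* For small p the perturbed orbit is the unique periodic orbit in some fixed
   neighbourhood, of size delta, of the orbit x; this identifies it. *)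
Definition locally_rigid (R : realType) (G : network) (k : node G -> nat)
    (f : state R k -> state R k) (x : R -> state R k) (T : R)
    (col : rel (node G)) (t0 : R) : Prop :=
  exists g, transverse_section f (x t0) g /\
  exists delta eps tstar : R, [/\ 0 < delta, 0 < eps, 0 < tstar &
    forall p, perturbation p -> (C1_norm p < eps%:E)%E ->
      exists y S,
        [/\ perturbed_orbit f x T t0 g delta p y S,
            forall y' S', perturbed_orbit f x T t0 g delta p y' S' ->
              S' = S /\ forall t, y' t = y t,
            hyperbolic (f \+ p) y S
          & forall t, `|t - t0| < tstar ->
              forall c d, synchronous (y t) c d <-> col c d]].

(** * Strong hyperbolicity *)

Definition rep_dim (G : network) (k : node G -> nat) (Rs : {set node G})
    (r : {r | r \in Rs}) : nat := k (sval r).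

Notation rep_state R k Rs := (prodsp R (@rep_dim _ k Rs)).

Definition induced_field (R : realType) (G : network) (k : node G -> nat)
    (Rs : {set node G}) (rep : node G -> {r | r \in Rs})
    (fh : components R k) (z : rep_state R k Rs) : rep_state R k Rs :=
  pack (fun r : {r | r \in Rs} =>
    fh (sval r)
      (fcoord z r,
       pack (fun e : inputs (sval r) =>
         tr (tail_dim k e) (fcoord z (rep (tail (arr e)))))) :
      'rV[R]_(rep_dim k r)).

Definition induced_orbit (R : realType) (G : network) (k : node G -> nat)
    (Rs : {set node G}) (x : R -> state R k) (t : R) : rep_state R k Rs :=
  pack (fun r : {r | r \in Rs} =>
    fcoord (x t) (sval r) : 'rV[R]_(rep_dim k r)).

(* The case p = 0 is the one in which no perturbation is necessary.  The period
   of the induced orbit may be smaller than that of the orbit itself. *)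
Definition strongly_hyperbolic_for (R : realType) (G : network)
    (k : node G -> nat) (f : state R k -> state R k) (x : R -> state R k)
    (T : R) (col : rel (node G)) : Prop :=
  hyperbolic f x T /\
  exists (Rs : {set node G}) (rep : node G -> {r | r \in Rs}),
    representatives col rep /\
    forall eta : R, 0 < eta ->
      exists p, [/\ perturbation p, (C1_norm p < eta%:E)%E &
        exists y S gh,
          [/\ periodic_orbit (f \+ p) y S, near_orbit eta x T y S,
              admissible_components gh (f \+ p)
            & exists S',
                hyperbolic (induced_field rep gh) (induced_orbit Rs y) S']].

Definition strongly_hyperbolic (R : realType) (G : network)
    (k : node G -> nat) (f : state R k -> state R k) (x : R -> state R k)
    (T : R) : Prop :=
  forall col : rel (node G),
    colouring col -> strongly_hyperbolic_for f x T col.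

(* Main.v *)
(* A hyperbolic periodic orbit persists under C^1-small perturbations: the perturbed orbit is
   found by a Newton iteration whose linearised equation is solvable because the Floquet
   multiplier 1 is simple.

   Perturb f so that as few nodes as possible are constant near t0 on the rigid orbit y; by
   minimality the same set K of nodes stays constant under all further small perturbations.
   Suppose c and d have the same colour but no input isomorphism between them preserves colours.
   Then along y no pullback of the local state (own state and input states) of d equals the local
   state of c, so admissible perturbations can be concentrated, up to input symmetries, near the
   local states of c.  If the local state of c moves, this is possible at arbitrarily many times
   close to some t1, giving independent parameters lam_1, ..., lam_m.  Synchrony of c and d gives
   one equation at each time, which determines lam from the perturbed orbit, and that orbit is
   determined by its state at t1: impossible once m exceeds the dimension of the phase space.
   The same count with the equation x_c' = 0 for c in K shows that nodes feeding into K are in K.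
   Hence c, d and everything upstream of them are constant near t0, and a last count compares the
   stationarity equations of c and of one node per colour in K with the coordinates of these
   representatives alone, among which c does not figure. *)
From HB Require Import structures.
From mathcomp Require Import all_boot all_order all_algebra.
From mathcomp Require Import all_classical all_reals all_analysis.
From mathcomp Require Import complex.
From mathcomp Require Import perm ring lra.
Require Import Defs.

Set Implicit Arguments.
Unset Strict Implicit.
Unset Printing Implicit Defensive.

Import Order.TTheory GRing.Theory Num.Theory.
Import numFieldNormedType.Exports.

Local Open Scope classical_set_scope.
Local Open Scope ring_scope.

(** * Calculus of matrix-valued functions *)

Section MxNorm.
Variable R : realType.

(** Only existence and uniqueness of the perturbed orbit are used, no continuity in the parameters:
    an injectivity estimate with an explicit Lipschitz constant already contradicts a pigeonhole
    count on grids, so neither smooth dependence nor invariance of domain enters. The constraints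
    are imposed at finitely many local states, so perturbations need not be localised by bump
    functions. It suffices that they vanish exactly at finitely many points. Trigonometric
    polynomials achieve this, are bounded together with their derivatives, and stay so under
    composition with linear maps and symmetrisation. Elsewhere their values are controlled by
    Lipschitz constants of any size, because the distance [rho] of the perturbed orbits is chosen
    after these. Sampling at many times needs a local state that moves; for a constant one all times
    give the same equation. This is why the last count runs over nodes, and why K must first be
    closed under tails: only then do the stationarity equations of nodes in K involve states of K
    alone. Minimality of K makes constancy itself a constraint that can be counted. *)

Lemma mx_entry_le m n (M : 'M[R]_(m, n)) i j : `|M i j| <= `|M|.
Proof.
rewrite [leRHS]/Num.Def.normr/= mx_normrE.
exact: (le_bigmax _ (fun ij : 'I_m * 'I_n => `|M ij.1 ij.2|) (i, j)).
Qed.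

Lemma mx_norm_le m n (M : 'M[R]_(m, n)) e :
  0 <= e -> (forall i j, `|M i j| <= e) -> `|M| <= e.
Proof.
move=> e0 Me; rewrite [leLHS]/Num.Def.normr/= mx_normrE.
by apply: bigmax_le => // -[i j] _; exact: Me.
Qed.

Lemma mulmx_norm_le m n p (A : 'M[R]_(m, n)) (B : 'M[R]_(n, p)) :
  `|A *m B| <= n%:R * `|A| * `|B|.
Proof.
apply: mx_norm_le => [|i j]; first by rewrite !mulr_ge0.
rewrite mxE (le_trans (ler_norm_sum _ _ _))//.
rewrite (le_trans (ler_sum _ (G := fun=> `|A| * `|B|) _))//.
  by move=> l _; rewrite normrM ler_pM// mx_entry_le.
by rewrite sumr_const card_ord -[X in X <= _]mulr_natl mulrA.
Qed.

Lemma is_derive_mx m n (u : R -> 'M[R]_(m, n)) (t : R) (v : 'M[R]_(m, n)) :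
  is_derive t 1 u v <->
  forall i j, is_derive t 1 (fun s => u s i j : R) (v i j).
Proof.
split=> [[du uv] i j|H].
  have dij := (derivable_mxP _ _ _).1 du.
  by apply: DeriveDef; [exact: dij|rewrite -uv derive_mx// mxE].
have du : derivable u t 1 by apply/derivable_mxP => i j; have [] := H i j.
apply: DeriveDef => //; rewrite derive_mx//; apply/matrixP => i j.
by rewrite mxE; have [] := H i j.
Qed.

Lemma is_derive_continuous (V : normedModType R) (u : R -> V) (t : R) v :
  is_derive t 1 u v -> {for t, continuous u}.
Proof.
by move=> [/derivable1_diffP du _]; exact: differentiable_continuous.
Qed.

Lemma is_derive_comp_diff (V W : normedModType R) (F : V -> W) (u : R -> V)
    (t : R) v : differentiable F (u t) -> is_derive t 1 u v ->
  is_derive t 1 (F \o u) ('d F (u t) v).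
Proof.
move=> dF [/derivable1_diffP du uv].
apply: DeriveDef; first by apply/derivable1_diffP; exact: differentiable_comp.
rewrite deriveE; last exact: differentiable_comp.
by rewrite diff_comp//= -uv deriveE.
Qed.

(** The norm is the largest absolute entry, so the scalar mean value theorem on each entry gives the
    bound without loss of a constant. *)
Lemma mean_value_le m n (u du : R -> 'M[R]_(m, n)) (B a b : R) :
  a <= b -> (forall t : R, a <= t <= b -> is_derive t 1 u (du t)) ->
  (forall t : R, a <= t <= b -> `|du t| <= B) -> `|u b - u a| <= B * (b - a).
Proof.
move=> ab du_ duB.
have B0 : 0 <= B by apply: le_trans (duB a _); rewrite ?lexx ?ab.
apply: mx_norm_le => [|i j]; first by rewrite mulr_ge0// subr_ge0.
have d (t : R) : a <= t <= b -> is_derive t 1 (fun s => u s i j : R) (du t i j).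
  by move=> /du_/is_derive_mx.
have [|c|c cab] := @MVT_segment R (fun s => u s i j) (fun s => du s i j) a b ab.
- by move=> x; rewrite in_itv /= => /andP[/ltW ax /ltW xb]; apply: d; rewrite ax.
- apply: continuous_in_subspaceT c => x; rewrite inE /= in_itv /= => /d.
  exact: is_derive_continuous.
- rewrite !mxE => ->; rewrite normrM (ger0_norm (_ : 0 <= b - a)) ?subr_ge0//.
  rewrite ler_wpM2r ?subr_ge0// (le_trans (mx_entry_le _ _ _))// duB//.
Qed.

Lemma mean_value_dist_le m n (u du : R -> 'M[R]_(m, n)) (B a b c d : R) :
  (forall t : R, c <= t <= d -> is_derive t 1 u (du t)) ->
  (forall t : R, c <= t <= d -> `|du t| <= B) ->
  c <= a <= d -> c <= b <= d -> `|u b - u a| <= B * `|b - a|.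
Proof.
move=> du_ duB /andP[ca ad] /andP[cb bd].
have [ab|/ltW ba] := leP a b.
  rewrite (ger0_norm (_ : 0 <= b - a)) ?subr_ge0//.
  by apply: (mean_value_le (du := du)) => // t /andP[at_ tb];
    [apply: du_|apply: duB]; rewrite (le_trans ca)// (le_trans tb).
rewrite distrC (distrC b) (ger0_norm (_ : 0 <= a - b)) ?subr_ge0//.
by apply: (mean_value_le (du := du)) => // t /andP[at_ tb];
  [apply: du_|apply: duB]; rewrite (le_trans cb)// (le_trans tb).
Qed.

Lemma is_derive0_cst m n (u : R -> 'M[R]_(m, n)) :
  (forall t : R, is_derive t 1 u 0) -> forall a b, u a = u b.
Proof.
move=> du a b; apply/eqP; rewrite -subr_eq0 -normr_le0.
have := @mean_value_dist_le _ _ u (fun=> 0) 0 b a (Num.min a b) (Num.max a b).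
rewrite mul0r; apply => //; first by move=> t _; rewrite normr0.
  by rewrite ge_min lexx orbT le_max lexx orbT.
by rewrite ge_min lexx le_max lexx.
Qed.

Lemma primitive_on (f : R -> R) (b : R) : 0 < b -> continuous f ->
  exists F : R -> R, F 0 = 0 /\ forall t : R, `|t| < b -> is_derive t 1 F (f t).
Proof.
move=> b0 cf; pose F0 (x : R) := (\int[lebesgue_measure]_(t in `[- b, x]) f t)%R.
have dF (t : R) : `|t| < b -> is_derive t 1 F0 (f t).
  rewrite ltr_norml => /andP[bt tb].
  have [|dt vt] := @continuous_FTC1_closed R f (- b) t b tb _ bt (cf t).
    apply: continuous_compact_integrable; first exact: segment_compact.
    exact: continuous_subspaceT.
  by apply: DeriveDef; rewrite -?derive1E.
exists (fun x => F0 x - F0 0); split => [|t tb]; first by rewrite subrr.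
have := is_deriveB (dF t tb) (is_derive_cst (F0 0) t (1 : R)).
by rewrite subr0.
Qed.

Lemma primitive_real (f : R -> R) : continuous f ->
  exists F : R -> R, F 0 = 0 /\ forall t : R, is_derive t 1 F (f t).
Proof.
move=> cf.
have /choice[P HP] : forall n : nat, exists F : R -> R,
    F 0 = 0 /\ forall t : R, `|t| < n.+1%:R -> is_derive t 1 F (f t).
  by move=> n; apply: primitive_on.
have agree m n (t : R) : `|t| < m.+1%:R -> `|t| < n.+1%:R -> P m t = P n t.
  move=> tm tn; have [P0 dP] := HP m; have [Q0 dQ] := HP n.
  apply/eqP; rewrite -subr_eq0 -normr_le0.
  pose u s := (P m s - P n s)%:M : 'M[R]_1.
  have := @mean_value_dist_le _ _ u (fun=> 0) 0 0 t (- `|t|) `|t|.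
  rewrite mul0r /u P0 Q0 subrr raddf0 subr0 => H.
  apply: le_trans (H _ _ _ _).
  - by rewrite (le_trans _ (mx_entry_le _ 0 0))// mxE eqxx.
  - move=> s; rewrite -ler_norml => st; apply/is_derive_mx => i j.
    rewrite !ord1 mxE; under eq_fun do rewrite mxE eqxx mulr1n.
    rewrite -(subrr (f s)); apply: is_deriveB; [apply: dP|apply: dQ];
      exact: le_lt_trans st _.
  - by move=> s _; rewrite normr0.
  - by rewrite lerNl oppr0 normr_ge0.
  - by rewrite -ler_norml.
pose k (t : R) := Num.truncn `|t|.
have kt (t : R) : `|t| < (k t).+1%:R by apply: truncnS_gt.
exists (fun t => P (k t) t); split => [|t]; first by have [] := HP (k 0).
(* Near [t] the index [k s] can differ from [k t]; the primitive with one index more is valid on the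
   unit ball about [t] and agrees there with all of them. *)
have dP := (HP (k t).+1).2.
apply: (@near_eq_is_derive _ _ _ (P (k t).+1)) => //; last first.
  by apply: dP; rewrite (lt_trans (kt t))// ltr_nat.
near=> s; apply: agree => //.
near: s; exists 1 => //= s /=; rewrite distrC => ts.
rewrite -(subrK t s) (le_lt_trans (ler_normD _ _))// -addn1 natrD addrC.
by rewrite ltrD.
Unshelve. all: by end_near. Qed.

Lemma primitive_mx m n (f : R -> 'M[R]_(m, n)) : continuous f ->
  exists F : R -> 'M[R]_(m, n), F 0 = 0 /\ forall t : R, is_derive t 1 F (f t).
Proof.
move=> cf.
have cfij i j : continuous (fun t => f t i j : R).
  move=> t; apply: (@continuous_comp _ _ _ f (fun M : 'M[R]_(m, n) => M i j)).
    exact: cf.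
  exact: coord_continuous.
pose F i j := sval (cid (primitive_real (cfij i j))).
have HF i j : F i j 0 = 0 /\ forall t : R, is_derive t 1 (F i j) (f t i j).
  by rewrite /F; case: cid.
exists (fun t => \matrix_(i, j) F i j t); split.
  by apply/matrixP => i j; rewrite !mxE (HF i j).1.
move=> t; apply/is_derive_mx => i j.
by under eq_fun do rewrite mxE; apply: (HF i j).2.
Qed.

Lemma mean_value_global m n (u du : R -> 'M[R]_(m, n)) (B : R) :
  (forall t : R, is_derive t 1 u (du t)) -> (forall t : R, `|du t| <= B) ->
  forall a b, `|u b - u a| <= B * `|b - a|.
Proof.
move=> du_ duB a b.
apply: (@mean_value_dist_le _ _ u du B a b (Num.min a b) (Num.max a b)) => //.
  by rewrite ge_min lexx le_max lexx.
by rewrite ge_min lexx orbT le_max lexx orbT.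
Qed.

(** The candidate for [v] is [v 0] plus a primitive of [dv]. The mean value bound for [u k] minus
    this primitive leaves an error of [e k] times a constant depending on the time only, hence
    arbitrarily small. *)
Lemma uniform_limit_is_derive m n (u : nat -> R -> 'M[R]_(m, n))
    (du : nat -> R -> 'M[R]_(m, n)) (v dv : R -> 'M[R]_(m, n)) (e : nat -> R) :
  (forall n (t : R), is_derive t 1 (u n) (du n t)) ->
  continuous dv ->
  (forall n (t : R), `|u n t - v t| <= e n) ->
  (forall n (t : R), `|du n t - dv t| <= e n) ->
  (forall r, 0 < r -> exists n, e n < r) ->
  forall t : R, is_derive t 1 v (dv t).
Proof.
move=> Hu cdv uv duv e0 t.
have [P [P0 dP]] := primitive_mx cdv.
suff -> : v = fun s => v 0 + P s.
  by have := is_deriveD (is_derive_cst (v 0) t (1 : R)) (dP t); rewrite add0r.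
apply/funext => s; apply/eqP; rewrite -subr_eq0 opprD addrA -normr_le0.
apply/ler_addgt0Pl => r r0; rewrite addr0.
have [|k ek] := e0 (r / (2 + `|s|)); first by rewrite divr_gt0// ltr_pwDl.
have e_ge0 : 0 <= e k by rewrite (le_trans _ (uv k 0)).
pose w (s : R) := u k s - P s.
have dw (x : R) : is_derive x 1 w (du k x - dv x) by apply: is_deriveB.
have := mean_value_global dw (fun t => duv k t) 0 s.
rewrite /w P0 !subr0 => H.
have -> : v s - v 0 - P s = (v s - u k s) + (u k s - P s - u k 0) + (u k 0 - v 0).
  by apply/matrixP => i j; rewrite !mxE; ring.
rewrite (le_trans (ler_normD _ _))//.
apply: (@le_trans _ _ (e k * (2 + `|s|))); last first.
  by rewrite -ler_pdivlMr ?ltW// ltr_pwDl.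
rewrite (_ : _ * _ = e k + e k * `|s| + e k); last by ring.
rewrite lerD// (le_trans (ler_normD _ _))// lerD//.
by rewrite distrC.
Qed.

Lemma gronwall_short m n (u du : R -> 'M[R]_(m, n)) (L b t1 tau : R) :
  0 <= L -> 0 <= b -> 0 <= tau -> L * tau <= 2^-1 ->
  (forall t : R, `|t - t1| <= tau -> is_derive t 1 u (du t)) ->
  (forall t : R, `|t - t1| <= tau -> `|du t| <= L * `|u t| + b) ->
  forall t, `|t - t1| <= tau -> `|u t| <= 2 * (`|u t1| + tau * b).
Proof.
move=> L0 b0 tau0 Lt du_ dub.
have seg t : (t1 - tau <= t <= t1 + tau) = (`|t - t1| <= tau) by rewrite ler_distl.
have t1t : t1 - tau <= t1 + tau by rewrite lerD2l (le_trans _ tau0)// oppr_le0.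
have [|c cI cmax] := EVT_max t1t (f := fun t => `|u t|).
  apply: continuous_in_subspaceT => t; rewrite inE /= in_itv /= seg => /du_ /is_derive_continuous.
  by move=> cu; apply: (continuous_comp cu); exact: norm_continuous.
have cmax' t : `|t - t1| <= tau -> `|u t| <= `|u c|.
  by move=> tt; apply: cmax; rewrite in_itv /= seg.
have uc : `|u c - u t1| <= (L * `|u c| + b) * `|c - t1|.
  apply: (@mean_value_dist_le _ _ u du _ t1 c (t1 - tau) (t1 + tau)).
  - by move=> t; rewrite seg => /du_.
  - move=> t; rewrite seg => tt; rewrite (le_trans (dub _ tt))// lerD2r.
    by rewrite ler_wpM2l// cmax'.
  - by rewrite seg subrr normr0.
  - by rewrite in_itv in cI.
have ct : `|c - t1| <= tau by rewrite in_itv /= seg in cI.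
have ucM : `|u c| <= 2 * (`|u t1| + tau * b).
  have h1 : `|u c| <= `|u t1| + (L * `|u c| + b) * tau.
    rewrite -[X in `|X| <= _](subrK (u t1)) (le_trans (ler_normD _ _))// addrC lerD2l.
    by rewrite (le_trans uc)// ler_wpM2l// addr_ge0// mulr_ge0.
  have h2 : L * tau * `|u c| <= 2^-1 * `|u c| by rewrite ler_wpM2r.
  lra.
by move=> t tt; rewrite (le_trans (cmax' _ tt)).
Qed.

Lemma linear_growth_zero m n (u du : R -> 'M[R]_(m, n)) (L s : R) :
  (forall t : R, is_derive t 1 u (du t)) ->
  (forall t : R, `|du t| <= L * `|u t|) -> u s = 0 -> forall t, u t = 0.
Proof.
move=> du_ duL us.
have L1 : 0 < `|L| + 1 by rewrite ltr_wpDl.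
pose tau := (2 * (`|L| + 1))^-1.
have tau0 : 0 < tau by rewrite invr_gt0 mulr_gt0.
have Lt : (`|L| + 1) * tau <= 2^-1 by rewrite /tau invfM mulrCA mulfV ?mulr1// gt_eqF.
have step t1 : u t1 = 0 -> forall t, `|t - t1| <= tau -> u t = 0.
  move=> u1 t tt; apply/eqP; rewrite -normr_le0.
  have := @gronwall_short _ _ u du (`|L| + 1) 0 t1 tau (ltW L1) (lexx _) (ltW tau0) Lt.
  move=> /(_ (fun t _ => du_ t)); rewrite u1 normr0 mulr0 addr0 mulr0; apply => //.
  move=> x _; rewrite (le_trans (duL _))// addr0 ler_wpM2r//.
  by rewrite (le_trans (ler_norm _))// lerDl.
have iter (k : nat) : forall t, `|t - s| <= k%:R * tau -> u t = 0.
  elim: k => [t|k IH t tk].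
    by rewrite mul0r normr_le0 subr_eq0 => /eqP ->.
  (* The fraction k / (k + 1) of the way from [s] to [t] leaves a last step of length at most
     [tau]. *)
  pose t1 := s + (t - s) * (k%:R / k.+1%:R).
  have k1 : 0 < k.+1%:R :> R by rewrite ltr0n.
  apply: (@step t1).
    apply: IH; rewrite /t1 addrC addKr normrM [X in _ * X]ger0_norm ?divr_ge0//.
    by rewrite mulrA ler_pdivrMr// -mulrA [leLHS]mulrC ler_wpM2l// mulrC.
  have -> : t - t1 = (t - s) / k.+1%:R.
    rewrite /t1 -natr1; field.
    by rewrite natr1 gt_eqF.
  by rewrite normrM normfV (ger0_norm (ltW k1)) ler_pdivrMr// mulrC.
move=> t; apply: (iter (Num.truncn (`|t - s| / tau)).+1).
by rewrite -ler_pdivrMr// ltW// truncnS_gt.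
Qed.

Lemma periodic_representative (T t : R) : 0 < T ->
  exists2 s, 0 <= s <= T &
    forall (X : Type) (u : R -> X), (forall t, u (t + T) = u t) -> u t = u s.
Proof.
move=> T0.
have perk (X : Type) (u : R -> X) (k : nat) r :
    (forall t, u (t + T) = u t) -> u (r + k%:R * T) = u r.
  move=> per; elim: k => [|k IH]; first by rewrite mul0r addr0.
  by rewrite -natr1 mulrDl mul1r addrA per.
have pos r : 0 <= r -> exists2 s, 0 <= s <= T &
    forall (X : Type) (u : R -> X), (forall t, u (t + T) = u t) -> u r = u s.
  move=> r0; have /andP[k1 k2] := truncn_itv (divr_ge0 r0 (ltW T0)).
  exists (r - (Num.truncn (r / T))%:R * T); last first.
    by move=> X u per; rewrite -[RHS](perk _ _ (Num.truncn (r / T)))// subrK.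
  rewrite subr_ge0 -ler_pdivlMr// k1 /= lerBlDr.
  by move: k2; rewrite ltr_pdivrMr// -natr1 mulrDl mul1r addrC => /ltW.
have [|t0] := leP 0 t; first exact: pos.
pose k := (Num.truncn (- t / T)).+1.
have [|s sT Hs] := pos (t + k%:R * T).
  by rewrite -lerBlDl sub0r -ler_pdivrMr// ltW// truncnS_gt.
by exists s => // X u per; rewrite -(Hs _ _ per) perk.
Qed.

Lemma periodic_bounded (V : normedModType R) (T : R) (u : R -> V) :
  0 < T -> continuous u -> (forall t, u (t + T) = u t) ->
  exists2 B, 0 < B & forall t, `|u t| <= B.
Proof.
move=> T0 cu per.
have [|c cI cmax] := EVT_max (ltW T0) (f := fun t => `|u t|).
  by apply: continuous_subspaceT => t; apply: (continuous_comp (cu t)); exact: norm_continuous.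
exists (`|u c| + 1); first by rewrite ltr_wpDl.
move=> t; have [s sT ->//] := periodic_representative t T0.
by rewrite (@le_trans _ _ `|u c|) ?lerDl// cmax// in_itv.
Qed.

Lemma continuous_bounded_ball m n (h : 'rV[R]_m -> 'rV[R]_n) (r : R) :
  0 <= r -> continuous h -> exists2 B, 0 < B & forall a, `|a| <= r -> `|h a| <= B.
Proof.
move=> r0 ch; pose A := [set a : 'rV[R]_m | `|a| <= r].
have cA : compact A.
  apply: bounded_closed_compact.
    by exists r; split; [exact: num_real|move=> M /ltW rM a /= /le_trans; apply].
  apply: (@closed_comp _ _ (fun a : 'rV[R]_m => `|a|) [set x | x <= r]); last exact: closed_le.
  by move=> a _; exact: norm_continuous.
have [||c cinA cmax] := @EVT_max_rV R m (fun a => `|h a|) A _ cA.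
- by exists 0; rewrite /A /= normr0.
- apply: continuous_subspaceT => a; apply: (continuous_comp (ch a)); exact: norm_continuous.
exists (`|h c| + 1); first by rewrite ltr_wpDl.
by move=> a ar; rewrite (@le_trans _ _ `|h c|) ?lerDl//; apply: cmax; rewrite inE.
Qed.

Lemma diff_rV_le m n (G : 'rV[R]_m -> 'rV[R]_n) x v B :
  (forall i, `|'d G x (delta_mx 0 i)| <= B) -> `|'d G x v| <= m%:R * B * `|v|.
Proof.
move=> GB; rewrite {1}[v]row_sum_delta linear_sum (le_trans (ler_norm_sum _ _ _))//.
rewrite (le_trans (ler_sum _ (G := fun=> B * `|v|) _))//.
  move=> i _; rewrite linearZ /= normrZ mulrC ler_pM// ?mx_entry_le//.
by rewrite sumr_const card_ord -[X in X <= _]mulr_natl mulrA.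
Qed.

Lemma is_derive_scalel (V : normedModType R) (w : V) (t : R) :
  is_derive t 1 (fun s : R => s *: w) w.
Proof.
have [ds dE] := is_diff_scalel t w.
by apply: DeriveDef; [exact/derivable1_diffP|rewrite deriveE// dE /= scale1r].
Qed.

Lemma is_derive_line (V : normedModType R) (b w : V) (t : R) :
  is_derive t 1 (fun s : R => b + s *: w) w.
Proof.
by have := is_deriveD (is_derive_cst b t (1 : R)) (is_derive_scalel w t); rewrite add0r.
Qed.

Lemma lipschitz_ball m n (G : 'rV[R]_m -> 'rV[R]_n) (r B : R) :
  (forall x, differentiable G x) ->
  (forall x v, `|x| <= r -> `|'d G x v| <= B * `|v|) ->
  forall a b, `|a| <= r -> `|b| <= r -> `|G a - G b| <= B * `|a - b|.
Proof.
move=> dG GB a b ar br.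
have du (t : R) : is_derive t 1 (G \o (fun t : R => b + t *: (a - b)))
    ('d G (b + t *: (a - b)) (a - b)).
  by apply: is_derive_comp_diff; [exact: dG|exact: is_derive_line].
set g := G \o _ in du.
have <- : g 1 = G a by rewrite /g /= scale1r subrKC.
have <- : g 0 = G b by rewrite /g /= scale0r addr0.
rewrite -[leRHS]mulr1 -[in leRHS](subr0 1).
apply: (mean_value_le ler01 (fun t _ => du t)) => t /andP[t0 t1].
apply: GB; rewrite (_ : _ + _ = t *: a + (1 - t) *: b); last first.
  by apply/matrixP => i j; rewrite !mxE; ring.
rewrite (le_trans (ler_normD _ _))// !normrZ !ger0_norm// ?subr_ge0//.
rewrite -[leRHS]mul1r -[in leRHS](subrK t 1) [in leRHS]mulrDl addrC.
by rewrite lerD// ler_wpM2l// subr_ge0.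
Qed.

Lemma Ck1_lipschitz_ball m n (G : 'rV[R]_m -> 'rV[R]_n) (r : R) :
  0 <= r -> Ck 1 G ->
  exists2 B, 0 < B & forall a b, `|a| <= r -> `|b| <= r -> `|G a - G b| <= B * `|a - b|.
Proof.
move=> r0 [dG cG].
have /choice[B HB] i : exists B, 0 < B /\ forall x, `|x| <= r -> `|'d G x (delta_mx 0 i)| <= B.
  have [B B0 HB] := continuous_bounded_ball r0 (cG (delta_mx 0 i)).
  by exists B; split => // x xr; rewrite -deriveE//; apply: HB.
have B0 : 0 <= \sum_i B i by apply: sumr_ge0 => i _; rewrite ltW// (HB i).1.
exists (m%:R * (\sum_i B i) + 1); first by rewrite ltr_wpDl// mulr_ge0.
apply: lipschitz_ball => // x v xr.
rewrite (@le_trans _ _ (m%:R * (\sum_i B i) * `|v|))//; last first.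
  by rewrite ler_wpM2r// lerDl.
apply: diff_rV_le => i; rewrite (le_trans ((HB i).2 _ xr))//.
rewrite (bigD1 i)//= lerDl; apply: sumr_ge0 => j _; by rewrite ltW// (HB j).1.
Qed.

(** Each row of the Jacobian is a directional derivative of [G], itself of class C^1, so the
    Lipschitz bound for [Ck 1] maps applies row by row. *)
Lemma jacobian_lipschitz_ball m n (G : 'rV[R]_m -> 'rV[R]_n) (r : R) :
  0 <= r -> smooth G ->
  exists2 B, 0 < B &
    forall a b, `|a| <= r -> `|b| <= r -> `|'J G a - 'J G b| <= B * `|a - b|.
Proof.
move=> r0 sG; have [dG _] := sG 1%N.
have /choice[B HB] i : exists B, 0 < B /\
    forall a b, `|a| <= r -> `|b| <= r ->
      `|'D_(delta_mx 0 i) G a - 'D_(delta_mx 0 i) G b| <= B * `|a - b|.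
  have [B B0 HB] := Ck1_lipschitz_ball r0 ((sG 2%N).2 (delta_mx 0 i)).
  by exists B.
have B0 : 0 <= \sum_i B i by apply: sumr_ge0 => i _; rewrite ltW// (HB i).1.
exists (\sum_i B i + 1); first by rewrite ltr_wpDl.
move=> a b ar br; apply: mx_norm_le => [|i j]; first by rewrite mulr_ge0// addr_ge0.
have -> : ('J G a - 'J G b) i j = ('D_(delta_mx 0 i) G a - 'D_(delta_mx 0 i) G b) 0 j.
  by rewrite !deriveE// /jacobian !mxE.
rewrite (le_trans (mx_entry_le _ _ _))// (le_trans ((HB i).2 _ _ ar br))//.
rewrite ler_wpM2r// (bigD1 i)//= -addrA lerDl addr_ge0//.
by apply: sumr_ge0 => l _; rewrite ltW// (HB l).1.
Qed.
End MxNorm.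

(** * Persistence of hyperbolic periodic orbits *)

Section SimpleEigenvalue.
Variable R : realType.

Lemma char_poly_lblock n (C : 'cV[R]_n) (D : 'M[R]_n) :
  char_poly (block_mx 1 0 C D : 'M[R]_(1 + n)) = ('X - 1) * char_poly D.
Proof.
rewrite /char_poly /char_poly_mx map_block_mx scalar_mx_block opp_block_mx.
rewrite add_block_mx map_mx0 subr0 det_lblock map_mx1.
by rewrite (det_mx11 ('X%:M - 1)) !mxE eqxx.
Qed.

Lemma char_poly_conj n (P A B : 'M[R]_n) :
  P \in unitmx -> P *m A = B *m P -> char_poly A = char_poly B.
Proof.
move=> uP PA.
have H : map_mx polyC P *m char_poly_mx A = char_poly_mx B *m map_mx polyC P.
  rewrite /char_poly_mx mulmxBr mulmxBl -!map_mxM PA.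
  by rewrite mul_mx_scalar mul_scalar_mx.
have := congr1 determinant H; rewrite !det_mulmx mulrC => /mulIf; apply.
by rewrite det_map_mx polyC_eq0 -unitfE -unitmxE.
Qed.

Lemma row_mx_delta0 n (w : 'M[R]_1) :
  row_mx w 0 = w 0 0 *: (delta_mx 0 0 : 'rV[R]_(1 + n)).
Proof.
apply/rowP => j; rewrite !mxE; case: splitP => j' jj'.
  by rewrite !ord1 (_ : j = 0) ?eqxx ?mulr1//; apply/val_inj => /=; rewrite jj' ord1.
rewrite mxE (_ : (j == 0) = false) ?mulr0//.
by apply/eqP => j0; move: jj'; rewrite j0.
Qed.

(** In a basis beginning with [a] the matrix is block triangular with diagonal blocks 1 and [D].
    Simplicity of the eigenvalue 1 makes [1 - D] invertible, so the range of [1 - M] is a complement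
    of the line spanned by [a]. Later [M] is the monodromy matrix and [a] the velocity of the
    orbit. *)
Lemma simple_eigenvalue_split N (M : 'M[R]_N) (a : 'rV[R]_N) :
  a != 0 -> a *m M = a ->
  mup 1 (map_poly (real_complex R) (char_poly M)) = 1%N ->
  forall T : R, T != 0 -> exists2 K, 0 < K & forall r : 'rV[R]_N,
    exists xi s, [/\ xi *m (1%:M - M) - (s * T) *: a = r, `|xi| <= K * `|r| & `|s| <= K * `|r| ].
Proof.
case: N M a => [|n] M a a0 aM mu T T0.
  by move: a0; rewrite thinmx0 eqxx.
rewrite -[n.+1]/(1 + n)%N in M a a0 aM mu *.
pose P := row_ebase a; have uP : P \in unitmx by apply: row_ebase_unit.
have [c c0 ca] : exists2 c, c != 0 & a = c *: row 0 P.
  exists (col_ebase a 0 0).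
    by have := col_ebase_unit a; rewrite unitmxE [col_ebase a]mx11_scalar det_scalar1 unitfE mxE.
  rewrite -{1}(mulmx_ebase a) (_ : \rank a = 1%N); last by rewrite rank_rV a0.
  rewrite {1}[col_ebase a]mx11_scalar mul_scalar_mx -scalemxAl; congr (_ *: _).
  rewrite rowE; congr (_ *m _).
  by apply/matrixP => i j; rewrite !ord1 !mxE /= ltnS leqn0 andbT eq_sym.
pose B := P *m M *m invmx P.
have PM : P *m M = B *m P by rewrite /B mulmxKV.
have e0B : row 0 B = row 0 (1%:M : 'M[R]_(1 + n)).
  have aP : row 0 P *m M = row 0 P.
    by move: aM; rewrite ca -scalemxAl => /(scalerI c0).
  by rewrite /B !row_mul aP -row_mul mulmxV.
pose C := dlsubmx B; pose D := drsubmx B.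
have BE : B = block_mx 1 0 C D.
  rewrite -[LHS]submxK; congr block_mx.
    apply/matrixP => i j; rewrite !ord1 !mxE.
    have := congr1 (fun z : 'rV[R]_(1 + n) => z 0 0) e0B; rewrite !mxE => H.
    by rewrite (_ : lshift n 0 = 0)//; apply/val_inj.
  apply/matrixP => i j; rewrite !ord1 !mxE.
  have := congr1 (fun z : 'rV[R]_(1 + n) => z 0 (rshift 1 j)) e0B; rewrite !mxE => H.
  by rewrite (_ : lshift n 0 = 0) ?H//; apply/val_inj.
(* A root 1 of the characteristic polynomial of [D] would add to the factor X - 1 split off by the
   block form and raise the multiplicity to at least 2. *)
have uD : 1%:M - D \in unitmx.
  have : ~~ root (map_poly (real_complex R) (char_poly D)) 1.
    move: mu; rewrite (char_poly_conj uP PM) BE char_poly_lblock rmorphM /=.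
    rewrite rmorphB /= map_polyX rmorph1 => mu.
    have q0 : map_poly (real_complex R) (char_poly D) != 0.
      by rewrite map_poly_eq0 monic_neq0// char_poly_monic.
    apply/negP => rt; move: mu; rewrite mupM//; last by rewrite -[1]/(1%:P) polyXsubC_eq0.
    have := mup_XsubCX 1 (1 : R[i]) 1; rewrite eqxx expr1 polyC1 => ->.
    rewrite add1n => -[]; apply/eqP.
    by rewrite -lt0n -XsubC_dvd// dvdp_XsubCl.
  rewrite -(rmorph1 (real_complex R)) fmorph_root -eigenvalue_root_char.
  rewrite /eigenvalue negbK /eigenspace kermx_eq0 row_free_unit => uD.
  by rewrite -[1%:M - D]opprB unitmxE -scaleN1r detZ unitrM -unitmxE uD unitrX// unitrN1.
pose E := invmx (1%:M - D).
(* [XI] inverts [1 - D] on the complementary coordinates. The block [- C] of [1 - B] then leaves an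
   error along [a], which [S] cancels together with the first coordinate of [r]. *)
pose XI (r : 'rV[R]_(1 + n)) := r *m (invmx P *m block_mx 0 0 0 E *m P).
pose S (r : 'rV[R]_(1 + n)) := (r *m (invmx P *m col_mx 1 (E *m C))) 0 0 * - (T * c)^-1.
have key r : XI r *m (1%:M - M) - (S r * T) *: a = r.
  have XP : XI r *m (1%:M - M) = r *m invmx P *m block_mx 0 0 0 E *m (1%:M - B) *m P.
    have PB : P *m (1%:M - M) = (1%:M - B) *m P by rewrite mulmxBr mulmxBl PM mulmx1 mul1mx.
    by rewrite /XI -!mulmxA PB.
  have aE : (S r * T) *: a = - (r *m invmx P *m block_mx 1 0 (E *m C) 0 *m P).
    rewrite ca scalerA (_ : S r * T * c = - (r *m (invmx P *m col_mx 1 (E *m C))) 0 0); last first.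
      by rewrite /S; field; rewrite T0 c0.
    rewrite scaleNr; congr (- _); rewrite rowE scalemxAl; congr (_ *m _).
    rewrite mulmxA block_mxEh col_mx0 mul_mx_row mulmx0.
    by rewrite row_mx_delta0.
  have blk : block_mx 0 0 0 E *m (1%:M - B) + block_mx 1 0 (E *m C) 0 = 1%:M :> 'M[R]_(1 + n).
    rewrite BE scalar_mx_block opp_block_mx add_block_mx mulmx_block !mul0mx !add0r.
    rewrite [E *m - C]mulmxN mulVmx// add_block_mx.
    by rewrite !addr0 add0r [X in block_mx _ _ X _](addNr (E *m C)).
  rewrite XP aE opprK -mulmxDl -!(mulmxA r) -mulmxDr -!(mulmxA (invmx P)) -mulmxDr blk mulmx1.
  by rewrite -mulmxA mulVmx// mulmx1.
pose K1 := (1 + n)%:R * `|invmx P *m block_mx 0 0 0 E *m P|.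
pose K2 := (1 + n)%:R * `|invmx P *m col_mx 1 (E *m C)| * `|(T * c)^-1|.
have K10 : 0 <= K1 by rewrite mulr_ge0.
have K20 : 0 <= K2 by rewrite !mulr_ge0.
exists (K1 + K2 + 1); first by rewrite ltr_wpDl// addr_ge0.
move=> r; exists (XI r), (S r); split => //.
  rewrite (@le_trans _ _ (K1 * `|r|))//; last by rewrite ler_wpM2r// -addrA lerDl addr_ge0.
  by rewrite (le_trans (mulmx_norm_le _ _))// /K1 mulrAC.
rewrite (@le_trans _ _ (K2 * `|r|))//; last by rewrite ler_wpM2r// addrAC lerDr addr_ge0.
rewrite /S normrM normrN /K2 mulrAC ler_wpM2r//.
by rewrite (le_trans (mx_entry_le _ _ _))// (le_trans (mulmx_norm_le _ _))// mulrAC.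
Qed.
End SimpleEigenvalue.

(** * Linear differential equations with periodic coefficients *)

Section LinearPeriodic.
Variable R : realType.

Lemma continuous_mx (T : topologicalType) m n (M : T -> 'M[R]_(m, n)) :
  (forall i j, continuous (fun t => M t i j : R)) -> continuous M.
Proof.
move=> cM t; apply/cvgrPdist_le => e e0; near=> s.
apply: mx_norm_le => [|i j]; first exact: ltW.
rewrite !mxE; move: i j; near: s.
apply: filter_forall => i; apply: filter_forall => j.
by have /cvgrPdist_le/(_ _ e0) := cM i j t; apply: filterS.
Unshelve. all: by end_near. Qed.

Lemma continuous_entry (T : topologicalType) m n (M : T -> 'M[R]_(m, n)) i j :
  continuous M -> continuous (fun t => M t i j : R).
Proof.
move=> cM t; apply: (@continuous_comp _ _ _ M (fun A : 'M[R]_(m, n) => A i j)).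
  exact: cM.
exact: coord_continuous.
Qed.

Lemma continuous_mulmx (T : topologicalType) m n p (M : T -> 'M[R]_(m, n))
    (P : T -> 'M[R]_(n, p)) :
  continuous M -> continuous P -> continuous (fun t => M t *m P t).
Proof.
move=> cM cP; apply: continuous_mx => i j; under eq_fun do rewrite mxE.
apply: continuous_big => [|l _]; first exact: add_continuous.
by move=> t; apply: continuousM; apply: continuous_entry.
Qed.

Lemma continuous_mulR (T : topologicalType) (f g : T -> R) :
  continuous f -> continuous g -> continuous (fun t => f t * g t).
Proof. by move=> cf cg t; apply: (@continuousM R T f g t (cf t) (cg t)). Qed.

Lemma continuous_det (T : topologicalType) n (M : T -> 'M[R]_n) :
  continuous M -> continuous (fun t => \det (M t)).
Proof.
move=> cM; apply: continuous_big => [|s _]; first exact: add_continuous.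
apply: (@continuous_mulR T (fun=> (-1) ^+ s)); first by move=> t; exact: cst_continuous.
apply: continuous_big => [|i _]; first exact: mul_continuous.
exact: continuous_entry.
Qed.

Lemma continuous_invmx (T : topologicalType) n (M : T -> 'M[R]_n) :
  continuous M -> (forall t, M t \in unitmx) -> continuous (fun t => invmx (M t)).
Proof.
move=> cM uM; apply: continuous_mx => i j.
rewrite (_ : (fun t => _) = fun t => (\det (M t))^-1 * cofactor (M t) j i); last first.
  by apply/funext => t; rewrite /invmx uM !mxE.
apply: (@continuous_mulR T (fun t => (\det (M t))^-1)).
  move=> t; apply: (@continuousV _ _ (fun t => \det (M t))).
    by rewrite -unitfE -unitmxE.
  exact: continuous_det.
apply: (@continuous_mulR T (fun=> (-1) ^+ (j + i))); first by move=> t; exact: cst_continuous.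
apply: continuous_det; apply: continuous_mx => k l.
by under eq_fun do rewrite !mxE; apply: continuous_entry.
Qed.

Lemma is_derive_mulmx m n p (u du : R -> 'M[R]_(m, n)) (v dv : R -> 'M[R]_(n, p)) (t : R) :
  is_derive t 1 u (du t) -> is_derive t 1 v (dv t) ->
  is_derive t 1 (fun s => u s *m v s) (du t *m v t + u t *m dv t).
Proof.
move=> /is_derive_mx hu /is_derive_mx hv; apply/is_derive_mx => i j.
rewrite (_ : (fun s => _) = \sum_(l < n) (fun s => u s i l * v s l j : R)); last first.
  by apply/funext => s; rewrite mxE fct_sumE.
rewrite !mxE -big_split /=.
apply: is_derive_sum => l; have := is_deriveM (hu i l) (hv l j).
by rewrite addrC /GRing.scale /= [v t l j * _]mulrC.
Qed.

Lemma is_derive_comp_scalar (V : normedModType R) (u : R -> V) (h : R -> R) (s c : R) v :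
  is_derive (h s) 1 u v -> is_derive s 1 h c -> is_derive s 1 (u \o h) (c *: v).
Proof.
move=> [/derivable1_diffP du uv] dh.
have := is_derive_comp_diff du dh.
by rewrite -uv (deriveE _ du) -linearZ /= /GRing.scale /= mulr1.
Qed.

Lemma is_derive_affine (V : normedModType R) (u : R -> V) (c d t : R) v :
  is_derive (c * t + d) 1 u v -> is_derive t 1 (fun s => u (c * s + d)) (c *: v).
Proof.
move=> du; apply: (@is_derive_comp_scalar _ u (fun s => c * s + d)) => //.
have := is_derive_line (d : R^o) (c : R^o) t.
by under eq_fun do rewrite addrC /GRing.scale /= mulrC.
Qed.

Lemma segment_bounded (V : normedModType R) (u : R -> V) (a b : R) :
  continuous u -> exists2 B, 0 < B & forall t, a <= t <= b -> `|u t| <= B.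
Proof.
move=> cu; have [ab|ba] := leP a b; last first.
  by exists 1 => // t /andP[/le_trans h /h]; rewrite leNgt ba.
have [|c cI cmax] := EVT_max ab (f := fun t => `|u t|).
  by apply: continuous_subspaceT => t; apply: (continuous_comp (cu t)); exact: norm_continuous.
exists (`|u c| + 1); first by rewrite ltr_wpDl.
by move=> t tab; rewrite (@le_trans _ _ `|u c|) ?lerDl// cmax// in_itv.
Qed.

Variables (N : nat) (A : R -> 'M[R]_N) (T : R) (Y : R -> 'M[R]_N) (z : R -> 'rV[R]_N).
Hypotheses (T0 : 0 < T) (cA : continuous A) (perA : forall t, A (t + T) = A t).
Hypotheses (Y0 : Y 0 = 1%:M) (dY : forall t : R, is_derive t 1 Y (Y t *m A t)).
Hypotheses (dz : forall t : R, is_derive t 1 z (z t *m A t)).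
Hypotheses (z0 : z 0 != 0) (perz : forall t, z (t + T) = z t).
Hypothesis simple1 : mup 1 (map_poly (real_complex R) (char_poly (Y T))) = 1%N.

Lemma linear_unique m (u : R -> 'M[R]_(m, N)) s :
  (forall t : R, is_derive t 1 u (u t *m A t)) -> u s = 0 -> forall t, u t = 0.
Proof.
move=> du us; have [B B0 HB] := periodic_bounded T0 cA perA.
apply: (@linear_growth_zero _ _ _ u _ (N%:R * B) s du) => // t.
rewrite (le_trans (mulmx_norm_le _ _))// mulrAC ler_wpM2r//.
by rewrite ler_wpM2l.
Qed.

(** A row vector killed by [Y t] yields a solution that vanishes at [t], hence everywhere, in
    particular at 0, where [Y] is the identity. *)
Lemma fundamental_unit t : Y t \in unitmx.
Proof.
rewrite -row_free_unit -kermx_eq0; apply/eqP.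
set K := kermx _.
have dK (s : R) : is_derive s 1 (fun s => K *m Y s) ((K *m Y s) *m A s).
  have := is_derive_mulmx (du := fun=> 0) (dv := fun s => Y s *m A s) (is_derive_cst K s (1 : R)) (dY s).
  by rewrite mul0mx add0r mulmxA.
have := linear_unique dK (mulmx_ker (Y t)) 0.
by rewrite Y0 mulmx1.
Qed.

Lemma linear_flow t : z t = z 0 *m Y t.
Proof.
have dK (s : R) : is_derive s 1 (fun s => z s - z 0 *m Y s) ((z s - z 0 *m Y s) *m A s).
  have := is_derive_mulmx (du := fun=> 0) (dv := fun s => Y s *m A s) (is_derive_cst (z 0) s (1 : R)) (dY s).
  rewrite mul0mx add0r mulmxA => /(is_deriveB (dz s)).
  by rewrite -mulmxBl.
apply/eqP; rewrite -subr_eq0; apply/eqP.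
by apply: (linear_unique dK (s := 0)); rewrite Y0 mulmx1 subrr.
Qed.

(* The Fredholm alternative: the inhomogeneity is corrected along the periodic solution [z], which
   later amounts to changing the period. *)
Lemma linear_periodic_solve : exists2 K, 0 < K &
  forall (b : R -> 'rV[R]_N) beta, continuous b -> (forall t, b (t + T) = b t) ->
    (forall t, `|b t| <= beta) ->
  exists (x : R -> 'rV[R]_N) (s : R),
    [/\ forall t : R, is_derive t 1 x (x t *m A t + s *: z t + b t),
        forall t, x (t + T) = x t, forall t, `|x t| <= K * beta & `|s| <= K * beta].
Proof.
have cY : continuous Y by move=> t; exact: (is_derive_continuous (dY t)).
have cYi := continuous_invmx cY fundamental_unit.
have aM : z 0 *m Y T = z 0 by rewrite -linear_flow -[in LHS](add0r T) perz.
have [K1 K10 HK1] := simple_eigenvalue_split z0 aM simple1 (lt0r_neq0 T0).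
have [Bi Bi0 HBi] := segment_bounded 0 T cYi.
have [BY BY0 HBY] := segment_bounded 0 T cY.
pose n : R := N%:R; have n0 : 0 <= n by rewrite ler0n.
pose CP := n * Bi * T; pose C1 := n * CP * BY.
have CP0 : 0 <= CP by rewrite !mulr_ge0// ltW.
have C10 : 0 <= C1 by rewrite !mulr_ge0// ltW.
pose K2 := n * (K1 * C1 + K1 * C1 * T * `|z 0| + CP) * BY.
have K1C1 : 0 <= K1 * C1 by rewrite mulr_ge0// ltW.
have K1C1T : 0 <= K1 * C1 * T * `|z 0| by rewrite !mulr_ge0// ltW.
have K20 : 0 <= K2 by rewrite !mulr_ge0 ?addr_ge0// ltW.
exists (K1 * C1 + K2 + 1); first by rewrite ltr_wpDl// addr_ge0.
move=> b beta cb perb bbeta.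
have beta0 : 0 <= beta by rewrite (le_trans _ (bbeta 0)).
have [P [P0 dP]] := primitive_mx (continuous_mulmx cb cYi).
have PT t : 0 <= t <= T -> `|P t| <= CP * beta.
  move=> /andP[t0 tT]; rewrite -[P t]subr0 -P0.
  rewrite (le_trans (@mean_value_le _ _ _ P (fun t => b t *m invmx (Y t)) (n * beta * Bi) 0 t t0 _ _))//.
    move=> s /andP[s0 st]; rewrite (le_trans (mulmx_norm_le _ _))// ler_pM// ?mulr_ge0//.
      by rewrite ler_wpM2l.
    by rewrite HBi// s0 (le_trans st).
  rewrite subr0 (_ : CP * beta = n * beta * Bi * T); last by rewrite /CP; ring.
  by rewrite ler_wpM2l// !mulr_ge0// ltW.
have TT : 0 <= T <= T by rewrite lexx ltW.
(* Requiring x(T) = x(0) of the variation of constants formula [x] below gives xi = (xi + T s z(0) +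
   P(T)) Y(T); as z(0) Y(T) = z(0), this is the equation solved here. *)
have [xi [s [xiE xiK sK]]] := HK1 (P T *m Y T).
have rC1 : `|P T *m Y T| <= C1 * beta.
  rewrite (le_trans (mulmx_norm_le _ _))// (_ : C1 * beta = n * (CP * beta) * BY); last first.
    by rewrite /C1; ring.
  by rewrite ler_pM// ?mulr_ge0// ?HBY// ler_wpM2l// PT.
have xiK' : `|xi| <= K1 * C1 * beta.
  by rewrite (le_trans xiK)// -mulrA ler_wpM2l// ltW.
have sK' : `|s| <= K1 * C1 * beta.
  by rewrite (le_trans sK)// -mulrA ler_wpM2l// ltW.
pose x (t : R) := (xi + t *: (s *: z 0) + P t) *m Y t.
have dx (t : R) : is_derive t 1 x (x t *m A t + s *: z t + b t).
  have dl := is_deriveD (is_derive_line xi (s *: z 0) t) (dP t).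
  have := is_derive_mulmx (du := fun t => s *: z 0 + b t *m invmx (Y t)) (dv := fun s => Y s *m A s) dl (dY t).
  rewrite mulmxDl -mulmxA mulVmx ?fundamental_unit// mulmx1 -scalemxAl -linear_flow mulmxA.
  by rewrite [_ + b t + _]addrC [_ + (_ + b t)]addrA.
have perx t : x (t + T) = x t.
  apply/eqP; rewrite -subr_eq0; apply/eqP.
  have dw (r : R) : is_derive r 1 (fun r => x (r + T) - x r) ((x (r + T) - x r) *m A r).
    have := is_derive_affine (u := x) (c := 1) (d := T) (t := r) (dx _).
    rewrite mul1r scale1r perA perz perb => d1.
    have := is_deriveB d1 (dx r).
    rewrite (_ : _ - (x r *m A r + _ + _) = (x (r + T) - x r) *m A r); last first.
      by rewrite mulmxBl; apply/matrixP => i j; rewrite !mxE; ring.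
    by under eq_fun do rewrite mul1r.
  apply: (linear_unique dw (s := 0)).
  rewrite add0r /x P0 scale0r !addr0 Y0 mulmx1 !mulmxDl -scalemxAl -scalemxAl aM.
  rewrite -xiE mulmxBr mulmx1; move: (xi *m Y T) => w.
  by apply/matrixP => i j; rewrite !mxE; ring.
exists x, s; split => //.
- move=> t; have [t' t'T ->//] := periodic_representative t T0.
  rewrite (@le_trans _ _ (K2 * beta))//; last first.
    by rewrite ler_wpM2r// addrAC lerDr addr_ge0.
  rewrite (le_trans (mulmx_norm_le _ _))//.
  rewrite (_ : K2 * beta = n * (K1 * C1 * beta + K1 * C1 * beta * T * `|z 0| + CP * beta) * BY); last first.
    by rewrite /K2; ring.
  rewrite ler_pM// ?mulr_ge0// ?HBY// ler_wpM2l//.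
  rewrite (le_trans (ler_normD _ _))// lerD ?PT// (le_trans (ler_normD _ _))// lerD//.
  rewrite !normrZ mulrA ler_wpM2r// mulrC ler_pM//.
  by case/andP: t'T => t0 tT; rewrite ger0_norm.
- rewrite (le_trans sK')// ler_wpM2r// -addrA lerDl addr_ge0//.
Qed.
End LinearPeriodic.

(** * Newton iteration for a periodic orbit of unknown period *)

Section Newton.
Variable R : realType.

Lemma continuous_addf (T : topologicalType) (V : normedModType R) (f g : T -> V) :
  continuous f -> continuous g -> continuous (fun t => f t + g t).
Proof. by move=> cf cg t; apply: (@continuousD _ _ _ f g t (cf t) (cg t)). Qed.

Lemma continuous_subf (T : topologicalType) (V : normedModType R) (f g : T -> V) :
  continuous f -> continuous g -> continuous (fun t => f t - g t).
Proof. by move=> cf cg t; apply: (@continuousB _ _ _ f g t (cf t) (cg t)). Qed.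

Lemma continuous_scalef (T : topologicalType) (V : normedModType R) (c : R) (f : T -> V) :
  continuous f -> continuous (fun t => c *: f t).
Proof.
move=> cf t; apply: (@continuousZ _ _ _ (fun=> c) f t); last exact: cf.
exact: cst_continuous.
Qed.

Lemma uniform_limit_continuous (V : normedModType R) (u : nat -> R -> V) v (e : nat -> R) :
  (forall n, continuous (u n)) -> (forall n (t : R), `|u n t - v t| <= e n) ->
  (forall r, 0 < r -> exists n, e n < r) -> continuous v.
Proof.
move=> cu uv e0 t; apply/cvgrPdist_le => r r0.
have [|n en] := e0 (r / 3); first by rewrite divr_gt0.
have /cvgrPdist_le/(_ (r / 3)) := cu n t; rewrite divr_gt0// => /(_ isT).
apply: filterS => s us.
rewrite (_ : v t - v s = (v t - u n t) + (u n t - u n s) + (u n s - v s)); last first.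
  by rewrite !addrA !subrK.
rewrite (le_trans (ler_normD _ _))// (le_trans (lerD (ler_normD _ _) (lexx _)))//.
have h1 := uv n t; have h2 := uv n s; rewrite distrC in h1; lra.
Qed.

Lemma div_expr2_small (a e : R) : 0 < e -> exists n, a / 2 ^+ n < e.
Proof.
move=> e0; pose n := (Num.truncn (`|a| / e)).+1; exists n.
rewrite ltr_pdivrMr ?exprn_gt0// mulrC -ltr_pdivrMr//.
rewrite (@le_lt_trans _ _ (`|a| / e))//; first by rewrite ler_pM2r ?invr_gt0// ler_norm.
rewrite (@lt_trans _ _ n%:R)// ?truncnS_gt// -natrX ltr_nat.
exact: ltn_expl.
Qed.

Lemma geometric_limit (V : completeNormedModType R) (x : nat -> V) (c : R) :
  0 <= c -> (forall n, `|x n.+1 - x n| <= c / 2 ^+ n) ->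
  exists l, forall n, `|x n - l| <= 2 * c / 2 ^+ n.
Proof.
move=> c0 xc.
have tail n k : `|x (n + k)%N - x n| <= 2 * c / 2 ^+ n - 2 * c / 2 ^+ (n + k).
  elim: k => [|k IH]; first by rewrite addn0 !subrr normr0.
  rewrite addnS -[x _.+1 - _](subrKA (x (n + k)%N)) (le_trans (ler_normD _ _))//.
  rewrite (le_trans (lerD (xc _) IH))// exprS invfM.
  by rewrite le_eqVlt; apply/orP; left; apply/eqP; field; rewrite !expf_neq0.
have tail' n k : `|x (n + k)%N - x n| <= 2 * c / 2 ^+ n.
  by rewrite (le_trans (tail n k))// gerBl divr_ge0// mulr_ge0.
have cvgx : cvg (x @ \oo).
  apply: cauchy_cvg; apply: cauchy_exP => e e0.
  have [n ne] := div_expr2_small (2 * c) e0.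
  exists (x n); exists n => // k /= nk; rewrite -ball_normE /= distrC.
  by rewrite -(subnKC nk) (le_lt_trans (tail' _ _)).
exists (lim (x @ \oo)) => n.
apply/ler_addgt0Pl => e e0.
have /cvgrPdist_lt/(_ _ e0)[m _ Hm] := cvgx.
rewrite -(subrKA (x (n + m)%N)) (le_trans (ler_normD _ _))// addrC lerD//.
  by rewrite distrC ltW// Hm//= leq_addl.
by rewrite distrC tail'.
Qed.

Lemma geometric_limit_mx m n (x : nat -> 'M[R]_(m, n)) (c : R) :
  0 <= c -> (forall k, `|x k.+1 - x k| <= c / 2 ^+ k) ->
  exists l, forall k, `|x k - l| <= 2 * c / 2 ^+ k.
Proof.
move=> c0 xc.
have H i j : exists l : R, forall k, `|x k i j - l| <= 2 * c / 2 ^+ k.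
  apply: (@geometric_limit R^o (fun k => x k i j) c c0) => k.
  by rewrite (le_trans _ (xc k))// (le_trans _ (mx_entry_le _ i j))// !mxE.
exists (\matrix_(i, j) sval (cid (H i j))) => k.
apply: mx_norm_le => [|i j]; first by rewrite divr_ge0 ?exprn_ge0// mulr_ge0.
by rewrite !mxE; case: cid => l /= /(_ k).
Qed.

Variables (N : nat) (F : 'rV[R]_N -> 'rV[R]_N) (y : R -> 'rV[R]_N) (T : R).
Hypotheses (sF : smooth F) (T0 : 0 < T).
Hypotheses (dy : forall t : R, is_derive t 1 y (F (y t))) (pery : forall t, y (t + T) = y t).

Let A t := 'J F (y t).

Variables (K By BF BA LF LJ : R).
Hypothesis K0 : 0 < K.
Hypothesis solve : forall (b : R -> 'rV[R]_N) beta, continuous b ->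
    (forall t, b (t + T) = b t) -> (forall t, `|b t| <= beta) ->
  exists (x : R -> 'rV[R]_N) (s : R),
    [/\ forall t : R, is_derive t 1 x (x t *m A t + s *: F (y t) + b t),
        forall t, x (t + T) = x t, forall t, `|x t| <= K * beta & `|s| <= K * beta].
Hypotheses (By0 : 0 <= By) (BF0 : 0 <= BF) (BA0 : 0 <= BA) (LF0 : 0 <= LF) (LJ0 : 0 <= LJ).
Hypotheses (yB : forall t, `|y t| <= By) (FB : forall t, `|F (y t)| <= BF).
Hypothesis AB : forall t, `|A t| <= BA.
Hypothesis FL : forall a b, `|a| <= By + 1 -> `|b| <= By + 1 -> `|F a - F b| <= LF * `|a - b|.
Hypothesis JL : forall a b, `|a| <= By + 1 -> `|b| <= By + 1 ->
  `|'J F a - 'J F b| <= LJ * `|a - b|.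

Lemma near_orbit_ball t a r : r <= 1 -> `|a - y t| <= r -> `|a| <= By + 1.
Proof.
move=> r1 ar; rewrite -(subrK (y t) a) (le_trans (ler_normD _ _))// addrC.
by rewrite lerD// (le_trans ar).
Qed.

(** The linearisation is taken along the unperturbed orbit and not at the current iterate, so every
    step solves the same linear equation with the same constant [K]. The price is an error of order
    [r] times the step instead of its square, which is enough for halving. *)
Lemma linearisation_error t a b r : 0 <= r <= 1 -> `|a - y t| <= r -> `|b - y t| <= r ->
  `|F a - F b - (a - b) *m A t| <= N%:R * (LJ * r) * `|a - b|.
Proof.
move=> /andP[r0 r1] ar br; have [dF _] := sF 1%N.
pose u (s : R) := F (b + s *: (a - b)) - s *: ((a - b) *m A t).
pose du (s : R) := (a - b) *m ('J F (b + s *: (a - b)) - A t).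
have dus (s : R) : is_derive s 1 u (du s).
  have d1 := is_derive_comp_diff (dF (b + s *: (a - b))) (is_derive_line b (a - b) s).
  have d2 := is_derive_scalel ((a - b) *m A t) s.
  have := is_deriveB d1 d2; by rewrite -deriveE// deriveEjacobian// -mulmxBr.
have -> : F a - F b - (a - b) *m A t = u 1 - u 0.
  by rewrite /u !scale1r !scale0r addr0 subr0 subrKC addrAC.
have := mean_value_le (B := N%:R * (LJ * r) * `|a - b|) ler01 (fun t _ => dus t).
rewrite subr0 mulr1; apply => s /andP[s0 s1].
rewrite (le_trans (mulmx_norm_le _ _))// mulrAC ler_wpM2r// ler_wpM2l//.
have seg : `|b + s *: (a - b) - y t| <= r.
  rewrite (_ : _ - _ = s *: (a - y t) + (1 - s) *: (b - y t)); last first.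
    by apply/matrixP => i j; rewrite !mxE; ring.
  rewrite (le_trans (ler_normD _ _))// !normrZ !ger0_norm// ?subr_ge0//.
  rewrite -[leRHS]mul1r -[in leRHS](subrK s 1) [in leRHS]mulrDl addrC.
  by rewrite lerD// ler_wpM2l// subr_ge0.
rewrite (le_trans (JL _ _))//; first exact: near_orbit_ball seg.
  by rewrite (le_trans (yB t))// lerDl.
by rewrite ler_wpM2l.
Qed.

Variables (p : 'rV[R]_N -> 'rV[R]_N) (eps r : R).
Hypotheses (dp : forall x, differentiable p x) (eps0 : 0 <= eps).
Hypotheses (pB : forall x, `|p x| <= eps) (dpB : forall x v, `|'d p x v| <= eps * `|v|).
Hypotheses (r0 : 0 <= r) (r1 : r <= 1).
Hypothesis r_small : K * (r * (2 * N%:R * LJ + N%:R * BA + LF)) <= 4^-1.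
Hypothesis eps_small : K * (3 * eps) <= 4^-1.

Let G x := F x + p x.

Lemma small_lipschitz a b : `|p a - p b| <= eps * `|a - b|.
Proof.
apply: (@lipschitz_ball _ _ _ p (Num.max `|a| `|b|)) => //.
  by rewrite le_max lexx.
by rewrite le_max lexx orbT.
Qed.

(* Approximate solution of u' = (1 + s) (F + p)(u) with residual [E]. *)
Definition approx (beta d : R) (st : (R -> 'rV[R]_N) * R * (R -> 'rV[R]_N)) :=
  let: (u, s, E) := st in
  [/\ forall t : R, is_derive t 1 u ((1 + s) *: G (u t) - E t),
      continuous E, (forall t, u (t + T) = u t) /\ (forall t, E (t + T) = E t),
      forall t, `|E t| <= beta & (forall t, `|u t - y t| <= d) /\ `|s| <= d].

Lemma continuous_field (u : R -> 'rV[R]_N) : continuous u -> continuous (fun t => G (u t)).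
Proof.
move=> cu t; have [dF _] := sF 1%N.
apply: (@continuous_comp _ _ _ u G); first exact: cu.
by apply: differentiable_continuous; apply: differentiableD.
Qed.

(** The unknowns are the loop and the time scale 1 + s, the period being kept at [T]. The correction
    solves the linear equation with the residual as inhomogeneity; [r_small] and [eps_small] each
    leave at most a quarter of the old residual. *)
Lemma newton_step beta d st : 0 <= d -> approx beta d st -> d + K * beta <= r ->
  exists st', [/\ approx (beta / 2) (d + K * beta) st',
    forall t, `|st'.1.1 t - st.1.1 t| <= K * beta & `|st'.1.2 - st.1.2| <= K * beta].
Proof.
case: st => [[u s] E] d0 [du cE [peru perE] EB [uB sB]] dr.
have [z [q [dz perz zB qB]]] := solve cE perE EB.
have [dF _] := sF 1%N.
have beta0 : 0 <= beta by rewrite (le_trans _ (EB 0)).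
have k0 : 0 <= K * beta by rewrite mulr_ge0// ltW.
have cu : continuous u by move=> t; exact: (is_derive_continuous (du t)).
have cz : continuous z by move=> t; exact: (is_derive_continuous (dz t)).
have cy : continuous y by move=> t; exact: (is_derive_continuous (dy t)).
have cA : continuous A.
  apply: continuous_mx => i j.
  rewrite (_ : (fun t => _) = (fun t => ('D_(delta_mx 0 i) F (y t)) 0 j)); last first.
    by apply/funext => t; rewrite /A deriveE// /jacobian mxE.
  apply: continuous_entry => t.
  by apply: (@continuous_comp _ _ _ y ('D_(delta_mx 0 i) F)); [exact: cy|apply: (sF 1%N).2].
have cFy : continuous (fun t => F (y t)).
  by move=> t; apply: (@continuous_comp _ _ _ y F); [exact: cy|exact: differentiable_continuous].
pose v t := u t + z t.
have cv : continuous v by move=> t; apply: continuousD; [exact: cu|exact: cz].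
pose E' t := (1 + (s + q)) *: G (v t) - ((1 + s) *: G (u t) + z t *m A t + q *: F (y t)).
have vB t : `|v t - y t| <= d + K * beta.
  by rewrite /v addrAC (le_trans (ler_normD _ _))// lerD.
have s2 : `|1 + s| <= 2.
  by rewrite (le_trans (ler_normD _ _))// normr1 lerD2l (le_trans sB)// (le_trans _ r1)// (le_trans _ dr)// lerDl.
have d_r : d <= r by rewrite (le_trans _ dr)// lerDl.
have r01 : 0 <= r <= 1 by rewrite r0.
exists (v, s + q, E'); split => /=.
- split.
  + move=> t; have := is_deriveD (du t) (dz t).
    rewrite (_ : _ - _ + _ = (1 + (s + q)) *: G (v t) - E' t)// /E'.
    by move: (z t *m A t) => w; apply/rowP => j; rewrite !mxE; ring.
  + apply: continuous_subf; first by apply: continuous_scalef; exact: continuous_field.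
    apply: continuous_addf; last exact: continuous_scalef.
    apply: continuous_addf; last exact: continuous_mulmx.
    by apply: continuous_scalef; exact: continuous_field.
  + by split => t; rewrite /E' /v /A ?pery ?peru ?perz.
  + move=> t.
    (* Linearisation error, variation of [p], first-order term weighted by [s], change of [F] off
       the orbit weighted by [q], and [q] times [p]. These five terms are the origin of the summands
       in [r_small] and, through 2 + 1, of the factor 3 in [eps_small]. *)
    rewrite (_ : E' t = (1 + s) *: (F (v t) - F (u t) - (v t - u t) *m A t)
      + (1 + s) *: (p (v t) - p (u t)) + s *: (z t *m A t)
      + q *: (F (v t) - F (y t)) + q *: p (v t)); last first.
      rewrite /E' /G {4}/v [u t + _]addrC addrK.
      by move: (z t *m A t) => w; apply/rowP => j; rewrite !mxE; ring.
    have -> : beta / 2 = K * beta * (r * (2 * N%:R * LJ + N%:R * BA + LF))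
        + K * beta * (3 * eps) + beta * (4^-1 - K * (r * (2 * N%:R * LJ + N%:R * BA + LF)))
        + beta * (4^-1 - K * (3 * eps)) by field.
    rewrite -[X in X <= _]addr0 lerD//; last by rewrite mulr_ge0// subr_ge0.
    rewrite -[X in X <= _]addr0 lerD//; last by rewrite mulr_ge0// subr_ge0.
    have -> : K * beta * (r * (2 * N%:R * LJ + N%:R * BA + LF)) + K * beta * (3 * eps) =
      2 * (N%:R * (LJ * r) * (K * beta)) + 2 * (eps * (K * beta)) + r * (N%:R * (K * beta) * BA)
      + K * beta * (LF * r) + K * beta * eps by ring.
    have vuB : `|v t - u t| <= K * beta by rewrite /v [u t + _]addrC addrK.
    have uR : `|u t - y t| <= r by rewrite (le_trans (uB t)).
    have vR : `|v t - y t| <= r by rewrite (le_trans (vB t)).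
    rewrite (le_trans (ler_normD _ _))// lerD ?normrZ//; last by rewrite ler_pM.
    rewrite (le_trans (ler_normD _ _))// lerD ?normrZ//; last first.
      rewrite ler_pM// (le_trans (FL _ _))//; first exact: near_orbit_ball vR.
        by rewrite (le_trans (yB t))// lerDl.
      by rewrite ler_wpM2l.
    rewrite (le_trans (ler_normD _ _))// lerD ?normrZ//; last first.
      rewrite ler_pM//; first by rewrite (le_trans sB).
      rewrite (le_trans (mulmx_norm_le _ _))// ler_pM ?mulr_ge0// ?ler_wpM2l//.
    rewrite (le_trans (ler_normD _ _))// lerD ?normrZ//.
      rewrite ler_pM// (le_trans (linearisation_error r01 vR uR))//.
      by rewrite ler_wpM2l// !mulr_ge0.
    by rewrite ler_pM// (le_trans (small_lipschitz _ _))// ler_wpM2l.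
  + by split => //; rewrite (le_trans (ler_normD _ _))// lerD.
- by move=> t; rewrite /v [u t + _]addrC addrK.
- by rewrite [s + _]addrC addrK.
Qed.

Lemma newton_limit : 2 * K * eps <= r ->
  exists (u : R -> 'rV[R]_N) (s : R),
    [/\ forall t : R, is_derive t 1 u ((1 + s) *: G (u t)),
        forall t, u (t + T) = u t, forall t, `|u t - y t| <= r & `|s| <= r].
Proof.
move=> Kr; have [dF _] := sF 1%N.
(* The distance is the sum of the steps K eps / 2^i with i < n, so it stays below 2 K eps. *)
pose inv n := approx (eps / 2 ^+ n) (K * (2 * eps - 2 * eps / 2 ^+ n)).
pose close n (st st' : (R -> 'rV[R]_N) * R * (R -> 'rV[R]_N)) :=
  (forall t, `|st'.1.1 t - st.1.1 t| <= K * eps / 2 ^+ n) /\ `|st'.1.2 - st.1.2| <= K * eps / 2 ^+ n.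
have pow2_ge1 n : 1 <= 2 ^+ n :> R by rewrite exprn_ege1// ler1n.
have dn_le n : eps / 2 ^+ n <= eps.
  by rewrite ler_pdivrMr ?exprn_gt0// ler_peMr.
have dn0 n : 0 <= eps / 2 ^+ n by rewrite divr_ge0// exprn_ge0.
have dnr n : K * (2 * eps - 2 * eps / 2 ^+ n) <= r.
  rewrite (le_trans _ Kr)// -[leRHS]mulrA [leRHS]mulrCA (ler_wpM2l (ltW K0))// gerBl.
  by rewrite -mulrA mulr_ge0.
have step n st : inv n st -> exists st', inv n.+1 st' /\ close n st st'.
  move=> ist; have e2 : eps / 2 ^+ n / 2 = eps / 2 ^+ n.+1.
    by rewrite exprS invfM; ring.
  have d2 : K * (2 * eps - 2 * eps / 2 ^+ n) + K * (eps / 2 ^+ n)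
      = K * (2 * eps - 2 * eps / 2 ^+ n.+1).
    by rewrite -[2 * eps / 2 ^+ n.+1]mulrA -e2; field; rewrite expf_neq0.
  have [||st' [h1 h2 h3]] := newton_step _ ist.
  - by rewrite (mulr_ge0 (ltW K0))// subr_ge0 -mulrA ler_wpM2l.
  - by rewrite d2.
  by exists st'; rewrite /inv -e2 -d2; split => //; split => [t|]; rewrite -mulrA.
have cy : continuous y by move=> t; exact: (is_derive_continuous (dy t)).
(* The start is the unperturbed orbit at unchanged speed, whose residual is [p] along it. *)
have inv0 : inv 0%N (y, 0, fun t => p (y t)).
  rewrite /inv /= expr0 !divr1 subrr mulr0; split => //.
  - by move=> t; rewrite addr0 scale1r /G addrK.
  - by move=> t; apply: (@continuous_comp _ _ _ y p); [exact: cy|exact: differentiable_continuous].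
  - by split => // t; rewrite pery.
  - by split => [t|]; rewrite ?subrr ?normr0.
(* Dependent choice asks for a successor of every pair, so the invariant is a premise of [rel]; a
   pair violating it is its own successor. The counter travels with the iterate because the
   invariant depends on it. *)
pose rel (a b : nat * ((R -> 'rV[R]_N) * R * (R -> 'rV[R]_N))) :=
  inv a.1 a.2 -> [/\ b.1 = a.1.+1, inv b.1 b.2 & close a.1 a.2 b.2].
have relT a : {b | rel a b}.
  case: a => n st; apply: cid.
  have [/step[st' [h1 h2]]|nst] := pselect (inv n st); first by exists (n.+1, st').
  by exists (n, st).
have [f [f0 fS]] := dependent_choice relT (0%N, (y, 0, fun t => p (y t))).
have fI n : (f n).1 = n /\ inv n (f n).2.
  elim: n => [|n [IH1 IH2]]; first by rewrite f0.
  have := fS n; rewrite /rel IH1 => /(_ IH2)[E h _].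
  by rewrite E in h *.
have fC n : close n (f n).2 (f n.+1).2.
  by have := fS n; rewrite /rel (fI n).1 => /(_ (fI n).2)[].
pose u n := (f n).2.1.1; pose s n := (f n).2.1.2; pose E n := (f n).2.2.
have fA n : approx (eps / 2 ^+ n) (K * (2 * eps - 2 * eps / 2 ^+ n)) (u n, s n, E n).
  by have := (fI n).2; rewrite /inv /u /s /E; case: (f n).2 => -[].
have Ke0 : 0 <= K * eps by rewrite mulr_ge0// ltW.
have /choice[v Hv] (t : R) := @geometric_limit_mx _ _ (fun n => u n t) _ Ke0 (fun n => (fC n).1 t).
have [q Hq] : exists q : R, forall n, `|s n - q| <= 2 * (K * eps) / 2 ^+ n.
  exact: (@geometric_limit R^o s (K * eps) Ke0 (fun n => (fC n).2)).
have limE (a e : R) : 0 < e -> exists n, a / 2 ^+ n < e by exact: div_expr2_small.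
have limle (a b c : R) : (forall n, a <= b + c / 2 ^+ n) -> a <= b.
  move=> H; apply/ler_addgt0Pl => e e0; have [n /ltW ne] := limE c e e0.
  by rewrite (le_trans (H n))// addrC lerD.
have vy t : `|v t - y t| <= r.
  apply: (limle _ _ (2 * (K * eps))) => n; have [_ _ _ _ [uB _]] := fA n.
  rewrite -(subrKA (u n t)) (le_trans (ler_normD _ _))// addrC lerD//.
    by rewrite (le_trans (uB t)).
  by rewrite distrC Hv.
have qr : `|q| <= r.
  apply: (limle _ _ (2 * (K * eps))) => n; have [_ _ _ _ [_ sB]] := fA n.
  rewrite -[q](subrK (s n)) (le_trans (ler_normD _ _))// addrC lerD//.
    by rewrite (le_trans sB).
  by rewrite distrC Hq.
have cv : continuous v.
  apply: (uniform_limit_continuous (u := u) (e := fun n => 2 * (K * eps) / 2 ^+ n)) => //; last exact: limE.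
  by move=> n t; have [du _ _ _ _] := fA n; exact: (is_derive_continuous (du t)).
exists v, q; split => //; last first.
  move=> t; apply/eqP; rewrite -subr_eq0 -normr_le0.
  apply: (limle _ _ (2 * (2 * (K * eps)))) => n; rewrite add0r.
  have [_ _ [peru _] _ _] := fA n.
  rewrite -(subrKA (u n t)) (le_trans (ler_normD _ _))// -[X in u n X]addr0.
  have h1 := Hv (t + T) n; have h2 := Hv t n.
  rewrite -/(u n _) peru in h1.
  rewrite distrC addr0 (le_trans (lerD h1 h2))// le_eqVlt; apply/orP; left; apply/eqP.
  by field; rewrite expf_neq0.
pose C := 2 * (K * eps) * (BF + LF + eps) + 2 * (LF + eps) * (2 * (K * eps)) + eps + 2 * (K * eps).
apply: (@uniform_limit_is_derive _ _ _ u (fun n t => (1 + s n) *: G (u n t) - E n t)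
   v _ (fun n => C / 2 ^+ n)).
- by move=> n t; have [] := fA n.
- by apply: continuous_scalef; exact: continuous_field.
- move=> n t; rewrite (le_trans (Hv t n))// ler_wpM2r ?invr_ge0 ?exprn_ge0// lerDr.
  by rewrite !addr_ge0// !mulr_ge0// ?addr_ge0// ltW.
- move=> n t; have [_ _ _ EB [uB sB]] := fA n.
  have uR : `|u n t - y t| <= r by rewrite (le_trans (uB t)).
  have ub := near_orbit_ball r1 uR; have vb := near_orbit_ball r1 (vy t).
  have GL : `|G (u n t) - G (v t)| <= (LF + eps) * (2 * (K * eps) / 2 ^+ n).
    rewrite /G (_ : _ - _ = (F (u n t) - F (v t)) + (p (u n t) - p (v t))); last first.
      by apply/rowP => j; rewrite !mxE; ring.
    rewrite (le_trans (ler_normD _ _))// mulrDl lerD//.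
      by rewrite (le_trans (FL ub vb))// ler_wpM2l// Hv.
    by rewrite (le_trans (small_lipschitz _ _))// ler_wpM2l// Hv.
  have GB : `|G (u n t)| <= BF + LF + eps.
    rewrite /G (le_trans (ler_normD _ _))// lerD//.
    rewrite -(subrK (F (y t)) (F (u n t))) (le_trans (ler_normD _ _))// addrC lerD//.
    have yb : `|y t| <= By + 1 by rewrite (le_trans (yB t))// lerDl.
    rewrite (le_trans (FL ub yb))// ler_piMr//.
    by rewrite (le_trans uR).
  have q2 : `|1 + q| <= 2.
    by rewrite (le_trans (ler_normD _ _))// normr1 lerD2l (le_trans qr).
  rewrite (_ : _ - _ = (s n - q) *: G (u n t) + (1 + q) *: (G (u n t) - G (v t)) - E n t); last first.
    by apply/rowP => j; rewrite !mxE; ring.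
  rewrite (le_trans (ler_normB _ _))//.
  rewrite (_ : C / 2 ^+ n = 2 * (K * eps) / 2 ^+ n * (BF + LF + eps)
     + 2 * ((LF + eps) * (2 * (K * eps) / 2 ^+ n)) + eps / 2 ^+ n + 2 * (K * eps) / 2 ^+ n); last first.
    by rewrite /C; field; rewrite expf_neq0.
  rewrite -[X in X <= _]addr0 lerD//; last by rewrite divr_ge0 ?exprn_ge0// mulr_ge0.
  rewrite lerD// (le_trans (ler_normD _ _))// lerD// normrZ ler_pM//.
- exact: limE.
Qed.
End Newton.

(** * Minimal period and phase of the perturbed orbit *)

Section Persistence.
Variable R : realType.

Lemma lipschitz_fun_continuous (V W : normedModType R) (h : V -> W) (L : R) :
  0 <= L -> (forall a b, `|h a - h b| <= L * `|a - b|) -> continuous h.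
Proof.
move=> L0 hL a; apply/cvgrPdist_lt => e e0.
apply/nbhs_normP; exists (e / (L + 1)); first by rewrite /= divr_gt0// ltr_wpDl.
move=> b /=; rewrite ltr_pdivlMr ?ltr_wpDl// => ab.
rewrite (le_lt_trans (hL _ _))// (le_lt_trans _ ab)// mulrC ler_wpM2l// lerDl//.
Qed.

(** The largest displacement under a shift by [s] is continuous in [s] and positive for 0 < s < T,
    so it has a positive minimum on the compact middle part of the period. Shifts near 0 or [T]
    admit no uniform bound; [period_multiple] serves to avoid them. *)
Lemma minimal_period_gap N (y : R -> 'rV[R]_N) (T L : R) :
  0 < T -> 0 <= L -> (forall a b, `|y b - y a| <= L * `|b - a|) ->
  (forall s, 0 < s < T -> ~ (forall t, y (t + s) = y t)) ->
  (forall t, y (t + T) = y t) ->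
  exists2 m, 0 < m & forall s, T / 4 <= s <= 3 * T / 4 -> exists t, m <= `|y (t + s) - y t|.
Proof.
move=> T0 L0 yL noper pery.
pose D s := [set `|y (t + s) - y t| | t in [set: R]].
have DB s : ubound (D s) (L * `|s|) by move=> _ [t _ <-]; rewrite (le_trans (yL _ _))// addrC addKr.
have Dsup s : has_sup (D s).
  by split; [exists `|y (0 + s) - y 0|; exists 0|exists (L * `|s|)].
pose phi s := sup (D s).
have phi_ge s t : `|y (t + s) - y t| <= phi s.
  by apply: (sup_upper_bound (Dsup s)); exists t.
have phiL s s' : phi s <= phi s' + L * `|s - s'|.
  apply: ge_sup => [|_ [t _ <-]]; first by have [] := Dsup s.
  rewrite -(subrKA (y (t + s'))) (le_trans (ler_normD _ _))// addrC lerD//.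
  by rewrite (le_trans (yL _ _))// opprD addrACA subrr add0r.
have cphi : continuous phi.
  apply: (@lipschitz_fun_continuous R^o R^o phi L L0) => s s'.
  have h1 := phiL s s'; have h2 := phiL s' s; rewrite distrC in h2.
  by rewrite ler_norml; apply/andP; split; lra.
have TT : T / 4 <= 3 * T / 4 by rewrite ler_pM2r// ler_peMl ?ler1n// ltW.
have [c cI cmin] := EVT_min TT (continuous_subspaceT cphi).
rewrite in_itv /= in cI; case/andP: cI => c1 c2.
have c0 : 0 < phi c.
  rewrite lt_neqAle (le_trans (normr_ge0 _) (phi_ge c 0)) andbT eq_sym; apply/eqP => pc.
  apply: (noper c).
    rewrite (lt_le_trans _ c1) ?divr_gt0//= (le_lt_trans c2)// ltr_pdivrMr//.
    by rewrite mulrC ltr_pM2l// ltr_nat.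
  by move=> t; apply/eqP; rewrite -subr_eq0 -normr_le0 -pc.
exists (phi c / 2); first by rewrite divr_gt0.
move=> s sT; have cs : phi c <= phi s by apply: cmin; rewrite in_itv.
have c2s : phi c / 2 < phi s by rewrite (lt_le_trans _ cs)// ltr_pdivrMr// ltr_pMr// ltr1n.
have [_ [t _ <-] /ltW h] := sup_gt (Dsup s).1 c2s.
by exists t.
Qed.

(** The multiples of a period of at most T / 2 are too closely spaced to miss the middle half of
    [0, T]; a longer period is replaced by its complement T - s. *)
Lemma period_multiple (T s : R) (X : Type) (u : R -> X) :
  0 < s < T -> (forall t, u (t + s) = u t) -> (forall t, u (t + T) = u t) ->
  exists2 s', T / 4 <= s' <= 3 * T / 4 & forall t, u (t + s') = u t.
Proof.
have short r : 0 < r <= T / 2 -> (forall t, u (t + r) = u t) ->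
    exists2 s', T / 4 <= s' <= 3 * T / 4 & forall t, u (t + s') = u t.
  move=> /andP[r0 rT] per.
  have T0 : 0 < T by lra.
  have q0 : 0 <= T / 4 / r by rewrite !divr_ge0// ltW.
  have /andP[k1 k2] := truncn_itv q0.
  move: (Num.truncn _) k1 k2 => n; rewrite ler_pdivlMr// ltr_pdivrMr// => k1 k2.
  exists (n.+1%:R * r).
    move: k1 k2; rewrite -[n.+1%:R]natr1 mulrDl mul1r.
    by move=> h1 h2; apply/andP; split; lra.
  elim: (n.+1) => [|k IH] t; first by rewrite mul0r addr0.
  by rewrite -[k.+1%:R]natr1 mulrDl mul1r addrA per.
move=> /andP[s0 sT] pers perT.
have [sT2|sT2] := leP s (T / 2); first by apply: (short s); rewrite ?s0.
apply: (short (T - s)); first by apply/andP; split; lra.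
by move=> t; rewrite -pers -addrA subrK perT.
Qed.

(** Transversality in a form that survives uniformly small changes of the orbit: two points on
    opposite sides of the section stay there, and the intermediate value theorem finds a crossing
    between them. *)
Lemma sign_change_near (h : R -> R) (t0 c r : R) : is_derive t0 1 h c -> c != 0 -> h t0 = 0 ->
  0 < r -> exists2 d, 0 < d < r & h (t0 - d) * h (t0 + d) < 0.
Proof.
move=> [dh hc] c0 h0 r0.
have : (fun d => d^-1 *: (h (d *: 1 + t0) - h t0)) @ 0^' --> c by rewrite -hc.
move=> /cvgrPdist_lt /(_ (`|c| / 2)); rewrite divr_gt0 ?normr_gt0// => /(_ isT).
move=> [e /= e0 He].
pose d := Num.min e r / 2.
have m0 : 0 < Num.min e r by rewrite lt_min e0.
have d0 : 0 < d by rewrite divr_gt0.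
have dm : d < Num.min e r by rewrite ltr_pdivrMr// ltr_pMr// ltr1n.
have /andP[de dr] : (d < e) && (d < r) by rewrite -lt_min.
exists d; first by rewrite d0.
have H (x : R) : x != 0 -> `|x| < e -> 0 < c * (h (t0 + x) / x).
  move=> x0 xe; have := He x; rewrite /ball_ /= sub0r normrN => /(_ xe x0).
  rewrite h0 subr0 [x *: 1]mulr1 [_ *: _]mulrC [t0 + x]addrC; set q := _ / x => Hq.
  have : `|c * q - c * c| < c * c / 2.
    have -> : c * c = `|c| * `|c| by rewrite -normrM ger0_norm// -expr2 sqr_ge0.
    have -> : c * q - `|c| * `|c| = c * (q - c).
      by rewrite -normrM ger0_norm -?expr2 ?sqr_ge0// expr2 mulrBr.
    by rewrite normrM distrC -mulrA ltr_pM2l ?normr_gt0.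
  have c2 : 0 < c * c by rewrite -expr2 exprn_even_gt0.
  by rewrite ltr_norml => /andP[h1 _]; lra.
have h1 := H d (lt0r_neq0 d0); rewrite gtr0_norm// in h1; have {}h1 := h1 de.
have h2 := H (- d); rewrite oppr_eq0 normrN gtr0_norm// (lt0r_neq0 d0) in h2.
have {}h2 := h2 isT de.
have h3 := mulr_gt0 h1 h2.
have c2 : 0 < c * c by rewrite -expr2 exprn_even_gt0.
have E : c * (h (t0 + d) / d) * (c * (h (t0 - d) / (- d))) =
   - ((c * c) * (h (t0 - d) * h (t0 + d)) / (d * d)).
  by field; rewrite (lt0r_neq0 d0).
move: h3; rewrite E oppr_gt0 pmulr_llt0 ?invr_gt0 ?mulr_gt0//.
by rewrite pmulr_rlt0.
Qed.

(** Explicit real bounds in the max norm, for use in the analysis; [C1_norm_le] turns them into a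
    bound on [C1_norm] at the cost of the factor [norm_ratio]. *)
Definition C1_small N (eps : R) (p : 'rV[R]_N -> 'rV[R]_N) :=
  [/\ forall x, differentiable p x, forall x, `|p x| <= eps &
      forall x v, `|'d p x v| <= eps * `|v|].

Lemma periodic_orbit_lipschitz N (F : 'rV[R]_N -> 'rV[R]_N) y T :
  smooth F -> periodic_orbit F y T ->
  exists2 L, 0 < L & forall a b, `|y b - y a| <= L * `|b - a|.
Proof.
move=> sF [dy T0 pery _].
have cy : continuous y by move=> t; exact: (is_derive_continuous (dy t)).
have [|t|L L0 HL] := @periodic_bounded _ _ T (fun t => F (y t)) T0; last 2 first.
- by rewrite pery.
- by exists L => //; exact: (mean_value_global dy HL).
move=> t; apply: (@continuous_comp _ _ _ y F); first exact: cy.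
exact: (sF 0%N).
Qed.

Lemma hyperbolic_newton N (F : 'rV[R]_N -> 'rV[R]_N) y T : smooth F -> hyperbolic F y T ->
  forall rho, 0 < rho -> exists2 eps, 0 < eps & forall p, C1_small eps p ->
  exists (u : R -> 'rV[R]_N) (s : R),
    [/\ forall t : R, is_derive t 1 u ((1 + s) *: (F (u t) + p (u t))),
        forall t, u (t + T) = u t, forall t, `|u t - y t| <= rho & `|s| <= rho].
Proof.
move=> sF [[dy T0 pery noper] [M [[Y [Y0 dY YT]] [mu _]]]] rho rho0.
have [dF _] := sF 1%N.
have cy : continuous y by move=> t; exact: (is_derive_continuous (dy t)).
pose A t := 'J F (y t).
have cJ : continuous (fun x => 'J F x).
  apply: continuous_mx => i j.
  rewrite (_ : (fun t => _) = (fun x => ('D_(delta_mx 0 i) F x) 0 j)); last first.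
    by apply/funext => t; rewrite deriveE// /jacobian mxE.
  by apply: continuous_entry; apply: (sF 1%N).2.
have cA : continuous A.
  by move=> t; apply: (@continuous_comp _ _ _ y (fun x => 'J F x)); [exact: cy|exact: cJ].
have cFy : continuous (fun t => F (y t)).
  by move=> t; apply: (@continuous_comp _ _ _ y F); [exact: cy|exact: differentiable_continuous].
have perA t : A (t + T) = A t by rewrite /A pery.
have perF t : F (y (t + T)) = F (y t) by rewrite pery.
have dz (t : R) : is_derive t 1 (fun t => F (y t)) (F (y t) *m A t).
  have := is_derive_comp_diff (dF (y t)) (dy t).
  by rewrite -deriveE// deriveEjacobian.
(* The velocity is the periodic solution of the variational equation; were it zero at one time,
   uniqueness would make the orbit constant. *)
have z0 : F (y 0) != 0.
  apply/eqP => Fy0; apply: (noper (T / 2)).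
    by rewrite divr_gt0//= ltr_pdivrMr// ltr_pMr// ltr1n.
  move=> t; apply: is_derive0_cst => r.
  by have := dy r; rewrite (linear_unique T0 cA perA dz Fy0).
have [|K K0 solve] := linear_periodic_solve T0 cA perA Y0 dY dz z0 perF.
  by rewrite YT.
have [By By0 yB] := periodic_bounded T0 cy pery.
have [BF BF0 FB] := periodic_bounded T0 cFy perF.
have [BA BA0 AB] := periodic_bounded T0 cA perA.
have By1 : 0 <= By + 1 by rewrite addr_ge0// ltW.
have [LF LF0 FL] := Ck1_lipschitz_ball By1 (sF 1%N).
have [LJ LJ0 JL] := jacobian_lipschitz_ball By1 sF.
pose C := 2 * N%:R * LJ + N%:R * BA + LF.
have C0 : 0 <= C by rewrite !addr_ge0 ?mulr_ge0// ltW.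
have KC1 : 0 < 4 * (K * C + 1) by rewrite mulr_gt0// ltr_wpDl// mulr_ge0// ltW.
(* The last entry gives [r_small]. In [eps] below, r / (2 K) keeps the whole iteration within
   distance [r], and 1 / (12 K) gives [eps_small]. *)
pose r := Num.min (Num.min rho 1) (4 * (K * C + 1))^-1.
have r0 : 0 < r by rewrite !lt_min rho0 ltr01 invr_gt0.
have [rrho r1 rC] : [/\ r <= rho, r <= 1 & r <= (4 * (K * C + 1))^-1].
  by rewrite /r !ge_min !lexx ?orbT; split.
pose eps := Num.min (r / (2 * K)) (12 * K)^-1.
have eps0 : 0 < eps by rewrite lt_min divr_gt0 ?invr_gt0 ?mulr_gt0.
exists eps => // p [dp pB dpB].
have [|||u [s [h1 h2 h3 h4]]] := @newton_limit _ _ F y T sF dy pery K By BF BA LF LJ K0 solve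
  (ltW BF0) (ltW LF0) (ltW LJ0) yB FB AB FL JL p eps r dp (ltW eps0) pB dpB (ltW r0) r1.
- move: rC; rewrite -[leRHS]mul1r ler_pdivlMr// -/C => rC; have := ltW r0; lra.
- have : eps <= (12 * K)^-1 by rewrite ge_min lexx orbT.
  rewrite -[leRHS]mul1r ler_pdivlMr ?mulr_gt0//; lra.
- have : eps <= r / (2 * K) by rewrite ge_min lexx.
  by rewrite ler_pdivlMr ?mulr_gt0// mulrC.
exists u, s; split => // [t|]; first by rewrite (le_trans (h3 t)).
by rewrite (le_trans h4).
Qed.

(** Rescaling time by 1 + q turns the loop of [hyperbolic_newton] into a solution of period T (1 +
    q), and a translation in time puts it on the section at [t0]. *)
Theorem hyperbolic_persistence N (F : 'rV[R]_N -> 'rV[R]_N) y T (g : 'rV[R]_N -> R) (t0 : R) :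
  smooth F -> hyperbolic F y T -> smooth g -> g (y t0) = 0 ->
  'd g (y t0) (F (y t0)) <> 0 ->
  forall rho, 0 < rho -> exists2 eps, 0 < eps & forall p, C1_small eps p ->
  exists (v : R -> 'rV[R]_N) (S : R),
    [/\ periodic_orbit (F \+ p) v S, `|S - T| < rho,
        forall t, exists s, `|v t - y s| < rho, g (v t0) = 0 &
        forall t, `|t - t0| <= 1 -> `|v t - y t| < rho].
Proof.
move=> sF hyp sg gy dgF rho rho0; have [po _] := hyp; have [dy T0 pery noper] := po.
have [dg _] := sg 1%N.
have [L L0 yL] := periodic_orbit_lipschitz sF po.
have [m m0 gap] := minimal_period_gap T0 (ltW L0) yL noper pery.
have dgy : is_derive t0 1 (g \o y) ('d g (y t0) (F (y t0))).
  exact: is_derive_comp_diff (dg _) (dy t0).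
pose h0 := rho / (4 * L).
have h00 : 0 < h0 by rewrite divr_gt0// mulr_gt0.
have [h /andP[hp hh0] sgn] : exists2 d, 0 < d < h0 & (g \o y) (t0 - d) * (g \o y) (t0 + d) < 0.
  by apply: (sign_change_near dgy) => //; exact/eqP.
have cg : continuous g by exact: (sg 0%N).
have same_sign c : g c != 0 -> exists2 e, 0 < e & forall a, `|a - c| < e -> 0 < g a * g c.
  move=> gc; have /cvgrPdist_lt/(_ `|g c|) := cg c; rewrite normr_gt0 => /(_ gc).
  move=> /nbhs_normP[e /= e0 He]; exists e => // a ac.
  have := He a; rewrite /ball_ /= distrC => /(_ ac) H.
  have : `|(g a - g c) * g c| < `|g c| * `|g c| by rewrite normrM distrC ltr_pM2r// normr_gt0.
  rewrite -(normrM (g c)) (ger0_norm (_ : 0 <= g c * g c)) -?expr2 ?sqr_ge0// expr2 ltr_norml.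
  by move=> /andP[H1 _]; lra.
have [e1 e10 He1] : exists2 e, 0 < e & forall a b, `|a - y (t0 - h)| < e ->
    `|b - y (t0 + h)| < e -> g a * g b < 0.
  have /andP[s1 s2] : (g (y (t0 - h)) != 0) && (g (y (t0 + h)) != 0).
    by have := ltr0_neq0 sgn; rewrite /= mulf_eq0 negb_or.
  have [ea ea0 Ha] := same_sign _ s1; have [eb eb0 Hb] := same_sign _ s2.
  exists (Num.min ea eb); first by rewrite lt_min ea0.
  move=> a b; rewrite !lt_min => /andP[/Ha ha _] /andP[_ /Hb hb].
  have := mulr_gt0 ha hb; rewrite mulrACA => H.
  by move: sgn; rewrite /= => sgn; rewrite nmulr_lgt0// in H.
(* [e1] preserves the crossing of the section, [m] the minimality of the period, 1 / 2 bounds the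
   time scale from below and rho / (2 T) the change of period. The two remaining entries, with [h0],
   bound the distance to [y] after reparametrisation. *)
pose r := Num.min (Num.min (e1 / 2) (m / 4)) (Num.min (Num.min (rho / 8) (rho / (8 * L))) (Num.min (1/2) (rho / (2 * T)))).
have r0 : 0 < r by rewrite !lt_min !divr_gt0// ?mulr_gt0//.
have [r1 r2 [r3 r4] [r5 r6]] : [/\ r < e1, r <= m / 4, r <= rho / 8 /\ r <= rho / (8 * L)
    & r <= 1 / 2 /\ r <= rho / (2 * T)].
  have r1 : r <= e1 / 2 by rewrite /r !ge_min lexx.
  split; [|by rewrite /r !ge_min !lexx ?orbT|split|split]; last 4 first.
  - by rewrite /r !ge_min !lexx ?orbT.
  - by rewrite /r !ge_min !lexx ?orbT.
  - by rewrite /r !ge_min !lexx ?orbT.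
  - by rewrite /r !ge_min !lexx ?orbT.
  by rewrite (le_lt_trans r1)// ltr_pdivrMr// ltr_pMr// ltr1n.
have [eps eps0 Heps] := hyperbolic_newton sF hyp r0.
exists eps => // p psmall; have [dp _ _] := psmall.
have [u [q [du peru uy qr]]] := Heps p psmall.
have q1 : 1 / 2 <= 1 + q.
  by have := le_trans qr r5; rewrite ler_norml => /andP[h1 _]; lra.
have q0 : 0 < 1 + q by lra.
have cu : continuous u by move=> t; exact: (is_derive_continuous (du t)).
have prod : g (u (t0 - h)) * g (u (t0 + h)) < 0.
  by apply: He1; rewrite (le_lt_trans (uy _)).
have th : t0 - h <= t0 + h by lra.
have [||s0 s0I gs0] := @IVT R (g \o u) (t0 - h) (t0 + h) 0 th.
- by apply: continuous_subspaceT => t; apply: (@continuous_comp _ _ _ u g); [exact: cu|exact: cg].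
- rewrite ge_min le_max /=; move: prod; set a := g _; set b := g _ => prod.
  have [a0|a0] := leP a 0; have [b0|b0] := leP b 0; rewrite ?orbT /=.
  - by move: prod; rewrite ltNge mulr_le0.
  - by rewrite (ltW b0) orbT.
  - by rewrite (ltW a0).
  - by move: prod; rewrite ltNge ltW// mulr_gt0.
rewrite in_itv /= in s0I; case/andP: s0I => s0l s0r.
have s0t : `|s0 - t0| <= h by rewrite ler_distl s0l.
pose c := (1 + q)^-1; have c0 : 0 < c by rewrite invr_gt0.
have cq : c * (1 + q) = 1 by rewrite mulVf// gt_eqF.
pose v t := u (c * t + (s0 - c * t0)).
have Tq : 0 < T * (1 + q) by rewrite mulr_gt0.
have vp s t : v (t + s * (1 + q)) = u (c * t + (s0 - c * t0) + s).
  by rewrite /v; congr u; rewrite mulrDr mulrCA cq mulr1; ring.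
have Lr : L * r <= rho / 8.
  by move: r4; rewrite ler_pdivlMr ?mulr_gt0//; lra.
have Lh : L * h < rho / 4.
  by move: hh0; rewrite /h0 ltr_pdivlMr ?mulr_gt0//; lra.
exists v, (T * (1 + q)); split.
- split => //.
  + move=> t; have := is_derive_affine (u := u) (c := c) (d := s0 - c * t0) (t := t) (du _).
    by rewrite scalerA cq scale1r.
  + by move=> t; rewrite vp peru.
  (* A smaller period of [v] gives one of [u] below [T], hence one in the middle range, where [y] is
     displaced by at least [m] although [u] stays within m / 4 of it. *)
  + move=> s /andP[s_gt0 sT] pers.
    have [s' s'T Hs'] : exists2 s', T / 4 <= s' <= 3 * T / 4 & forall t, u (t + s') = u t.
      apply: (@period_multiple _ (c * s)) => //.
        rewrite mulr_gt0//= -(ltr_pM2r q0) mulrAC cq mul1r//.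
      move=> t; have := pers ((1 + q) * (t - (s0 - c * t0))).
      rewrite /v mulrDr !mulrA cq !mul1r.
      rewrite (_ : t - _ + c * s + _ = t + c * s); last by ring.
      by rewrite subrK.
    have [t mt] := gap _ s'T.
    have := le_lt_trans mt _ => /(_ m); rewrite ltxx => H; apply/notF/H.
    rewrite (_ : y (t + s') - y t = (y (t + s') - u (t + s')) + (u t - y t)); last first.
      by rewrite Hs'; apply/rowP => j; rewrite !mxE; ring.
    rewrite (le_lt_trans (ler_normD _ _))//.
    have h1 := uy (t + s'); have h2 := uy t; rewrite distrC in h1; lra.
- rewrite (_ : T * (1 + q) - T = T * q); last by ring.
  rewrite normrM gtr0_norm//; have := ler_wpM2l (ltW T0) (le_trans qr r6).
  rewrite (_ : T * (rho / (2 * T)) = rho / 2); last by field; rewrite gt_eqF.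
  lra.
- move=> t; exists (c * t + (s0 - c * t0)).
  by rewrite /v (le_lt_trans (uy _))//; lra.
- by rewrite /v subrKC.
- move=> t tt0.
  rewrite /v -(subrKA (y (c * t + (s0 - c * t0)))) (le_lt_trans (ler_normD _ _))//.
  have h1 := uy (c * t + (s0 - c * t0)).
  have h2 := yL t (c * t + (s0 - c * t0)).
  (* The two time parametrisations drift apart by c q (t - t0), bounded because [t] is within 1 of
     [t0], in addition to the offset s0 - t0. *)
  have h3 : `|c * t + (s0 - c * t0) - t| <= 2 * r + h.
    rewrite (_ : _ - t = (t - t0) * (- (c * q)) + (s0 - t0)); last first.
      by rewrite /c; field; rewrite gt_eqF.
    rewrite (le_trans (ler_normD _ _))// lerD// normrM normrN normrM (gtr0_norm c0).
    have c2 : c <= 2 by rewrite /c -(invrK 2) lef_pV2 ?posrE ?invr_gt0//; lra.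
    rewrite -[leRHS]mul1r ler_pM ?mulr_ge0// ?(ltW c0)// ler_pM// ltW//.
  have h4 := ler_wpM2l (ltW L0) h3; lra.
Qed.
End Persistence.

(** * Symmetrised perturbations *)

Section TrigonometricPolynomials.
Variable R : realType.

(* A class of maps closed under all the constructions below whose members are smooth and bounded
   together with their derivatives. *)
Definition trig (V W : normedModType R) (f : V -> W) : Prop :=
  exists (I : finType) (l : I -> {linear V -> R}) (th : I -> R) (a : I -> W),
    (forall i, continuous (l i)) /\ f = fun x => \sum_i cos (l i x + th i) *: a i.

(** Writing the derivative with a phase shift by pi / 2 instead of a sine keeps its form, so that
    [trig] is closed under differentiation. *)
Lemma is_diff_cos_comp (V : normedModType R) (l : {linear V -> R}) (th : R) (x : V) :
  continuous l ->
  is_diff x (fun y => cos (l y + th)) (fun v => cos (l x + (th + pi / 2)) * l v).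
Proof.
move=> cl.
have dl : is_diff x (l : V -> R) l.
  by apply: DiffDef; [exact: linear_differentiable|rewrite diff_lin].
have dlt := is_diffD dl (is_diff_cst (th : R) x).
rewrite addr0 in dlt.
have [dc vc] := is_derive_cos (l x + th).
have dcos : is_diff (l x + th) (cos : R -> R) (fun h => h *: (- sin (l x + th))).
  have dd : differentiable (cos : R -> R) (l x + th) by apply/derivable1_diffP.
  apply: DiffDef => //; apply/funext => h.
  by rewrite -vc deriveE// -linearZ /= /GRing.scale /= mulr1.
have := is_diff_comp dlt dcos; rewrite addrA cosDpihalf.
rewrite (_ : _ \o l = (fun v => - sin (l x + th) * l v))//.
by apply/funext => v /=; rewrite mulrC.
Qed.

Lemma is_diff_trig (V W : normedModType R) (I : finType) (l : I -> {linear V -> R})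
    (th : I -> R) (a : I -> W) x : (forall i, continuous (l i)) ->
  is_diff x (fun x => \sum_i cos (l i x + th i) *: a i)
    (fun v => \sum_i cos (l i x + (th i + pi / 2)) *: (l i v *: a i)).
Proof.
move=> cl.
rewrite (_ : (fun x => \sum_i _) = \sum_i (fun x => cos (l i x + th i) *: a i)); last first.
  by apply/funext => y; rewrite fct_sumE.
rewrite (_ : (fun v => \sum_i _) =
    \sum_i (fun v => cos (l i x + (th i + pi / 2)) *: (l i v *: a i))); last first.
  by apply/funext => y; rewrite fct_sumE.
elim/big_ind2: _ => [|f1 f2 g1 g2 h1 h2|i _].
- exact: is_diff_cst.
- exact: is_diffD.
- have [d1 e1] := is_diff_cos_comp (th i) x (cl i).
  apply: DiffDef; first exact: differentiableZl.
  by rewrite diffZl// e1; apply/funext => v /=; rewrite scalerA.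
Qed.

Lemma trig_derive (V W : normedModType R) (f : V -> W) : trig f ->
  (forall x, differentiable f x) /\ forall v, trig (fun x => 'd f x v).
Proof.
move=> [I [l [th [a [cl ->]]]]].
have H x := is_diff_trig th a x cl.
split => [x|v]; first by have [] := H x.
exists I, l, (fun i => th i + pi / 2), (fun i => l i v *: a i); split => //.
by apply/funext => x; have [_ ->] := H x.
Qed.

Lemma trig_smooth (V W : normedModType R) (f : V -> W) : trig f -> smooth f.
Proof.
move=> tf m; elim: m f tf => [|m IH] f tf /=; have [df tdf] := trig_derive tf.
  by move=> x; exact: differentiable_continuous.
split => // v; rewrite (_ : (fun x => _) = fun x => 'd f x v); first exact: IH.
by apply/funext => x; rewrite deriveE.
Qed.

Lemma trig_bounded (V W : normedModType R) (f : V -> W) : trig f ->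
  exists2 B, 0 < B & (forall x, `|f x| <= B) /\ forall x v, `|'d f x v| <= B * `|v|.
Proof.
have bnd (I : finType) (b : I -> R) (a : I -> W) :
    `|\sum_(i : I) cos (b i) *: a i| <= \sum_i `|a i|.
  rewrite (le_trans (ler_norm_sum _ _ _))// ler_sum// => i _.
  by rewrite normrZ ler_piMl// cos_max.
move=> [I [l [th [a [cl ->]]]]].
have /choice[k Hk] i : exists k : R, 0 < k /\ forall x, `|l i x| <= k * `|x|.
  by have [k k0 Hk] := linear_lipschitz (cl i); exists k.
have a0 : 0 <= \sum_i `|a i| by apply: sumr_ge0.
have ka0 : 0 <= \sum_i k i * `|a i|.
  by apply: sumr_ge0 => i _; rewrite mulr_ge0// ltW// (Hk i).1.
exists (\sum_i `|a i| + \sum_i k i * `|a i| + 1); first by rewrite ltr_wpDl// addr_ge0.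
split => [x|x v].
  by rewrite (le_trans (bnd _ _ _))// -addrA lerDl addr_ge0.
have [_ ->] := is_diff_trig th a x cl.
rewrite (le_trans (bnd _ _ _))// (@le_trans _ _ ((\sum_i k i * `|a i|) * `|v|))//; last first.
  by rewrite ler_wpM2r// addrAC lerDr addr_ge0.
rewrite mulr_suml ler_sum// => i _.
by rewrite normrZ mulrAC ler_wpM2r// (Hk i).2.
Qed.

Lemma trig_cst (V W : normedModType R) (c : W) : trig (fun _ : V => c).
Proof.
exists 'I_1, (fun=> \0), (fun=> 0), (fun=> c); split => [_|].
  exact: cst_continuous.
by apply/funext => x; rewrite big_ord1 addr0 cos0 scale1r.
Qed.

Lemma trigD (V W : normedModType R) (f g : V -> W) :
  trig f -> trig g -> trig (fun x => f x + g x).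
Proof.
move=> [I [l [th [a [cl ->]]]]] [J [l' [th' [a' [cl' ->]]]]].
exists (I + J)%type, (fun k => match k with inl i => l i | inr j => l' j end),
  (fun k => match k with inl i => th i | inr j => th' j end),
  (fun k => match k with inl i => a i | inr j => a' j end); split => [[i|j]|] //.
by apply/funext => x; rewrite big_sumType.
Qed.

Lemma trig_sum (V W : normedModType R) I (r : seq I) (P : pred I) (f : I -> V -> W) :
  (forall i, P i -> trig (f i)) -> trig (fun x => \sum_(i <- r | P i) f i x).
Proof.
move=> tf; elim: r => [|i r IH].
  by under eq_fun do rewrite big_nil; exact: trig_cst.
under eq_fun do rewrite big_cons.
have [Pi|//] := boolP (P i); exact: trigD (tf _ Pi) IH.
Qed.

Lemma trigZr (V W : normedModType R) (f : V -> R) (w : W) :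
  trig f -> trig (fun x => f x *: w).
Proof.
move=> [I [l [th [a [cl ->]]]]]; exists I, l, th, (fun i => a i *: w); split => //.
by apply/funext => x; rewrite scaler_suml; apply: eq_bigr => i _; rewrite scalerA.
Qed.

Lemma trig_comp (U V W : normedModType R) (L : {linear U -> V}) (f : V -> W) :
  continuous L -> trig f -> trig (fun x => f (L x)).
Proof.
move=> cL [I [l [th [a [cl ->]]]]].
exists I, (fun i => l i \o L), th, a; split => // i x.
by apply: continuous_comp; [exact: cL|exact: cl].
Qed.

Lemma trigM (V : normedModType R) (f g : V -> R) :
  trig f -> trig g -> trig (fun x => f x * g x).
Proof.
move=> [I [l [th [a [cl ->]]]]] [J [l' [th' [a' [cl' ->]]]]].
have cosM (x y : R) : cos x * cos y = cos (x + y) / 2 + cos (x - y) / 2.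
  by rewrite cosD cosB; field.
rewrite (_ : (fun x => _) = fun x => \sum_i \sum_j
    (cos ((l i \+ l' j) x + (th i + th' j)) *: (a i * a' j / 2)
     + cos ((l i \- l' j) x + (th i - th' j)) *: (a i * a' j / 2))); last first.
  apply/funext => x; rewrite mulr_suml; apply: eq_bigr => i _.
  rewrite mulr_sumr; apply: eq_bigr => j _.
  rewrite -[_ *: _ * _]/(cos (l i x + th i) * a i * (cos (l' j x + th' j) * a' j)).
  rewrite mulrACA cosM -[in RHS]scalerDl /GRing.scale /=.
  rewrite [l i x + l' j x + _]addrACA [l i x - l' j x + _]addrACA -opprD.
  by field.
apply: trig_sum => i _; apply: trig_sum => j _; apply: trigD.
- exists 'I_1, (fun=> l i \+ l' j), (fun=> th i + th' j), (fun=> a i * a' j / 2).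
  split => [_ x|]; first by apply: continuousD; [exact: cl|exact: cl'].
  by apply/funext => x; rewrite big_ord1.
- exists 'I_1, (fun=> l i \- l' j), (fun=> th i - th' j), (fun=> a i * a' j / 2).
  split => [_ x|]; first by apply: continuousB; [exact: cl|exact: cl'].
  by apply/funext => x; rewrite big_ord1.
Qed.

End TrigonometricPolynomials.

(** * Linear functionals and peak functions *)

Section LinearMaps.
Variable R : realType.

Definition entry m n i j (M : 'M[R]_(m, n)) : R := M i j.

Lemma entry_is_linear m n i j : linear (@entry m n i j).
Proof. by move=> a u v; rewrite /entry !mxE. Qed.
HB.instance Definition _ m n i j :=
  GRing.isLinear.Build R 'M[R]_(m, n) R _ (@entry m n i j) (@entry_is_linear m n i j).

Lemma linear_rV_continuous n (V : normedModType R) (f : {linear 'rV[R]_n -> V}) :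
  continuous f.
Proof.
apply/linear_bounded_continuous/linear_boundedP.
near=> r => x; rewrite {1}[x]row_sum_delta linear_sum.
rewrite (le_trans (ler_norm_sum _ _ _))//.
rewrite (@le_trans _ _ ((\sum_i `|f (delta_mx 0 i)|) * `|x|))//.
  rewrite mulr_suml ler_sum// => i _; rewrite linearZ /= normrZ mulrC.
  by rewrite ler_wpM2l// mx_entry_le.
by rewrite ler_wpM2r//; near: r; exact: nbhs_pinfty_ge.
Unshelve. all: by end_near. Qed.

Lemma linear_pair_continuous m n (V : normedModType R)
    (f : {linear ('rV[R]_m * 'rV[R]_n)%type -> V}) : continuous f.
Proof.
have l1 : linear (fun u : 'rV[R]_m => f (u, 0)).
  move=> a u v; rewrite -linearP; congr (f _).
  by rewrite -[RHS]/(a *: u + v, a *: (0 : 'rV[R]_n) + 0) scaler0 addr0.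
have l2 : linear (fun u : 'rV[R]_n => f (0, u)).
  move=> a u v; rewrite -linearP; congr (f _).
  by rewrite -[RHS]/(a *: (0 : 'rV[R]_m) + 0, a *: u + v) scaler0 addr0.
pose f1 : {linear 'rV[R]_m -> V} := HB.pack (fun u : 'rV[R]_m => f (u, 0))
  (GRing.isLinear.Build _ _ _ _ _ l1).
pose f2 : {linear 'rV[R]_n -> V} := HB.pack (fun u : 'rV[R]_n => f (0, u))
  (GRing.isLinear.Build _ _ _ _ _ l2).
have -> : (f : _ -> V) = fun z => f1 z.1 + f2 z.2.
  apply/funext => -[u v] /=; rewrite -linearD; congr (f _).
  by rewrite -[RHS]/(u + 0, 0 + v) addr0 add0r.
apply: (@continuous_addf _ _ _ (fun z => f1 z.1) (fun z => f2 z.2)) => z.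
  apply: (@continuous_comp _ _ _ fst f1); first exact: cvg_fst.
  exact: linear_rV_continuous.
apply: (@continuous_comp _ _ _ snd f2); first exact: cvg_snd.
exact: linear_rV_continuous.
Qed.

(** The scale [w] makes the phase run from 0 at [P] to pi at [Q], where 1 / 2 + cos / 2 takes the
    values 1 and 0. *)
Lemma trig_separate (V : normedModType R) (P Q : V) (l : {linear V -> R}) :
  continuous l -> l Q != l P -> exists phi : V -> R,
    [/\ trig phi, forall x, 0 <= phi x <= 1, phi P = 1 & phi Q = 0].
Proof.
move=> cl lPQ; pose w := pi / (l Q - l P).
exists (fun x => 1 / 2 + cos (w * (l x - l P)) / 2); split.
- apply: trigD; first exact: trig_cst.
  exists 'I_1, (fun=> w \*: l), (fun=> - (w * l P)), (fun=> 1 / 2); split.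
    by move=> _ x; apply: (@continuous_scalef _ _ _ w l).
  by apply/funext => x; rewrite big_ord1 /GRing.scale /= mulrBr mul1r.
- move=> x; have := cos_max (w * (l x - l P)); rewrite ler_norml => /andP[h1 h2].
  by apply/andP; split; lra.
- by rewrite subrr mulr0 cos0; field.
- by rewrite /w divfK ?subr_eq0// cospi; field.
Qed.

(** A product with one separating factor for each point to be killed; between these points it may
    well be large. *)
Lemma trig_peak (V : normedModType R) (P : V) (Qs : seq V) :
  (forall Q, Q != P -> exists2 l : {linear V -> R}, continuous l & l Q != l P) ->
  exists phi : V -> R, [/\ trig phi, forall x, 0 <= phi x <= 1, phi P = 1 &
    forall Q, Q \in Qs -> Q != P -> phi Q = 0].
Proof.
move=> sep; elim: Qs => [|Q Qs [phi [tphi phi01 phiP phiQ]]].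
  by exists (fun=> 1); split => //; [exact: trig_cst|rewrite ler01 lexx].
have [->|QP] := eqVneq Q P.
  by exists phi; split => // Q'; rewrite inE => /predU1P[->|/phiQ//]; rewrite eqxx.
have [l cl lPQ] := sep Q QP.
have [psi [tpsi psi01 psiP psiQ]] := trig_separate cl lPQ.
exists (fun x => psi x * phi x); split; first exact: trigM.
- move=> x; have /andP[a1 a2] := psi01 x; have /andP[b1 b2] := phi01 x.
  by rewrite mulr_ge0//= -[leRHS]mulr1 ler_pM.
- by rewrite psiP phiP mulr1.
- move=> Q'; rewrite inE => /predU1P[->|/phiQ h]; first by rewrite psiQ mul0r.
  by move=> /h ->; rewrite mulr0.
Qed.

Lemma pair_separate m n (Q P : 'rV[R]_m * 'rV[R]_n) : Q != P ->
  exists2 l : {linear ('rV[R]_m * 'rV[R]_n)%type -> R}, continuous l & l Q != l P.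
Proof.
case: Q P => [q1 q2] [p1 p2]; rewrite -pair_eqE /pair_eq /= negb_and => /orP[]; move=> /eqP/rowP/existsNP[j /eqP h].
  by exists (entry 0 j \o fst) => //; exact: linear_pair_continuous.
by exists (entry 0 j \o snd) => //; exact: linear_pair_continuous.
Qed.
End LinearMaps.

(** * Coordinates of products of Euclidean spaces *)

Section Products.
Variable R : realType.

Lemma tr_id n (u : 'rV[R]_n) : tr n u = u.
Proof. exact: conform_mx_id. Qed.

Lemma tr_tr m n p (u : 'rV[R]_m) : m = n -> tr p (tr n u) = tr p u.
Proof. by move=> mn; move: u; rewrite mn => u; rewrite tr_id. Qed.

Lemma tr_is_linear m n : linear (@tr R m n).
Proof.
move=> a u v; have [mn|mn] := eqVneq m n.
  by move: u v; rewrite mn => u v; rewrite !tr_id.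
rewrite /tr !nonconform_mx ?mn ?orbT//; by rewrite scaler0 addr0.
Qed.
HB.instance Definition _ m n :=
  GRing.isLinear.Build R 'rV[R]_m 'rV[R]_n _ (@tr R m n) (@tr_is_linear m n).

Lemma tr_entry m n (u : 'rV[R]_m) (i : 'I_m) (j : 'I_n) :
  m = n -> i = j :> nat -> tr n u 0 j = u 0 i.
Proof.
move=> mn; move: u i; rewrite mn => u i ij; rewrite tr_id; congr (u _ _).
exact/esym/val_inj.
Qed.

Lemma tr_norm_le m n (u : 'rV[R]_m) : `|tr n u| <= `|u|.
Proof.
have [mn|mn] := eqVneq m n; first by move: u; rewrite mn => u; rewrite tr_id.
by rewrite /tr nonconform_mx ?mn ?orbT// normr0.
Qed.

Variables (I : finType) (k : I -> nat).

Lemma fcoord_pack (u : forall i, 'rV[R]_(k i)) i : fcoord (pack u) i = u i.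
Proof.
rewrite /fcoord /pack mxrowK.
suff H i' (e : i' = i) : castmx (erefl, congr1 k e) (u i') = u i by exact: H.
by case: _ / e; rewrite castmx_id.
Qed.

Lemma fcoord_entry i (j : 'I_(k i)) :
  exists l, forall x : prodsp R k, fcoord x i 0 j = x 0 l.
Proof.
exists (tagnat.Rank (enum_rank i) (cast_ord (esym (congr1 k (enum_rankK i))) j)).
by move=> x; rewrite /fcoord castmxE /submxrow !mxE cast_ord_id.
Qed.

Lemma entry_fcoord (l : 'I_(total_dim k)) :
  exists i j, forall x : prodsp R k, x 0 l = fcoord x i 0 j.
Proof.
pose a := tagnat.sig1 l; pose j := tagnat.sig2 l.
exists (enum_val a), j => x.
have -> : fcoord x (enum_val a) = submxrow x a.
  suff H b (ba : b = a) (e : enum_val b = enum_val a) :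
      castmx (erefl, congr1 k e) (submxrow x b) = submxrow x a.
    by apply: H; rewrite enum_valK.
  by move: e; rewrite ba => e; rewrite (eq_irrelevance e erefl) castmx_id.
by rewrite -[x in LHS]submxrowK mxE.
Qed.

Definition proj i (x : prodsp R k) := fcoord x i.

Lemma proj_is_linear i : linear (proj i).
Proof.
move=> a x y; apply/rowP => j; have [l Hl] := fcoord_entry j.
by rewrite !mxE /proj !Hl !mxE.
Qed.
HB.instance Definition _ i :=
  GRing.isLinear.Build R (prodsp R k) 'rV[R]_(k i) _ (proj i) (proj_is_linear i).

Lemma fcoordD x y i : fcoord (x + y : prodsp R k) i = fcoord x i + fcoord y i.
Proof. exact: (linearD (proj i)). Qed.

Lemma fcoordB x y i : fcoord (x - y : prodsp R k) i = fcoord x i - fcoord y i.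
Proof. exact: (linearB (proj i)). Qed.

Lemma fcoordZ a x i : fcoord (a *: x : prodsp R k) i = a *: fcoord x i.
Proof. by rewrite -/(proj i _) linearZ. Qed.

Lemma fcoord0 i : fcoord (0 : prodsp R k) i = 0.
Proof. exact: (linear0 (proj i)). Qed.

Lemma fcoord_ext (x y : prodsp R k) : (forall i, fcoord x i = fcoord y i) -> x = y.
Proof. by move=> xy; apply/rowP => l; have [i [j H]] := entry_fcoord l; rewrite !H xy. Qed.

Lemma fcoord_norm_le (x : prodsp R k) i : `|fcoord x i| <= `|x|.
Proof.
apply: mx_norm_le => // i' j; rewrite ord1; have [l ->] := fcoord_entry j.
exact: mx_entry_le.
Qed.

Lemma norm_le_fcoord (x : prodsp R k) e :
  0 <= e -> (forall i, `|fcoord x i| <= e) -> `|x| <= e.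
Proof.
move=> e0 xe; apply: mx_norm_le => // i' l; rewrite ord1.
by have [i [j ->]] := entry_fcoord l; rewrite (le_trans (mx_entry_le _ _ _)).
Qed.

End Products.

(** * Local states, pullbacks and symmetrised maps *)

Section LocalStates.
Variables (R : realType) (G : network) (k : node G -> nat).
Hypothesis hk : node_spaces k.

Notation local c := ('rV[R]_(k c) * input_state R k c)%type.

Lemma input_iso_dim (c d : node G) (b : inputs c -> inputs d) :
  input_iso b -> k c = k d.
Proof. by move=> ib; have [_ _ h] := hk; apply: h; exists b. Qed.

Lemma input_iso_tail_dim (c d : node G) (b : inputs c -> inputs d) e :
  input_iso b -> tail_dim k e = tail_dim k (b e).
Proof. by move=> ib; have [_ h _] := hk; apply: h; apply: state_equiv_tail. Qed.

Lemma input_iso_id (c : node G) : input_iso (@id (inputs c)).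
Proof.
split; first by have [] := node_typeP c c c.
  by exists id.
by move=> e; have [] := arrow_typeP (arr e) (arr e) (arr e).
Qed.

Lemma input_iso_comp (a c d : node G) (b' : inputs a -> inputs c) (b : inputs c -> inputs d) :
  input_iso b' -> input_iso b -> input_iso (b \o b').
Proof.
move=> [n1 b1 a1] [n2 b2 a2]; split; last 2 first.
- exact: bij_comp.
- move=> e; have [_ tr_] := arrow_typeP (arr e) (arr (b' e)) (arr (b (b' e))).
  by rewrite tr_.
- by have [_ tr_] := node_typeP a c d; rewrite tr_.
Qed.

Lemma input_iso_inv (c d : node G) (b : inputs c -> inputs d) : input_iso b ->
  exists b' : inputs d -> inputs c, [/\ input_iso b', cancel b b' & cancel b' b].
Proof.
move=> [n1 [b' bK Kb] a1]; exists b'; split => //; split.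
- have [rc tr_] := node_typeP c d c; by rewrite -tr_// rc.
- by exists b.
- move=> e; have := a1 (b' e); rewrite Kb => h.
  have [rc tr_] := arrow_typeP (arr (b' e)) (arr e) (arr (b' e)).
  by rewrite -tr_// rc.
Qed.

Definition local_state (c : node G) (x : state R k) : local c :=
  (fcoord x c, tail_states x c).

(** In this notation the compatibility clause of [admissible_components] equates [fh d z] with
    [fh c (pull b z)], up to [tr]. *)
Definition pull (c d : node G) (b : inputs c -> inputs d) (z : local d) : local c :=
  (tr (k c) z.1, pullback b z.2).

Lemma local_state_is_linear c : linear (local_state c).
Proof.
move=> a x y; rewrite -[RHS]/(a *: fcoord x c + fcoord y c, a *: tail_states x c + tail_states y c).
congr (_, _); first by rewrite fcoordD fcoordZ.
by apply: fcoord_ext => e; rewrite !(fcoordD, fcoordZ, fcoord_pack).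
Qed.
HB.instance Definition _ c := GRing.isLinear.Build R (state R k) (local c) _
  (local_state c) (local_state_is_linear c).

Lemma pull_is_linear c d (b : inputs c -> inputs d) : linear (pull b).
Proof.
move=> a [x1 x2] [y1 y2].
rewrite -[RHS]/(a *: tr _ x1 + tr _ y1, a *: pullback b x2 + pullback b y2).
congr (_, _); first by rewrite /= linearP.
by apply: fcoord_ext => e; rewrite !(fcoordD, fcoordZ, fcoord_pack) linearP.
Qed.
HB.instance Definition _ c d (b : inputs c -> inputs d) :=
  GRing.isLinear.Build R (local d) (local c) _ (pull b) (pull_is_linear b).

Lemma pull_comp a c d (b' : inputs a -> inputs c) (b : inputs c -> inputs d) z :
  input_iso b -> pull b' (pull b z) = pull (b \o b') z.
Proof.
move=> ib; congr (_, _); first by rewrite /= tr_tr// (input_iso_dim ib).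
apply: fcoord_ext => e; rewrite !fcoord_pack tr_tr//.
by rewrite (input_iso_tail_dim _ ib).
Qed.

Lemma pull_id c (z : local c) : pull id z = z.
Proof.
case: z => u y; rewrite /pull /= tr_id; congr (_, _).
by apply: fcoord_ext => e; rewrite fcoord_pack tr_id.
Qed.

(* The average over input isomorphisms makes the components compatible with pullbacks. *)
Definition symmetrised c (phi : local c -> R) (w : 'rV[R]_(k c)) : components R k :=
  fun d z => \sum_(b : {ffun inputs c -> inputs d} | `[< input_iso b >]) phi (pull b z) *: tr (k d) w.

Definition sym_map c phi w (x : state R k) : state R k :=
  pack (fun d => @symmetrised c phi w d (local_state d x)).

Lemma trig_symmetrised c phi w d : trig phi -> trig (@symmetrised c phi w d).
Proof.
move=> tphi; apply: trig_sum => b _; apply: trigZr.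
exact: (trig_comp (@linear_pair_continuous _ _ _ _ (pull b)) tphi).
Qed.

Lemma trig_entrywise (V : normedModType R) n (f : V -> 'rV[R]_n) :
  (forall j, trig (fun x => f x 0 j)) -> trig f.
Proof.
move=> tf; rewrite (_ : f = fun x => \sum_j f x 0 j *: delta_mx 0 j).
  by apply: trig_sum => j _; apply: trigZr.
by apply/funext => x; rewrite -row_sum_delta.
Qed.

Lemma trig_entry (V : normedModType R) n (f : V -> 'rV[R]_n) j :
  trig f -> trig (fun x => f x 0 j).
Proof.
move=> [I [l [th [a [cl ->]]]]]; exists I, l, th, (fun i => a i 0 j); split => //.
by apply/funext => x; rewrite summxE; apply: eq_bigr => i _; rewrite mxE.
Qed.

Lemma trig_sym_map c phi w : trig phi -> trig (@sym_map c phi w).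
Proof.
move=> tphi; apply: trig_entrywise => l; have [d [j H]] := entry_fcoord R l.
under eq_fun do rewrite H fcoord_pack.
apply: trig_entry.
exact: (trig_comp (@linear_rV_continuous _ _ _ (local_state d)) (trig_symmetrised _ _ tphi)).
Qed.

(** Composition with an input isomorphism [b] from d to d' maps the input isomorphisms from c to d
    bijectively onto those from c to d', so the sum for d' is the sum for d at the pulled back
    state. *)
Lemma sym_map_admissible c phi w : trig phi -> admissible (@sym_map c phi w).
Proof.
move=> tphi; split; first exact/trig_smooth/trig_sym_map.
exists (@symmetrised c phi w); split.
- by move=> d; exact/trig_smooth/trig_symmetrised.
- by move=> x d; rewrite fcoord_pack.
- move=> d d' b ib u y; rewrite -[(tr (k d) u, _)]/(pull b (u, y)) /symmetrised linear_sum.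
  have kd := input_iso_dim ib.
  have [b' [ib' bK Kb]] := input_iso_inv ib.
  rewrite (reindex (fun h : {ffun inputs c -> inputs d} => [ffun e => b (h e)])); last first.
    exists (fun h : {ffun inputs c -> inputs d'} => [ffun e => b' (h e)]) => h _;
      by apply/ffunP => e; rewrite !ffunE ?bK ?Kb.
  have bh (h : {ffun inputs c -> inputs d}) : [ffun e => b (h e)] = b \o h :> (_ -> _).
    by apply/funext => e; rewrite ffunE.
  apply: eq_big => h; rewrite ?bh.
    apply/asboolP/asboolP => ih; last exact: input_iso_comp.
    rewrite (_ : (h : _ -> _) = b' \o (b \o h)); first exact: input_iso_comp.
    by apply/funext => e /=; rewrite bK.
  by move=> /asboolP ih; rewrite pull_comp// [RHS]linearZ /= tr_tr// kd (input_iso_dim ih).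
Qed.
End LocalStates.

(** * Norms and linear combinations of admissible perturbations *)

Section Perturbations.
Variables (R : realType) (G : network) (k : node G -> nat).
Hypothesis hk : node_spaces k.

Lemma eucl_norm_le m (u : 'rV[R]_m) : eucl_norm u <= m%:R * `|u|.
Proof.
rewrite /eucl_norm -(ger0_norm (_ : 0 <= m%:R * `|u|)) ?mulr_ge0// -sqrtr_sqr.
rewrite ler_sqrt ?sqr_ge0//.
rewrite (@le_trans _ _ (m%:R * `|u| ^+ 2))//.
  rewrite (le_trans (ler_sum _ (G := fun=> `|u| ^+ 2) _))//; last first.
    by rewrite sumr_const card_ord mulr_natl.
  by move=> j _; rewrite -[leLHS]ger0_norm ?sqr_ge0// normrX lerXn2r ?nnegrE// mx_entry_le.
rewrite exprMn ler_wpM2r ?sqr_ge0//.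
by case: m u => [|m] u; rewrite ?expr0n//= -natrX ler_nat leq_pmulr.
Qed.

Definition norm_ratio : R := \sum_c (k c)%:R + 1.

Lemma norm_ratio_gt0 : 0 < norm_ratio.
Proof. by rewrite /norm_ratio ltr_wpDl// sumr_ge0. Qed.

Lemma state_norm_le (x : state R k) : state_norm x <= norm_ratio * `|x|.
Proof.
apply: bigmax_le => [|c _]; first by rewrite mulr_ge0// ltW// norm_ratio_gt0.
rewrite (le_trans (eucl_norm_le _))// ler_pM// ?fcoord_norm_le//.
by rewrite /norm_ratio (bigD1 c)//= -addrA lerDl addr_ge0// sumr_ge0.
Qed.

Lemma norm_le_state_norm (x : state R k) : `|x| <= state_norm x.
Proof.
have s0 : 0 <= state_norm x by apply: bigmax_ge_id.
apply: norm_le_fcoord => // c; apply: mx_norm_le => // i j; rewrite ord1.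
rewrite (le_trans _ (le_bigmax _ (fun c => eucl_norm (fcoord x c)) c))//.
rewrite -sqrtr_sqr ler_sqrt; last by apply: sumr_ge0 => l _; rewrite sqr_ge0.
by rewrite (bigD1 j)//= lerDl; apply: sumr_ge0 => l _; rewrite sqr_ge0.
Qed.

Lemma C1_norm_le (p : state R k -> state R k) eta : 0 <= eta -> C1_small eta p ->
  (C1_norm p <= (norm_ratio * eta)%:E)%E.
Proof.
move=> eta0 [_ pB dpB]; apply: ge_ereal_sup => _ [x _ <-].
have le_eta u : `|u| <= eta -> (state_norm (u : state R k) <= norm_ratio * eta).
  by move=> ue; rewrite (le_trans (state_norm_le _))// ler_wpM2l// ltW// norm_ratio_gt0.
rewrite ge_max lee_fin le_eta//=; apply: ge_ereal_sup => _ [v /= v1 <-].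
rewrite lee_fin le_eta// (le_trans (dpB _ _))// ler_piMr//.
exact: le_trans (norm_le_state_norm v) v1.
Qed.

Lemma Ck_add (V W : normedModType R) m (f g : V -> W) :
  Ck m f -> Ck m g -> Ck m (fun x => f x + g x).
Proof.
elim: m f g => [|m IH] f g /=; first exact: continuous_addf.
move=> [df cf] [dg cg]; split => [x|v]; first exact: differentiableD.
rewrite (_ : (fun x => _) = fun x => 'D_v f x + 'D_v g x); first exact: IH.
by apply/funext => x; rewrite deriveD//; exact: diff_derivable.
Qed.

Lemma Ck_scale (V W : normedModType R) m (a : R) (f : V -> W) :
  Ck m f -> Ck m (fun x => a *: f x).
Proof.
elim: m f => [|m IH] f /=; first exact: continuous_scalef.
move=> [df cf]; split => [x|v]; first exact: differentiableZ.
rewrite (_ : (fun x => _) = fun x => a *: 'D_v f x); first exact: IH.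
by apply/funext => x; rewrite deriveZ//; exact: diff_derivable.
Qed.

Lemma admissible_add (f g : state R k -> state R k) :
  admissible f -> admissible g -> admissible (fun x => f x + g x).
Proof.
move=> [sf [fh [h1 h2 h3]]] [sg [gh [g1 g2 g3]]]; split => [m|]; first exact: Ck_add.
exists (fun c z => fh c z + gh c z); split.
- by move=> c m; apply: Ck_add; [exact: h1|exact: g1].
- by move=> x c; rewrite fcoordD h2 g2.
- by move=> c d b ib u y; rewrite (h3 _ _ b)// (g3 _ _ b)// linearD.
Qed.

Lemma admissible_scale (a : R) (f : state R k -> state R k) :
  admissible f -> admissible (fun x => a *: f x).
Proof.
move=> [sf [fh [h1 h2 h3]]]; split => [m|]; first exact: Ck_scale.
exists (fun c z => a *: fh c z); split.
- by move=> c m; apply: Ck_scale; exact: h1.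
- by move=> x c; rewrite fcoordZ h2.
- by move=> c d b ib u y; rewrite (h3 _ _ b)// linearZ.
Qed.

Lemma admissible0 : admissible (fun _ : state R k => 0 : state R k).
Proof.
have t0 (V W : normedModType R) : smooth (fun _ : V => 0 : W) by apply: trig_smooth; exact: trig_cst.
split; first exact: t0.
exists (fun c z => 0); split; first by move=> c; exact: t0.
- by move=> x c; rewrite fcoord0.
- by move=> c d b ib u y; rewrite linear0.
Qed.

Lemma admissible_sum (I : finType) (lam : I -> R) (Q : I -> state R k -> state R k) :
  (forall i, admissible (Q i)) -> admissible (fun x => \sum_i lam i *: Q i x).
Proof.
move=> aQ; elim: (index_enum I) => [|i r IH].
  by under eq_fun do rewrite big_nil; exact: admissible0.
under eq_fun do rewrite big_cons.
by apply: admissible_add => //; exact: admissible_scale.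
Qed.

Lemma admissible_local (f : state R k -> state R k) x y c :
  admissible f -> local_state c x = local_state c y -> fcoord (f x) c = fcoord (f y) c.
Proof. by move=> [_ [fh [_ h _]]] xy; rewrite !h -/(local_state c x) xy. Qed.

Lemma C1_small0 N eta : 0 <= eta -> C1_small eta (fun _ : 'rV[R]_N => 0 : 'rV[R]_N).
Proof.
move=> eta0; split => [x|x|x v]; first exact: differentiable_cst.
  by rewrite normr0.
by rewrite diff_cst normr0 mulr_ge0.
Qed.

Lemma C1_smallD N a b (f g : 'rV[R]_N -> 'rV[R]_N) :
  C1_small a f -> C1_small b g -> C1_small (a + b) (fun x => f x + g x).
Proof.
move=> [df f0 f1] [dg g0 g1]; split => [x|x|x v]; first exact: differentiableD.
  by rewrite (le_trans (ler_normD _ _))// lerD.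
by rewrite (@diffD _ _ _ f g)// (le_trans (ler_normD _ _))// mulrDl lerD.
Qed.

Lemma C1_smallZ N a c (f : 'rV[R]_N -> 'rV[R]_N) :
  C1_small a f -> C1_small (`|c| * a) (fun x => c *: f x).
Proof.
move=> [df f0 f1]; split => [x|x|x v]; first exact: differentiableZ.
  by rewrite normrZ ler_wpM2l.
by rewrite (@diffZ _ _ _ f)// normrZ -mulrA ler_wpM2l.
Qed.

Lemma C1_small_le N a b (f : 'rV[R]_N -> 'rV[R]_N) : a <= b -> C1_small a f -> C1_small b f.
Proof.
move=> ab [df f0 f1]; split => // [x|x v]; first exact: le_trans ab.
by rewrite (le_trans (f1 x v))// ler_wpM2r.
Qed.

Lemma C1_small_sum N (I : finType) (lam : I -> R) (Q : I -> 'rV[R]_N -> 'rV[R]_N) (B e : R) :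
  0 <= B -> 0 <= e -> (forall i, C1_small B (Q i)) -> (forall i, `|lam i| <= e) ->
  C1_small (#|I|%:R * (e * B)) (fun x => \sum_i lam i *: Q i x).
Proof.
move=> B0 e0 QB le; rewrite mulr_natl -[#|I|]/#|xpredT : pred I| -sumr_const.
elim: (index_enum I) => [|i r IH].
  rewrite big_nil (_ : (fun x => _) = fun=> 0); first exact: C1_small0.
  by apply/funext => x; rewrite big_nil.
rewrite big_cons (_ : (fun x => _) = fun x => lam i *: Q i x + \sum_(j <- r) lam j *: Q j x).
  apply: C1_smallD => //; apply: C1_small_le (C1_smallZ (lam i) (QB i)).
  by rewrite ler_wpM2r.
by apply/funext => x; rewrite big_cons.
Qed.

Lemma C1_small_lipschitz N a (f : 'rV[R]_N -> 'rV[R]_N) x y :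
  C1_small a f -> `|f x - f y| <= a * `|x - y|.
Proof.
move=> [df f0 f1]; apply: (@lipschitz_ball _ _ _ f (Num.max `|x| `|y|)) => //.
  by rewrite le_max lexx.
by rewrite le_max lexx orbT.
Qed.

Lemma trig_C1_small N (f : 'rV[R]_N -> 'rV[R]_N) : trig f ->
  exists2 B, 0 < B & C1_small B f.
Proof.
move=> tf; have [df _] := trig_derive tf.
by have [B B0 [f0 f1]] := trig_bounded tf; exists B.
Qed.

(** A crude count of maps between input sets, but independent of the peak functions. In the count
    over times this bound fixes the time span [tau1] before times and peaks are chosen, whereas the
    Lipschitz constants are known only afterwards. *)
Definition sym_bound : R := \sum_c \sum_d #|{ffun inputs (c : node G) -> inputs (d : node G)}|%:R.

Lemma sym_map_bound c (phi : 'rV[R]_(k c) * input_state R k c -> R) (w : 'rV[R]_(k c)) x :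
  (forall z, 0 <= phi z <= 1) -> `|w| <= 1 -> `|sym_map phi w x| <= sym_bound.
Proof.
move=> phi01 w1.
have s0 (a : node G) : 0 <= \sum_d #|{ffun inputs (a : node G) -> inputs (d : node G)}|%:R :> R.
  exact: sumr_ge0.
apply: norm_le_fcoord => [|d]; first exact: sumr_ge0.
rewrite fcoord_pack (le_trans (ler_norm_sum _ _ _))//.
rewrite (@le_trans _ _ #|{ffun inputs c -> inputs d}|%:R)//; last first.
  rewrite /sym_bound (bigD1 c)//= (bigD1 d)//= -addrA lerDl addr_ge0// sumr_ge0//.
rewrite -sum1_card natr_sum big_mkcond /= ler_sum// => b _.
case: ifP => // _; rewrite normrZ mulr_ile1// ?(le_trans (tr_norm_le _ _))//.
by have /andP[h1 h2] := phi01 (pull b (local_state d x)); rewrite ger0_norm.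
Qed.
End Perturbations.

(** * Parameter counts *)

Section Counting.
Variable R : realType.

(* Pigeonhole: [w] maps a grid in a cube of dimension #|I| to a cube of dimension #|J|. *)
Lemma no_expanding_map (I J : finType) (eps C B : R) (w : (I -> R) -> J -> R) :
  0 < eps -> 0 <= C -> 0 <= B -> (#|J| < #|I|)%N ->
  (forall lam, (forall i, `|lam i| <= eps) -> forall j, `|w lam j| <= B) ->
  (forall lam lam' h, (forall i, `|lam i| <= eps) -> (forall i, `|lam' i| <= eps) ->
     0 <= h -> (forall j, `|w lam j - w lam' j| <= h) -> forall i, `|lam i - lam' i| <= C * h) ->
  False.
Proof.
move=> eps0 C0 B0 JI wB wC.
(* The grid has [s] points per axis, the target cube fewer than K s boxes of side [h] per axis. The
   choice of [s] gives s^|I| > (K s)^|J|, that of [h] makes C h smaller than the grid spacing eps /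
   s. *)
pose K := (Num.truncn (4 * B * (C + 1) / eps)).+2.
pose s := (K ^ #|J|).+1.
have sR : 0 < s%:R :> R by rewrite ltr0n.
pose h := eps / (2 * s%:R * (C + 1)).
have [e0 sR0] := (ltW eps0, ltW sR).
have C1 : 0 < C + 1 by rewrite ltr_wpDl.
have h0 : 0 < h by rewrite divr_gt0// !mulr_gt0.
pose lam (f : {ffun I -> 'I_s}) i : R := eps * (f i)%:R / s%:R.
have lamB f i : `|lam f i| <= eps.
  rewrite ger0_norm ?divr_ge0 ?mulr_ge0// ler_pdivrMr// ler_pM2l// ler_nat.
  exact/ltnW/ltn_ord.
pose q f j := (w (lam f) j + B) / h.
have q0 f j : 0 <= q f j.
  rewrite divr_ge0 ?(ltW h0)// -lerBlDr sub0r.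
  by have := wB _ (lamB f) j; rewrite ler_norml => /andP[].
have qK f j : (Num.truncn (q f j) < K * s)%N.
  have /andP[tq _] := truncn_itv (q0 f j).
  rewrite -(ltr_nat R) (le_lt_trans tq)// /q.
  apply: (@le_lt_trans _ _ (2 * B / h)).
    rewrite ler_pM2r ?invr_gt0// mulr_natl mulr2n lerD2r.
    by have := wB _ (lamB f) j; rewrite ler_norml => /andP[].
  rewrite /h invf_div (_ : 2 * B * _ = (4 * B * (C + 1) / eps) * s%:R); last by field; rewrite gt_eqF.
  rewrite natrM ltr_pM2r// (lt_trans (truncnS_gt _))// ltr_nat.
  by rewrite /K ltnS.
pose c f := [ffun j => Ordinal (qK f j)].
have /injectivePn[f [f' ff' cc]] : ~~ injectiveb c.
  apply/negP => /injectiveP/leq_card; rewrite !card_ffun !card_ord leqNgt => /negP; apply.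
  rewrite expnMn (@leq_trans (s ^ #|J|.+1))//; last by rewrite leq_pexp2l.
  by rewrite expnS ltn_pmul2r ?expn_gt0.
have [i fi] : exists i, f i != f' i.
  by apply/existsP; rewrite -negb_forall; apply: contra ff' => /forallP H; apply/eqP/ffunP => i; exact/eqP.
have ww j : `|w (lam f) j - w (lam f') j| <= h.
  have := congr1 (fun z : {ffun J -> 'I_(K * s)} => val (z j)) cc; rewrite !ffunE /= => tq.
  have h1 := truncn_itv (q0 f j); have h2 := truncn_itv (q0 f' j).
  rewrite -tq in h2; move: h1 h2; rewrite -natr1 => /andP[a1 a2] /andP[b1 b2].
  rewrite (_ : _ - _ = (q f j - q f' j) * h); last by rewrite /q; field; rewrite gt_eqF.
  rewrite normrM (gtr0_norm h0) ler_piMl ?ltW// ltr_norml; apply/andP; split; lra.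
have := wC _ _ h (lamB f) (lamB f') (ltW h0) ww i; apply/negP; rewrite -ltNge.
apply: (@lt_le_trans _ _ (eps / s%:R)).
  rewrite /h mulrA ltr_pdivrMr ?mulr_gt0// (_ : eps / _ * _ = eps * (2 * (C + 1))); last first.
    by field; rewrite gt_eqF.
  by rewrite mulrC ltr_pM2l//; lra.
rewrite /lam -mulrBl -mulrBr normrM normrM (gtr0_norm eps0) (@gtr0_norm _ s%:R^-1) ?invr_gt0//.
rewrite ler_pM2r ?invr_gt0// ler_peMr//.
have : (f i != f' i :> nat) by [].
rewrite neq_ltn => /orP[] lt; last first.
  rewrite ger0_norm ?subr_ge0 ?ler_nat 1?ltnW//.
  by rewrite lerBrDr nat1r ler_nat.
rewrite distrC ger0_norm ?subr_ge0 ?ler_nat 1?ltnW//.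
by rewrite lerBrDr nat1r ler_nat.
Qed.

Lemma norm_near_le (V : normedModType R) (u v : V) (B rho : R) :
  `|u - v| < rho -> rho <= 1 -> `|v| <= B -> `|u| <= B + 1.
Proof. by have := ler_normD (u - v) v; rewrite subrK; lra. Qed.

Lemma weighted_sum_le (N : nat) (I : finType) (r : I -> R) (v : I -> 'rV[R]_N) (d c : R) :
  0 <= d -> 0 <= c -> (forall i, `|r i| <= d) -> (forall i, `|v i| <= c) ->
  `|\sum_j r j *: v j| <= #|I|%:R * d * c.
Proof.
move=> d0 c0 rd vc; rewrite (le_trans (ler_norm_sum _ _ _))//.
rewrite (le_trans (ler_sum _ (G := fun=> d * c) _))//.
  by move=> j _; rewrite normrZ ler_pM.
by rewrite sumr_const -[X in X <= _]mulr_natl mulrA.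
Qed.

(* The points [P lam i] and the data [w lam] depend on the parameters [lam] of the family
   F + sum_i lam_i Q_i.  The constraints express each lam_i through P lam i, hence, up to a
   small multiple of lam itself, through w lam, which has too few coordinates. *)
Lemma overdetermined_family (N : nat) (I J : finType) (F : 'rV[R]_N -> 'rV[R]_N)
    (Q : I -> 'rV[R]_N -> 'rV[R]_N) (ell : I -> {linear 'rV[R]_N -> R}) (n : I -> R)
    (y : I -> 'rV[R]_N) (P : (I -> R) -> I -> 'rV[R]_N) (w : (I -> R) -> J -> R)
    (q L A b rho eps B : R) :
  (#|J| < #|I|)%N ->
  (forall i u, `|ell i u| <= 2 * `|u|) -> (forall i, 1 <= n i) ->
  (forall i i', ell i (Q i' (y i)) = if i' == i then n i else 0) ->
  0 <= q -> 0 <= L -> 0 <= A -> 0 <= b -> 0 <= rho -> 0 < eps -> 0 <= B ->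
  (forall i a c, `|Q i a - Q i c| <= q * `|a - c|) ->
  2 * (#|I|%:R * q * rho) <= 4^-1 -> #|I|%:R * eps * q <= 1 -> 2 * (L + 1) * b <= 4^-1 ->
  (forall lam, (forall i, `|lam i| <= eps) ->
    [/\ forall i, ell i (F (P lam i) + \sum_j lam j *: Q j (P lam i)) = 0,
        forall i, `|P lam i - y i| <= rho & forall j, `|w lam j| <= B]) ->
  (forall lam lam', (forall i, `|lam i| <= eps) -> (forall i, `|lam' i| <= eps) ->
     (forall i, `|F (P lam i) - F (P lam' i)| <= L * `|P lam i - P lam' i|) /\
     forall h d, 0 <= h -> 0 <= d -> (forall j, `|w lam j - w lam' j| <= h) ->
       (forall i, `|lam i - lam' i| <= d) ->
       forall i, `|P lam i - P lam' i| <= A * h + b * d) -> False.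
Proof.
move=> JI ell2 n1 ellQ q0 L0 A0 b0 rho0 eps0 B0 Qq small1 small2 small3 H1 H2.
have L1 : 0 <= L + 1 by rewrite addr_ge0.
apply: (@no_expanding_map I J eps (4 * (L + 1) * A) B w) => //.
- by rewrite !mulr_ge0.
- by move=> lam /H1[_ _].
move=> lam lam' h hl hl' h0 wh.
have [E1 R1 _] := H1 _ hl; have [E2 _ _] := H1 _ hl'.
have [FL PL] := H2 _ _ hl hl'.
pose d := \big[Num.max/0]_i `|lam i - lam' i|.
have d0 : 0 <= d by apply: bigmax_ge_id.
have ld i : `|lam i - lam' i| <= d by apply: (le_bigmax _ (fun i => `|lam i - lam' i|)).
have key i : `|lam i - lam' i| <= 2 * (L + 1) * A * h + d / 2.
  set p := P lam i; set p' := P lam' i.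
  have pp : `|p - p'| <= A * h + b * d by apply: PL.
  (* The difference of the constraints for [lam] and [lam'], with the [Q j] moved to the unperturbed
     point [y i], where [ell i] singles out the parameter of index [i]. *)
  have E : \sum_j (lam j - lam' j) *: Q j (y i) =
      - (F p - F p') - \sum_j lam' j *: (Q j p - Q j p')
      - \sum_j (lam j - lam' j) *: (Q j p - Q j (y i))
      + ((F p + \sum_j lam j *: Q j p) - (F p' + \sum_j lam' j *: Q j p')).
    apply/rowP => l; rewrite !(mxE, summxE).
    rewrite (eq_bigr (fun j => lam j * Q j (y i) 0 l - lam' j * Q j (y i) 0 l)); last first.
      by move=> j _; rewrite !mxE mulrBl.
    rewrite [X in _ = _ - X - _ + _](eq_bigr (fun j => lam' j * Q j p 0 l - lam' j * Q j p' 0 l)); last first.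
      by move=> j _; rewrite !mxE mulrBr.
    rewrite [X in _ = _ - X + _](eq_bigr (fun j => lam j * Q j p 0 l - lam' j * Q j p 0 l
        - (lam j * Q j (y i) 0 l - lam' j * Q j (y i) 0 l))); last first.
      by move=> j _; rewrite !mxE; ring.
    rewrite [X in _ = _ + (_ + X - _)](eq_bigr (fun j => lam j * Q j p 0 l)); last by move=> j _; rewrite !mxE.
    rewrite [X in _ = _ + (_ - (_ + X))](eq_bigr (fun j => lam' j * Q j p' 0 l)); last by move=> j _; rewrite !mxE.
    by rewrite !sumrB; ring.
  have ellE : ell i (\sum_j (lam j - lam' j) *: Q j (y i)) = n i * (lam i - lam' i).
    rewrite linear_sum (bigD1 i)//= big1; last first.
      by move=> j ji; rewrite linearZ /= ellQ (negbTE ji) scaler0.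
    by rewrite addr0 linearZ /= ellQ eqxx /GRing.scale /= mulrC.
  have bound : `|n i * (lam i - lam' i)| <= 2 * (L * `|p - p'| + #|I|%:R * eps * (q * `|p - p'|)
      + #|I|%:R * d * (q * rho)).
    have E0 : ell i ((F p + \sum_j lam j *: Q j p) - (F p' + \sum_j lam' j *: Q j p')) = 0.
      by rewrite linearB /= (E1 i) (E2 i) subrr.
    rewrite -ellE E linearD /= E0 addr0 (le_trans (ell2 _ _))// ler_wpM2l//.
    rewrite (le_trans (ler_normB _ _))// lerD//; last first.
      apply: weighted_sum_le => //; first by rewrite mulr_ge0.
      by move=> j; rewrite (le_trans (Qq _ _ _))// ler_wpM2l//; exact: R1.
    rewrite (le_trans (ler_normB _ _))// lerD//; first by rewrite normrN FL.
    by apply: weighted_sum_le => //; [exact: ltW|rewrite mulr_ge0].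
  rewrite (@le_trans _ _ `|n i * (lam i - lam' i)|)//.
    by rewrite normrM ler_peMl// (le_trans (n1 i))// ler_norm.
  rewrite (le_trans bound)//.
  have s1 : #|I|%:R * eps * q * `|p - p'| <= `|p - p'| by rewrite ler_piMl.
  have s2 : d * (2 * (#|I|%:R * q * rho)) <= d * 4^-1 by rewrite ler_wpM2l.
  have s3 : d * (2 * (L + 1) * b) <= d * 4^-1 by rewrite ler_wpM2l.
  have s4 : 2 * (L + 1) * `|p - p'| <= 2 * (L + 1) * (A * h + b * d) by rewrite ler_wpM2l// mulr_ge0.
  lra.
(* The half of [d] to be absorbed consists of a quarter from [small1] and a quarter from
   [small3]. *)
have dd : d <= 2 * (L + 1) * A * h + d / 2.
  by apply: bigmax_le => //; rewrite addr_ge0 ?mulr_ge0.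
move=> i; rewrite (le_trans (ld i))//; lra.
Qed.
End Counting.

(** * Consequences of robust synchrony and constancy near one time *)

Section Robust.
Variables (R : realType) (G : network) (k : node G -> nat).
Hypothesis hk : node_spaces k.
Variables (col : rel (node G)) (F : state R k -> state R k) (y : R -> state R k).
Variables (t0 tau : R) (K : {set node G}).
Hypothesis hcol : colouring col.
Hypothesis aF : admissible F.
Hypothesis tau0 : 0 < tau.
Hypothesis dy : forall t : R, is_derive t 1 y (F (y t)).
Hypothesis yK : forall c, c \in K <->
  forall t, `|t - t0| < tau -> fcoord (y t) c = fcoord (y t0) c.
Hypothesis ysync : forall t, `|t - t0| < tau -> forall c d, synchronous (y t) c d <-> col c d.
(** This is what the counts need of rigidity and hyperbolicity: solutions near [y] on one fixed
    interval that keep the colours and the constant nodes. Periods and sections no longer appear. *)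
Hypothesis robust : forall rho, 0 < rho -> exists2 eta, 0 < eta &
  forall q, admissible q -> C1_small eta q -> exists v : R -> state R k,
    [/\ forall t : R, is_derive t 1 v (F (v t) + q (v t)),
        forall t, `|t - t0| < tau -> `|v t - y t| < rho,
        forall t, `|t - t0| < tau -> forall c d, synchronous (v t) c d <-> col c d
      & forall c, c \in K -> forall t, `|t - t0| < tau -> fcoord (v t) c = fcoord (v t0) c].

Lemma fin_min (I : finType) (d : I -> R) : (forall i, 0 < d i) ->
  exists2 e, 0 < e & forall i, e <= d i.
Proof.
move=> d0; exists (\big[Num.min/1]_i d i).
  by elim/big_ind: _ => // a b a0 b0; rewrite lt_min a0.
by move=> i; exact: bigmin_le_cond.
Qed.

Lemma bounded_on_interval : exists2 B, 0 <= B & forall t, `|t - t0| < tau -> `|y t| <= B.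
Proof.
have cy : continuous y by move=> t; exact: (is_derive_continuous (dy t)).
have [B B0 HB] := segment_bounded (t0 - tau) (t0 + tau) cy.
exists B => [|t /ltW tt]; first exact: ltW.
by apply: HB; rewrite -ler_distl.
Qed.

Lemma perturbed_family (I : finType) (Q : I -> state R k -> state R k) (rho e1 : R) :
  (forall i, trig (Q i)) -> (forall i, admissible (Q i)) -> 0 < rho -> 0 < e1 ->
  exists2 eps, 0 < eps <= e1 & exists V : (I -> R) -> R -> state R k,
    forall lam, (forall i, `|lam i| <= eps) ->
    [/\ forall t : R, is_derive t 1 (V lam) (F (V lam t) + \sum_i lam i *: Q i (V lam t)),
        forall t, `|t - t0| < tau -> `|V lam t - y t| < rho,
        forall t, `|t - t0| < tau -> forall c d, synchronous (V lam t) c d <-> col c d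
      & forall c, c \in K -> forall t, `|t - t0| < tau -> fcoord (V lam t) c = fcoord (V lam t0) c].
Proof.
move=> tQ aQ rho0 e10; have [eta eta0 H] := robust rho0.
have /choice[B HB] i : exists B, 0 < B /\ C1_small B (Q i).
  by have [B B0 HB] := trig_C1_small (tQ i); exists B.
pose Bs := \sum_i B i.
have Bs0 : 0 <= Bs by apply: sumr_ge0 => i _; exact/ltW/(HB i).1.
have QB i : C1_small Bs (Q i).
  apply: C1_small_le (HB i).2; rewrite /Bs (bigD1 i)//= lerDl sumr_ge0// => j _.
  exact/ltW/(HB j).1.
pose D := #|I|%:R * Bs + 1; have D0 : 0 < D by rewrite ltr_wpDl// mulr_ge0.
pose eps := Num.min e1 (eta / D).
have eps0 : 0 < eps by rewrite lt_min e10 divr_gt0.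
exists eps; first by rewrite eps0 ge_min lexx.
have X lam : exists v : R -> state R k, (forall i, `|lam i| <= eps) ->
    [/\ forall t : R, is_derive t 1 v (F (v t) + \sum_i lam i *: Q i (v t)),
        forall t, `|t - t0| < tau -> `|v t - y t| < rho,
        forall t, `|t - t0| < tau -> forall c d, synchronous (v t) c d <-> col c d
      & forall c, c \in K -> forall t, `|t - t0| < tau -> fcoord (v t) c = fcoord (v t0) c].
  (* Outside the cube of parameters nothing is claimed and [y] is a default. The resulting [V] is a
     choice without any regularity in [lam]. *)
  have [le|nle] := pselect (forall i, `|lam i| <= eps); last by exists y.
  have [|v Hv] := H _ (admissible_sum lam aQ); last by exists v.
  apply: C1_small_le (C1_small_sum Bs0 (ltW eps0) QB le).
  rewrite mulrCA (@le_trans _ _ (eps * D))//; first by rewrite ler_wpM2l ?(ltW eps0)// /D lerDl.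
  by rewrite -ler_pdivlMr// /eps ge_min lexx orbT.
by have [V HV] := choice X; exists V.
Qed.

(** The Lipschitz constant [q] belongs to the family and is fixed first; then [rho] is chosen
    against it, and only then [eps], through [robust]. *)
Lemma small_family (I : finType) (Q : I -> state R k -> state R k) :
  (forall i, trig (Q i)) -> (forall i, admissible (Q i)) ->
  exists q rho eps (V : (I -> R) -> R -> state R k),
  [/\ [/\ 0 <= q, 0 < rho & 0 < eps], rho <= 1,
      forall i a a', `|Q i a - Q i a'| <= q * `|a - a'|,
      2 * (#|I|%:R * q * rho) <= 4^-1 /\ #|I|%:R * eps * q <= 1
    & forall lam, (forall i, `|lam i| <= eps) ->
    [/\ forall t : R, is_derive t 1 (V lam) (F (V lam t) + \sum_i lam i *: Q i (V lam t)),
        forall t, `|t - t0| < tau -> `|V lam t - y t| < rho,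
        forall t, `|t - t0| < tau -> forall c d, synchronous (V lam t) c d <-> col c d
      & forall c, c \in K -> forall t, `|t - t0| < tau -> fcoord (V lam t) c = fcoord (V lam t0) c]].
Proof.
move=> tQ aQ.
have /choice[B HB] i : exists B, 0 < B /\ C1_small B (Q i).
  by have [B B0 HB] := trig_C1_small (tQ i); exists B.
pose q := \sum_i B i.
have q0 : 0 <= q by apply: sumr_ge0 => i _; exact/ltW/(HB i).1.
pose s := #|I|%:R * q; have s0 : 0 <= s by rewrite mulr_ge0.
have D0 : 0 < 8 * s + 1 by rewrite ltr_wpDl// mulr_ge0.
pose rho := (8 * s + 1)^-1; have rho0 : 0 < rho by rewrite invr_gt0.
have rhoq : rho * (8 * s + 1) = 1 by rewrite mulVf ?lt0r_neq0.
have [eps /andP[eps0 epsr] [V HV]] := perturbed_family tQ aQ rho0 rho0.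
exists q, rho, eps, V; split => //.
- by rewrite invf_le1// lerDr mulr_ge0.
- move=> i a a'; apply: C1_small_lipschitz; apply: C1_small_le (HB i).2.
  by rewrite /q (bigD1 i)//= lerDl sumr_ge0// => i' _; exact/ltW/(HB i').1.
- have : s * eps <= s * rho by rewrite ler_wpM2l.
  by rewrite mulrAC -/s; split; move: rhoq rho0; lra.
Qed.

Lemma is_derive_linear (V W : normedModType R) (l : {linear V -> W}) (u : R -> V) (t : R) v :
  continuous l -> is_derive t 1 u v -> is_derive t 1 (fun s => l (u s)) (l v).
Proof.
move=> cl du.
have := is_derive_comp_diff (linear_differentiable (u t) cl) du.
by rewrite diff_lin.
Qed.

Lemma is_derive0_interval (h : R -> R) (a b c d : R) :
  (forall t : R, c <= t <= d -> is_derive t 1 h 0) -> c <= a <= d -> c <= b <= d -> h a = h b.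
Proof.
move=> dh ha hb; apply/eqP; rewrite -subr_eq0 -normr_le0.
pose u s := (h s)%:M : 'M[R]_1.
have := @mean_value_dist_le _ _ _ u (fun=> 0) 0 b a c d.
rewrite mul0r /u => H; apply: le_trans (H _ _ hb ha).
- by rewrite (le_trans _ (mx_entry_le _ 0 0))// !mxE eqxx.
- move=> s sI; apply/is_derive_mx => i j; rewrite !ord1 mxE.
  by under eq_fun do rewrite mxE eqxx mulr1n; exact: dh.
- by move=> s _; rewrite normr0.
Qed.

(** This converts synchrony or constancy on the interval into an equation for the vector field at
    each time, the form in which [overdetermined_family] takes its constraints. *)
Lemma constant_functional (ell : {linear state R k -> R}) (v W : R -> state R k) :
  (forall t : R, is_derive t 1 v (W t)) ->
  (forall t, `|t - t0| < tau -> ell (v t) = ell (v t0)) ->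
  forall t, `|t - t0| < tau -> ell (W t) = 0.
Proof.
move=> dv vc t tt.
have d1 := is_derive_linear (@linear_rV_continuous _ _ _ ell) (dv t).
have d2 : is_derive t 1 (fun s => ell (v s)) 0.
  apply: (@near_eq_is_derive _ _ _ (cst (ell (v t0)))).
  apply/nbhs_normP; exists (tau - `|t - t0|); first by rewrite /= subr_gt0.
  move=> s /=; rewrite distrC => ts; apply/esym/vc.
  by rewrite -(subrKA t) (le_lt_trans (ler_normD _ _))// -ltrBrDr.
by have [_ e1] := d1; have [_ e2] := d2; rewrite -e1 e2.
Qed.

(** Pullback along an input isomorphism of [c] permutes the coordinates of a local state, and each
    of these is a coordinate of the whole state. So the values of [l] on the symmetric copies of one
    local state lie in a finite set that [generic_times] can avoid. *)
Lemma local_entry c (X Y : state R k) : local_state c X <> local_state c Y ->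
  exists l : {linear ('rV[R]_(k c) * input_state R k c)%type -> R},
    l (local_state c X) <> l (local_state c Y) /\
    forall b : inputs c -> inputs c, input_iso b -> forall Z,
      exists i, l (pull b (local_state c Z)) = Z 0 i.
Proof.
move=> XY.
have [H|/existsNP[j hj]] := pselect (forall j, fcoord X c 0 j = fcoord Y c 0 j); last first.
  exists (entry 0 j \o fst); split=> // b ib Z; have [i Hi] := fcoord_entry R j.
  by exists i; rewrite -Hi /= tr_id.
have [H'|/existsNP[e /existsNP[j hj]]] := pselect (forall (e : inputs c) j,
    fcoord (tail_states X c) e 0 j = fcoord (tail_states Y c) e 0 j); last first.
  exists (entry 0 j \o proj e \o snd); split=> // b ib Z.
  have te := input_iso_tail_dim hk e ib.
  have [i Hi] := fcoord_entry R (cast_ord te j : 'I_(k (tail (arr (b e))))).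
  exists i; rewrite -Hi /= /entry /proj /pullback !fcoord_pack.
  exact: tr_entry.
by case: XY; congr (_, _); [apply/rowP|apply: fcoord_ext => e; apply/rowP].
Qed.

Lemma moving_coordinate c t : `|t - t0| < tau -> local_state c (y t) <> local_state c (y t0) ->
  exists (l : {linear ('rV[R]_(k c) * input_state R k c)%type -> R}) (t1 : R),
  [/\ `|t1 - t0| < tau, l (local_state c (F (y t1))) <> 0 &
    forall b : inputs c -> inputs c, input_iso b -> forall Z,
      exists i, l (pull b (local_state c Z)) = Z 0 i].
Proof.
move=> tt /local_entry[l [lt lb]]; exists l.
apply: contrapT => H; apply: lt.
apply: (@is_derive0_interval (fun s => l (local_state c (y s))) t t0 (Num.min t t0) (Num.max t t0)).
- move=> s /andP[s1 s2].
  have st : `|s - t0| < tau.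
    rewrite ltr_norml; move: tt; rewrite ltr_norml => /andP[h1 h2].
    have := s1; have := s2; rewrite ge_min le_max => /orP[] a1 /orP[] a2; apply/andP; split; lra.
  have -> : 0 = l (local_state c (F (y s))) by apply: contrapT => h0; apply: H; exists s; split => //; exact/nesym.
  apply: (@is_derive_linear _ _ (l \o local_state c)) => //.
  exact: linear_rV_continuous.
- by rewrite ge_min lexx le_max lexx.
- by rewrite ge_min lexx orbT le_max lexx orbT.
Qed.

(** The two times are independent because the peak belonging to one sampling time is evaluated at
    all the others. *)
Lemma separated_near (V : normedModType R) (u v : R -> V) (t1 : R) :
  {for t1, continuous u} -> {for t1, continuous v} -> u t1 <> v t1 ->
  exists2 e, 0 < e & forall t t', `|t - t1| < e -> `|t' - t1| < e -> u t <> v t'.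
Proof.
move=> cu cv uv.
have n0 : 0 < `|u t1 - v t1| / 2 by rewrite divr_gt0// normr_gt0 subr_eq0; exact/eqP.
have /cvgrPdist_lt/(_ _ n0)/nbhs_normP[a /= a0 Ha] := cu.
have /cvgrPdist_lt/(_ _ n0)/nbhs_normP[b /= b0 Hb] := cv.
exists (Num.min a b); first by rewrite lt_min a0.
move=> t t'; rewrite !lt_min => /andP[ta _] /andP[_ tb] tt'.
have h1 := Ha t; have h2 := Hb t'; rewrite /ball_ /= in h1 h2.
rewrite distrC in ta; rewrite distrC in tb.
have := ler_normD (u t1 - u t) (v t' - v t1); rewrite tt' subrKA.
have := h1 ta; have := h2 tb; rewrite -tt' [`|v t1 - _|]distrC; lra.
Qed.

(** Near [t1] the function [h] takes infinitely many values: with finitely many, continuity would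
    make it locally constant and [c] zero. So each new time can avoid the finitely many coordinates
    at the earlier ones. *)
Lemma generic_times (h : R -> R) (t1 delta c : R) N (X : R -> 'rV[R]_N) m :
  is_derive t1 1 h c -> c != 0 -> 0 < delta ->
  exists T : nat -> R, (forall i, (i < m)%N -> `|T i - t1| < delta) /\
    forall i l, (l < i < m)%N -> forall e, h (T i) <> X (T l) 0 e.
Proof.
move=> dh c0 d0.
have new (A : seq R) : exists2 t, `|t - t1| < delta & h t \notin A.
  apply: contrapT => H.
  have hA t : `|t - t1| < delta -> h t \in A.
    by move=> td; apply: contrapT => /negP hn; apply: H; exists t.
  have [e e0 He] : exists2 e, 0 < e & forall a, a \in A -> a != h t1 -> e <= `|a - h t1|.
    elim: A {H hA} => [|a A [e e0 He]]; first by exists 1.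
    have [ah|ah] := eqVneq a (h t1).
      by exists e => // b; rewrite inE => /predU1P[->|/He//]; rewrite ah eqxx.
    exists (Num.min e `|a - h t1|); first by rewrite lt_min e0 normr_gt0 subr_eq0.
    move=> b; rewrite inE ge_min => /predU1P[->|/He h1 /h1 ->//].
    by rewrite lexx orbT.
  have hc : {for t1, continuous h} := is_derive_continuous dh.
  have /cvgrPdist_lt/(_ _ e0)/nbhs_normP[b /= b0 Hb] := hc.
  have loc t : `|t - t1| < Num.min delta b -> h t = h t1.
    rewrite lt_min => /andP[/hA hta tb]; apply/eqP; apply: contrapT => /negP hne.
    have := He _ hta hne; rewrite leNgt distrC => /negP; apply.
    by apply: Hb => /=; rewrite distrC.
  have d2 : is_derive t1 1 h 0.
    apply: (@near_eq_is_derive _ _ _ (cst (h t1))).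
    apply/nbhs_normP; exists (Num.min delta b); first by rewrite /= lt_min d0.
    by move=> s /=; rewrite distrC => /loc ->.
  by have [_ e1] := dh; have [_ e2] := d2; move: c0; rewrite -e1 e2 eqxx.
elim: m => [|m [T [T1 T2]]]; first by exists (fun=> t1); split => // i l; rewrite ltn0 andbF.
pose A := flatten [seq [seq X (T l) 0 e | e <- enum 'I_N] | l <- iota 0 m].
have [s s1 sA] := new A.
exists (fun i => if (i < m)%N then T i else s); split => [i im|i l /andP[li im] e].
  by case: ifP => // im'; exact: T1.
rewrite (leq_trans li)//.
case: ifP => im'; first by apply: T2; rewrite li.
move=> E; move/negP: sA; apply; rewrite E.
apply/flattenP; exists [seq X (T l) 0 e | e <- enum 'I_N].
  apply/mapP; exists l => //; rewrite mem_iota /= add0n.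
  by rewrite (leq_trans li)// -ltnS.
by apply/mapP; exists e => //; rewrite mem_enum.
Qed.

Lemma sym_map_entry c d (phi : 'rV[R]_(k c) * input_state R k c -> R) w (X : state R k) j :
  fcoord (sym_map phi w X) d 0 j =
  (\sum_(b : {ffun inputs c -> inputs d} | `[< input_iso b >]) phi (pull b (local_state d X)))
    * tr (k d) w 0 j.
Proof.
by rewrite fcoord_pack summxE mulr_suml; apply: eq_bigr => b _; rewrite mxE.
Qed.

Lemma symmetric_sum_ge1 c (phi : 'rV[R]_(k c) * input_state R k c -> R) z :
  (forall x, 0 <= phi x <= 1) -> phi z = 1 ->
  1 <= \sum_(b : {ffun inputs c -> inputs c} | `[< input_iso b >]) phi (pull b z).
Proof.
move=> p01 p1; have ff : ([ffun e => e] : inputs c -> inputs c) = id.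
  by apply/funext => e; rewrite ffunE.
rewrite (bigD1 [ffun e => e])/= ff; last exact/asboolP/input_iso_id.
by rewrite pull_id p1 lerDl sumr_ge0// => b _; have /andP[] := p01 (pull b z).
Qed.

Lemma pull_synchronous c d (b : inputs c -> inputs d) (X : state R k) e : input_iso b ->
  pull b (local_state d X) = local_state c X -> synchronous X (tail (arr e)) (tail (arr (b e))).
Proof.
move=> ib [_ H]; split; first exact: (input_iso_tail_dim hk e ib).
by have := congr1 (fun z => fcoord z e) H; rewrite !fcoord_pack => <-.
Qed.

(* For [s = true] the constraint is the synchrony of [c] and [d], for [s = false] the constancy of
   [c], in which case [d] and [j'] play no role. *)
Lemma determined_local_state c d (s : bool) (j : 'I_(k c)) (j' : 'I_(k d)) :
  (s -> k c = k d /\ j = j' :> nat) -> (s -> col c d) ->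
  (s -> forall b : inputs c -> inputs d, input_iso b ->
     exists e, ~ col (tail (arr e)) (tail (arr (b e)))) ->
  (~~ s -> c \in K) ->
  forall t, `|t - t0| < tau -> local_state c (y t) = local_state c (y t0).
Proof.
move=> sdim scol siso sK t tt; apply: contrapT => /(moving_coordinate tt)[l [t1 [tt1 lF lb]]].
pose N := total_dim k; pose m := N.+1.
have [By By0 HBy] := bounded_on_interval.
have [L L0 HL] := Ck1_lipschitz_ball (addr_ge0 By0 ler01) (aF.1 1%N).
pose sb := sym_bound R G.
have sb0 : 0 <= sb by rewrite /sb /sym_bound sumr_ge0// => a _; rewrite sumr_ge0.
have cy r : {for r, continuous y} := is_derive_continuous (dy r).
have cl r a : {for r, continuous (local_state a \o y)}.
  by apply: continuous_comp; [exact: cy|exact: linear_rV_continuous].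
(* Equality at [t1] would make corresponding tails synchronous and [b] colour-preserving, which
   [siso] excludes; continuity and the finite number of maps [b] give one radius. *)
have [sep sep0 Hsep] : exists2 e, 0 < e & s -> forall b : {ffun inputs c -> inputs d},
    input_iso b -> forall r r', `|r - t1| < e -> `|r' - t1| < e ->
    pull b (local_state d (y r)) <> local_state c (y r').
  have /choice[e He] (b : {ffun inputs c -> inputs d}) : exists e : R, 0 < e /\
      (s -> input_iso b -> forall r r', `|r - t1| < e -> `|r' - t1| < e ->
        pull b (local_state d (y r)) <> local_state c (y r')).
    have [[hs ib]|H] := pselect (s /\ input_iso b); last by exists 1; split => // hs ib; case: H.
    have cb : {for t1, continuous (fun r => pull b (local_state d (y r)))}.
      apply: (@continuous_comp _ _ _ (local_state d \o y) (pull b)); first exact: cl.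
      exact: linear_pair_continuous.
    have nb : pull b (local_state d (y t1)) <> local_state c (y t1).
      move=> H; have [e ne] := siso hs b ib; apply: ne; apply/(ysync tt1).
      exact: pull_synchronous.
    by have [e e0 He] := separated_near cb (cl t1 c) nb; exists e.
  have [e' e0 le] := fin_min (fun b => (He b).1).
  exists e' => // hs b ib r r' h1 h2; apply: (He b).2 => //; exact: lt_le_trans (le b).
have gap0 : 0 < tau - `|t1 - t0| by rewrite subr_gt0.
have ms1 : 0 < m%:R * sb + 1 by rewrite ltr_wpDl// mulr_ge0.
have D0 : 0 < 16 * (L + 1) * (m%:R * sb + 1) by rewrite !mulr_gt0// addr_gt0.
have D1 : 0 < 2 * (L + 1) by rewrite mulr_gt0// addr_gt0.
(* In order: stay inside the given interval, keep the separation, make the coefficient [bb] of the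
   parameter difference small, and meet the condition of [gronwall_short] for L + 1. *)
pose tau1 := Num.min (Num.min ((tau - `|t1 - t0|) / 2) sep)
  (Num.min (16 * (L + 1) * (m%:R * sb + 1))^-1 (2 * (L + 1))^-1).
have tau10 : 0 < tau1 by rewrite !lt_min sep0 divr_gt0//= !invr_gt0 D0.
have tau1I r : `|r - t1| <= tau1 -> `|r - t0| < tau.
  rewrite !le_min => /andP[/andP[h _] _].
  by rewrite -(subrKA t1) (le_lt_trans (ler_normD _ _))//; lra.
have tau1sep r : `|r - t1| < tau1 -> `|r - t1| < sep.
  by rewrite !lt_min => /andP[/andP[_ ->]].
pose bb := 2 * (tau1 * (m%:R * sb)).
have bb0 : 0 <= bb by rewrite !mulr_ge0// ltW.
have bbs : 2 * (L + 1) * bb <= 4^-1.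
  have : tau1 * (16 * (L + 1) * (m%:R * sb + 1)) <= 1.
    by rewrite -ler_pdivlMr// mul1r !ge_min lexx orbT.
  have : 0 <= tau1 * (L + 1) by rewrite mulr_ge0 ?ltW// addr_gt0.
  rewrite /bb; lra.
have Lt : (L + 1) * tau1 <= 2^-1.
  have : tau1 * (2 * (L + 1)) <= 1 by rewrite -ler_pdivlMr// mul1r !ge_min lexx !orbT.
  lra.
pose h r := l (local_state c (y r)).
have dh : is_derive t1 1 h (l (local_state c (F (y t1)))).
  by apply: (@is_derive_linear _ _ (l \o local_state c)) => //; exact: linear_rV_continuous.
have [Ti [Ti1 Ti2]] := generic_times y m dh (introN eqP lF) tau10.
have TiI (i : 'I_m) : `|Ti i - t0| < tau by apply/tau1I/ltW/Ti1.
pose ga (i : 'I_m) := local_state c (y (Ti i)).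
(* All copies of sampled local states that can occur in the symmetrised sums: those of [c] under its
   own symmetries and those of [d] pulled back to [c]. *)
pose pulls : seq ('rV[R]_(k c) * input_state R k c) :=
  [seq pull (z.1 : {ffun inputs c -> inputs c}) (local_state c (y (Ti z.2))) | z : _ * 'I_m] ++
  [seq pull (z.1 : {ffun inputs c -> inputs d}) (local_state d (y (Ti z.2))) | z : _ * 'I_m].
have /choice[phi Hphi] i : exists phi : _ -> R, [/\ trig phi, forall x, 0 <= phi x <= 1, phi (ga i) = 1 &
    forall Q, Q \in pulls -> Q != ga i -> phi Q = 0].
  by apply: trig_peak => Q; exact: pair_separate.
pose Q i := sym_map (phi i) (delta_mx 0 j).
pose ell : {linear state R k -> R} := (entry 0 j \o proj c) \- (s%:R \*: (entry 0 j' \o proj d)).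
have tQ i : trig (Q i) by apply: trig_sym_map; have [] := Hphi i.
have aQ i : admissible (Q i) by apply: sym_map_admissible => //; have [] := Hphi i.
have QB i x : `|Q i x| <= sb.
  apply: sym_map_bound; first by have [] := Hphi i.
  by apply: mx_norm_le => // a a'; rewrite mxE; case: (_ && _); rewrite ?normr1 ?normr0.
pose n (i : 'I_m) := \sum_(b : {ffun inputs c -> inputs c} | `[< input_iso b >])
  phi i (pull b (ga i)).
have ellQ (i i' : 'I_m) : ell (Q i' (y (Ti i))) = if i' == i then n i else 0.
  have -> : ell (Q i' (y (Ti i))) = \sum_(b : {ffun inputs c -> inputs c} | `[< input_iso b >])
      phi i' (pull b (ga i)).
    rewrite /ell /= /entry /proj /Q !sym_map_entry tr_id mxE !eqxx mulr1.
    rewrite [X in _ - X](_ : _ = 0) ?subr0//; case: (boolP s) => hs; last by rewrite scale0r.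
    have [kk jj] := sdim hs.
    rewrite big1 ?mul0r ?scaler0// => b /asboolP ib; have [_ _ _] := Hphi i'; apply.
      by rewrite mem_cat; apply/orP; right; apply/mapP; exists (b, i); rewrite ?mem_enum.
    by apply/eqP; apply: (Hsep hs b ib); apply/tau1sep/Ti1.
  have [->//|ii] := eqVneq i' i.
  apply: big1 => b /asboolP ib; have [_ _ _] := Hphi i'; apply.
    by rewrite mem_cat; apply/orP; left; apply/mapP; exists (b, i); rewrite ?mem_enum.
  apply/eqP => E.
  (* The time of larger index avoids the coordinates of the state at the other one. So the
     coincidence is written as a pullback of the local state of smaller index, inverting [b] if
     necessary. *)
  have : (i' != i :> nat) by []; rewrite neq_ltn => /orP[] lt.
    have [b' [ib' bK Kb]] := input_iso_inv ib.
    have E' : pull b' (ga i') = ga i.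
      rewrite -E pull_comp// (_ : b \o b' = id) ?pull_id//; exact/funext.
    have [e He] := lb b' ib' (y (Ti i')).
    apply: (Ti2 i i' _ e); first by rewrite lt ltn_ord.
    by rewrite -He /h -/(ga i) -E'.
  have [e He] := lb b ib (y (Ti i)).
  apply: (Ti2 i' i _ e); first by rewrite lt ltn_ord.
  by rewrite -He /h -/(ga i') -E.
have n1 i : 1 <= n i by have [_ p01 p1 _] := Hphi i; exact: symmetric_sum_ge1.
have [q [rho [eps [V [[q0 rho0 eps0] rho1 Qq [small1 small2] HV]]]]] := small_family tQ aQ.
have VB lam r : (forall i, `|lam i| <= eps) -> `|r - t0| < tau -> `|V lam r| <= By + 1.
  by move=> /HV[_ near _ _] rr; exact: norm_near_le (near _ rr) rho1 (HBy _ rr).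
(* N + 1 sampling times stand against the N coordinates of the state at [t1]; the constants 2 and
   [bb] come from [gronwall_short] between [t1] and the sampling times. *)
apply: (@overdetermined_family _ _ 'I_m 'I_N F Q (fun=> ell) n (fun i => y (Ti i))
  (fun lam i => V lam (Ti i)) (fun lam i => V lam t1 0 i) q L 2 bb rho eps (By + 1)) => //.
- by rewrite !card_ord.
- move=> _ u; rewrite /ell /= /entry /proj (le_trans (ler_normB _ _))// mulrDl mul1r lerD//.
    by rewrite (le_trans (mx_entry_le _ _ _))// fcoord_norm_le.
  rewrite normrM (le_trans _ (_ : `|fcoord u d 0 j'| <= _))//; last first.
    by rewrite (le_trans (mx_entry_le _ _ _))// fcoord_norm_le.
  by case: (s); rewrite ?normr1 ?mul1r// normr0 mul0r.
- exact: ltW.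
- exact: ltW.
- exact: addr_ge0.
- move=> lam hl; have [dV near sync VK] := HV _ hl; split.
  + move=> i; apply: (constant_functional dV) (TiI i) => r rr.
    rewrite /ell /= /entry /proj; case: (boolP s) => hs.
      have [kk jj] := sdim hs.
      have Z r' : `|r' - t0| < tau -> fcoord (V lam r') c 0 j = fcoord (V lam r') d 0 j'.
        move=> rr'; have [_ ->] := (sync _ rr' c d).2 (scol hs).
        exact: tr_entry.
      have t00 : `|t0 - t0| < tau by rewrite subrr normr0.
      by rewrite !Z// !scale1r !subrr.
    by rewrite !scale0r (VK _ (sK hs) _ rr).
  + by move=> i; exact/ltW/near.
  + by move=> i; rewrite (le_trans (mx_entry_le _ _ _))// VB.
move=> lam lam' hl hl'; split.
  by move=> i; apply: HL; apply: VB.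
move=> h' d' h0 d0 wh ld i.
have [dV _ _ _] := HV _ hl; have [dV' _ _ _] := HV _ hl'.
pose du r := (F (V lam r) + \sum_i lam i *: Q i (V lam r)) -
             (F (V lam' r) + \sum_i lam' i *: Q i (V lam' r)).
have := @gronwall_short _ _ _ (fun r => V lam r - V lam' r) du (L + 1) (m%:R * d' * sb) t1 tau1
  _ _ (ltW tau10) Lt _ _ (Ti i) (ltW (Ti1 _ (ltn_ord i))).
move=> H; apply: le_trans (H _ _ _ _) _.
- by rewrite addr_ge0// ltW.
- by rewrite !mulr_ge0.
- move=> r rt.
  (* The first two terms together have Lipschitz constant L + 1 in the state, the 1 coming from
     [small2]; the third is the inhomogeneity due to the parameters. *)
  have -> : du r = (F (V lam r) - F (V lam' r)) +
      \sum_i lam i *: (Q i (V lam r) - Q i (V lam' r)) +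
      \sum_i (lam i - lam' i) *: Q i (V lam' r).
    rewrite -addrA -big_split /= /du opprD addrACA -sumrB; congr (_ + _).
    by apply: eq_bigr => a _; rewrite scalerBr scalerBl addrA subrK.
  rewrite (le_trans (ler_normD _ _))// lerD//; last first.
    by rewrite (le_trans (weighted_sum_le d0 sb0 ld _))// ?card_ord// => a; exact: QB.
  rewrite (le_trans (ler_normD _ _))// mulrDl mul1r lerD//.
    by apply: HL; apply: VB => //; apply: tau1I.
  rewrite (le_trans (weighted_sum_le (ltW eps0) (_ : 0 <= q * `|V lam r - V lam' r|) hl _))//.
    by rewrite mulr_ge0.
  by rewrite mulrA ler_piMl.
- have V1 : `|V lam t1 - V lam' t1| <= h'.
    by apply: mx_norm_le => // a a'; rewrite ord1 !mxE; exact: wh.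
  rewrite mulrDr lerD ?ler_wpM2l// /bb.
  by rewrite [leRHS](_ : _ = 2 * (tau1 * (m%:R * d' * sb)))//; ring.
Qed.

Lemma constant_tail c (e : inputs c) : c \in K -> tail (arr e) \in K.
Proof.
have [k0 _ _] := hk; pose j := Ordinal (k0 c).
move=> cK; apply/yK => t tt.
have := @determined_local_state c c false j j _ _ _ (fun=> cK) t tt.
move=> /(_ _ _ _)/(congr1 (fun z => fcoord z.2 e)).
by rewrite !fcoord_pack; apply.
Qed.

Lemma colour_dim c d : col c d -> k c = k d.
Proof. by move=> cd; have [_ h _] := hk; apply: h; exact: hcol.2. Qed.

Lemma unbalanced_constant c d : col c d ->
  (forall b : inputs c -> inputs d, input_iso b ->
     exists e, ~ col (tail (arr e)) (tail (arr (b e)))) ->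
  c \in K.
Proof.
move=> cd nb; have kk := colour_dim cd; have [k0 _ _] := hk.
pose j := Ordinal (k0 c); apply/yK => t tt.
have := @determined_local_state c d true j (cast_ord kk j) _ _ _ _ t tt.
by move=> H; apply: (congr1 fst (H _ _ _ _)).
Qed.

Lemma colour_constant c d : col c d -> c \in K -> d \in K.
Proof.
move=> cd /yK cK; apply/yK => t tt; have t00 : `|t0 - t0| < tau by rewrite subrr normr0.
have dc : col d c by have [hr _] := hcol; have [rc tr_] := hr c d c; rewrite -tr_// rc.
by have [_ ->] := (ysync tt d c).2 dc; have [_ ->] := (ysync t00 d c).2 dc; rewrite cK.
Qed.

Lemma robust_balanced : balanced col.
Proof.
have [hr _] := hcol.
have cxx a : col a a by have [] := hr a a a.
have ceq a b z : col a b -> col a z = col b z by have [_] := hr a b z.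
have csym a b : col a b -> col b a by move=> ab; rewrite -(ceq _ _ _ ab).
move=> c d cd; apply: contrapT => nb.
have {}nb (b : inputs c -> inputs d) : input_iso b ->
    exists e, ~ col (tail (arr e)) (tail (arr (b e))).
  by move=> ib; apply: contrapT => H; apply: nb; exists b; split => // e; apply: contrapT => h; apply: H; exists e.
have cK := unbalanced_constant cd nb; have dK := colour_constant cd cK.
(* The class of [c] is represented by [d], so that [c] is not a representative and its stationarity
   equation is surplus. *)
pose rep e := if col e d then d else odflt e [pick a | col e a].
have rep_col e : col e (rep e).
  by rewrite /rep; case: ifP => // _; case: pickP => /=.
have rep_eq e e' : col e e' -> rep e = rep e'.
  move=> ee; rewrite /rep (ceq _ _ _ ee); case: ifP => // _.
  rewrite (eq_pick (fun a => ceq _ _ a ee)).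
  by case: pickP => //= H; have := H e'; rewrite cxx.
pose RK := [set e in K | rep e == e]; pose E := c |: RK.
have rep_RK e : e \in K -> rep e \in RK.
  by move=> eK; rewrite inE (colour_constant (rep_col e) eK) -(rep_eq _ _ (rep_col e)) eqxx.
have cnd : c <> d.
  move=> e; move: nb; rewrite -e => /(_ id (input_iso_id c))[a]; exact.
have rc : rep c = d by rewrite /rep cd.
have cRK : c \notin RK by rewrite inE rc cK/=; apply/eqP => /esym.
have EK e : e \in E -> e \in K by rewrite !inE => /predU1P[->//|/andP[]].
have t00 : `|t0 - t0| < tau by rewrite subrr normr0.
have iso_sync e e' (b : inputs e -> inputs e') : input_iso b ->
    pull b (local_state e' (y t0)) = local_state e (y t0) ->
    col e e' /\ forall a, col (tail (arr a)) (tail (arr (b a))).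
  move=> ib H; split => [|a]; apply/(ysync t00); last exact: pull_synchronous.
  by split; [exact: input_iso_dim ib|have := congr1 fst H].
(* A coincidence up to pullback gives equal colours and a colour-preserving isomorphism. Distinct
   nodes of [E] with equal colours can only be [c] and [d], between which there is none in either
   direction. *)
have sep e e' (b : inputs e -> inputs e') : e \in E -> e' \in E -> e != e' -> input_iso b ->
    pull b (local_state e' (y t0)) != local_state e (y t0).
  move=> eE eE' ne ib; apply/eqP => /(iso_sync _ _ _ ib)[ee tb].
  move: eE eE'; rewrite !inE => /predU1P[ec|/andP[_ /eqP re]] /predU1P[ec'|/andP[_ /eqP re']].
  - by move: ne; rewrite ec ec' eqxx.
  - have ed : e' = d by rewrite -re' -(rep_eq _ _ ee) ec.
    by subst e e'; have [a] := nb b ib; apply; exact: tb.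
  - have ed : e = d by rewrite -re (rep_eq _ _ ee) ec'.
    subst e e'; have [b' [ib' _ Kb]] := input_iso_inv ib.
    by have [a] := nb b' ib'; apply; apply: csym; have := tb (b' a); rewrite Kb.
  - by move: ne; rewrite -re -re' (rep_eq _ _ ee) eqxx.
have [By By0 HBy] := bounded_on_interval.
have [L L0 HL] := Ck1_lipschitz_ball (addr_ge0 By0 ler01) (aF.1 1%N).
(* Only the states of the representatives in [RK] enter [pt X]; on K it agrees with [X] when the
   colours of [X] are synchronous. *)
pose pt (X : state R k) : state R k :=
  pack (fun e => if e \in K then tr (k e) (fcoord X (rep e)) else 0).
have pt_le X Y h : 0 <= h -> (forall e, e \in RK -> `|fcoord X e - fcoord Y e| <= h) ->
    `|pt X - pt Y| <= h.
  move=> h0 H; apply: norm_le_fcoord => // e; rewrite fcoordB !fcoord_pack.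
  case: ifP => eK; last by rewrite subr0 normr0.
  by rewrite -linearB (le_trans (tr_norm_le _ _))// H// rep_RK.
have pt0 : pt 0 = 0.
  by apply: fcoord_ext => e; rewrite fcoord_pack fcoord0 linear0 if_same fcoord0.
have pt_norm X : `|pt X| <= `|X|.
  rewrite -[pt X]subr0 -pt0; apply: pt_le => // e _.
  by rewrite -fcoordB subr0 fcoord_norm_le.
(* By [constant_tail] the tails of a node in [K] lie in [K], so [pt X] retains the whole local
   state. *)
have pt_local X e : (forall a b, synchronous X a b <-> col a b) -> e \in K ->
    local_state e (pt X) = local_state e X.
  move=> sX eK.
  have H a : a \in K -> fcoord (pt X) a = fcoord X a.
    by move=> aK; rewrite fcoord_pack aK; have [_ <-] := (sX a (rep a)).2 (rep_col a).
  congr (_, _); first exact: H.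
  by apply: fcoord_ext => a; rewrite [LHS]fcoord_pack [RHS]fcoord_pack H// constant_tail.
(* All peaks belong to the single time [t0]; they separate nodes instead of times. *)
have peak e : {phi : _ -> R | [/\ trig phi, forall x, 0 <= phi x <= 1,
    phi (local_state e (y t0)) = 1 &
    forall Q, Q \in [seq pull (tagged z) (local_state (tag z) (y t0)) |
        z : {e' : node G & {ffun inputs e -> inputs e'}}] ->
      Q != local_state e (y t0) -> phi Q = 0]}.
  by apply: cid; apply: trig_peak => Q; exact: pair_separate.
pose phi e := sval (peak e); have Hphi e := svalP (peak e).
pose pos := {e : node G & 'I_(k e)}.
pose I := {x : pos | tag x \in E}; pose J := {x : pos | tag x \in RK}.
pose Q (i : I) := sym_map (phi (tag (sval i))) (delta_mx 0 (tagged (sval i))).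
pose ell (i : I) : {linear state R k -> R} := entry 0 (tagged (sval i)) \o proj (tag (sval i)).
have tQ i : trig (Q i) by apply: trig_sym_map; have [] := Hphi (tag (sval i)).
have aQ i : admissible (Q i) by apply: sym_map_admissible => //; have [] := Hphi (tag (sval i)).
pose n (i : I) := \sum_(b : {ffun inputs (tag (sval i)) -> inputs (tag (sval i))} | `[< input_iso b >])
  phi (tag (sval i)) (pull b (local_state (tag (sval i)) (y t0))).
have ellQ i i' : ell i (Q i' (pt (y t0))) = if i' == i then n i else 0.
  case: i i' => [[e j] /= eE] [[e' j'] /= eE'].
  rewrite /ell /= /entry /proj /Q /= sym_map_entry (pt_local _ _ (ysync t00) (EK _ eE)).
  rewrite -val_eqE /= /n /=.
  have [ee|ne] := eqVneq e' e; last first.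
    rewrite -tag_eqE /tag_eq /= (negbTE ne) /= big1 ?mul0r// => b /asboolP ib.
    have [_ _ _] := Hphi e'; apply; last exact: sep.
    apply/mapP; exists (Tagged (fun a => {ffun inputs e' -> inputs a}) b); by rewrite ?mem_enum.
  subst e'; rewrite tr_id mxE eqxx /= eq_Tagged /= [j == _]eq_sym.
  by case: ifP => _; rewrite ?mulr1 ?mulr0.
have n1 i : 1 <= n i by have [_ p01 p1 _] := Hphi (tag (sval i)); exact: symmetric_sum_ge1.
have [q [rho [eps [V [[q0 rho0 eps0] rho1 Qq [small1 small2] HV]]]]] := small_family tQ aQ.
have VB lam r : (forall i, `|lam i| <= eps) -> `|r - t0| < tau -> `|V lam r| <= By + 1.
  by move=> /HV[_ near _ _] rr; exact: norm_near_le (near _ rr) rho1 (HBy _ rr).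
(* The points are computed from the data at [t0] without any flow, hence the constants 1 and 0. The
   node [c] contributes [k c] > 0 indices to [I] and none to [J]. *)
apply: (@overdetermined_family _ _ I J F Q ell n (fun=> pt (y t0))
  (fun lam _ => pt (V lam t0)) (fun lam x => fcoord (V lam t0) (tag (sval x)) 0 (tagged (sval x)))
  q L 1 0 rho eps (By + 1)) => //.
- have [k0 _ _] := hk.
  rewrite !card_sig; apply: proper_card; apply/properP; split.
    by apply/fintype.subsetP => z; rewrite !inE => ->; rewrite orbT.
  exists (Tagged (fun e => 'I_(k e)) (Ordinal (k0 c))); rewrite !inE ?eqxx//=.
  by move: cRK; rewrite inE.
- move=> i u; rewrite /ell /= /entry /proj (le_trans (mx_entry_le _ _ _))//.
  by rewrite (le_trans (fcoord_norm_le _ _))// ler_peMl// ler1n.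
- exact: ltW.
- exact: ltW.
- exact: addr_ge0.
- by rewrite mulr0 invr_ge0.
- move=> lam hl; have [dV near sync VK] := HV _ hl; split.
  + move=> i; have eK := EK _ (svalP i).
    (* The equation holds at [V lam t0]; admissibility lets it be read at [pt (V lam t0)], which has
       the same local states on [K]. *)
    have aG := admissible_add aF (admissible_sum lam aQ).
    have := admissible_local aG (pt_local _ _ (sync _ t00) eK).
    rewrite /ell /= /entry /proj => ->.
    rewrite -[LHS]/(ell i _); apply: (constant_functional dV) t00 => r rr.
    by rewrite /ell /= /entry /proj (VK _ eK _ rr).
  + move=> i; apply: pt_le => [|e _]; first exact: ltW.
    by rewrite -fcoordB (le_trans (fcoord_norm_le _ _))//; exact/ltW/near.
  + move=> i; rewrite (le_trans (mx_entry_le _ _ _))// (le_trans (fcoord_norm_le _ _))//.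
    exact: VB.
move=> lam lam' hl hl'; split.
  by move=> i; apply: HL; rewrite (le_trans (pt_norm _))// VB.
move=> h d' h0 d0 wh ld i; rewrite mul1r mul0r addr0; apply: pt_le => // e eR.
apply: mx_norm_le => // a j; rewrite ord1 !mxE.
exact: (wh (exist _ (Tagged (fun e => 'I_(k e)) j) eR)).
Qed.
End Robust.

(** * From local rigidity to robustness at a minimal set of constant nodes *)

Lemma transverse_near (R : realType) N (f : 'rV[R]_N -> 'rV[R]_N) (g : 'rV[R]_N -> R) z :
  continuous f -> smooth g -> 'd g z (f z) <> 0 ->
  exists2 r, 0 < r & forall a u, `|a - z| < r -> `|u| < r -> 'd g a (f a + u) <> 0.
Proof.
move=> cf sg gz; have [dg cg] := sg 1%N.
have dE a u : 'd g a u = \sum_j u 0 j * 'D_(delta_mx 0 j) g a.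
  rewrite {1}[u]row_sum_delta linear_sum; apply: eq_bigr => j _.
  by rewrite linearZ deriveE.
have csum (h : 'I_N -> 'rV[R]_N -> R) : (forall j, continuous (h j)) ->
    continuous (fun a => \sum_j h j a).
  move=> ch; elim: (index_enum 'I_N) => [|j r IH].
    by under eq_fun do rewrite big_nil; exact: cst_continuous.
  by under eq_fun do rewrite big_cons; exact: continuous_addf.
have c1 : continuous (fun a => 'd g a (f a)).
  under eq_fun do rewrite dE; apply: csum => j; apply: continuous_mulR; last exact: cg.
  exact: continuous_entry.
have c2 : continuous (fun a => \sum_j `|'D_(delta_mx 0 j) g a|).
  apply: csum => j a; apply: (@continuous_comp _ _ _ (fun a => 'D_(delta_mx 0 j) g a) (@Num.norm _ _)).
    exact: cg.
  exact: norm_continuous.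
pose m := `|'d g z (f z)| / 2; have m0 : 0 < m by rewrite divr_gt0// normr_gt0; exact/eqP.
pose s a := \sum_j `|'D_(delta_mx 0 j) g a|.
have s0 : 0 < s z + 1 by rewrite ltr_wpDl// sumr_ge0.
have /cvgrPdist_lt/(_ _ m0)/nbhs_normP[a1 /= a10 H1] := c1 z.
have /cvgrPdist_lt/(_ _ ltr01)/nbhs_normP[a2 /= a20 H2] := c2 z.
exists (Num.min (Num.min a1 a2) (m / (s z + 1))); first by rewrite !lt_min a10 a20 divr_gt0.
move=> a u; rewrite !lt_min => /andP[/andP[b1 b2] _] /andP[_ u1].
have h1 : `|'d g z (f z) - 'd g a (f a)| < m by apply: H1; rewrite /= distrC.
have h2 : `|s z - s a| < 1 by apply: H2; rewrite /= distrC.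
have h3 : `|'d g a u| <= `|u| * (s z + 1).
  rewrite dE (le_trans (ler_norm_sum _ _ _))//.
  rewrite (@le_trans _ _ (`|u| * s a))//.
    by rewrite /s mulr_sumr ler_sum// => j _; rewrite normrM ler_wpM2r// mx_entry_le.
  by rewrite ler_wpM2l//; move: h2; rewrite ltr_norml => /andP[]; lra.
have h4 : `|u| * (s z + 1) < m by rewrite -ltr_pdivlMr.
rewrite linearD => E.
have := ler_normD ('d g z (f z) - 'd g a (f a)) (- 'd g a u).
have -> : 'd g z (f z) - 'd g a (f a) - 'd g a u = 'd g z (f z).
  by rewrite -addrA -opprD E subr0.
by rewrite normrN; move: h1 h3 h4; rewrite /m; lra.
Qed.

Lemma rigid_balanced (R : realType) (G : network) (k : node G -> nat)
    (f : state R k -> state R k) (x : R -> state R k) (T t0 : R) (col : rel (node G)) :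
  node_spaces k -> admissible f -> hyperbolic f x T -> colouring col ->
  locally_rigid f x T col t0 -> balanced col.
Proof.
move=> hk af hx hcol [g [[sg gx dgx] [delta [eps [ts [d0 eps0 ts0 H]]]]]].
have nr0 := norm_ratio_gt0 R k; set nr := norm_ratio R k in nr0.
have [r r0 Hr] := transverse_near (af.1 0%N) sg dgx.
(* [r] keeps the section transverse at nearby orbits; the other entries keep a sum of two distances
   within [delta], for periods and for [state_norm]. *)
pose rA := Num.min r (Num.min (delta / 2) (delta / (2 * nr))).
have rA0 : 0 < rA by rewrite !lt_min r0 !divr_gt0// mulr_gt0.
have rAr : rA <= r by rewrite ge_min lexx.
have rAd : 2 * rA <= delta by rewrite mulrC -ler_pdivlMr// !ge_min lexx !orbT.
have close (a b : state R k) : `|a - b| < 2 * rA -> state_norm (a - b) < delta.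
  move=> ab; rewrite (le_lt_trans (state_norm_le _))// -/nr.
  have : rA * (2 * nr) <= delta by rewrite -ler_pdivlMr ?mulr_gt0// !ge_min lexx !orbT.
  by apply: lt_le_trans; rewrite [ltRHS]mulrA [rA * 2]mulrC [ltLHS]mulrC ltr_pM2r.
have [epsA eA0 HA] := hyperbolic_persistence af.1 hx sg gx dgx rA0.
pose e1 := Num.min (Num.min epsA r) (eps / nr).
have e10 : 0 < e1 by rewrite !lt_min eA0 r0 divr_gt0.
(* The cut at 1 is the span on which [hyperbolic_persistence] controls the time parametrisation. *)
pose tau := Num.min ts 1; have tau0 : 0 < tau by rewrite lt_min ts0 ltr01.
(* The size [e] is strictly below [e1], which leaves room for a further perturbation on top of
   [p]. *)
pose full p v S := [/\ exists e, [/\ 0 <= e, e < e1, admissible p & C1_small e p],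
  [/\ hyperbolic (f \+ p) v S, `|S - T| < rA, forall t, exists s, `|v t - x s| < rA, g (v t0) = 0
    & `|v t0 - x t0| < rA],
  forall t, `|t - t0| < tau -> forall c d, synchronous (v t) c d <-> col c d
  & forall v' S', perturbed_orbit f x T t0 g delta p v' S' -> S' = S /\ v' = v].
(* The orbit found by persistence satisfies [perturbed_orbit], so uniqueness identifies it with the
   rigid one, which is thereby known to be within [rA] of [x]. *)
have ex p e : 0 <= e -> e < e1 -> admissible p -> C1_small e p -> exists v S, full p v S.
  move=> ee0 ee ap pe.
  have pn : (C1_norm p < eps%:E)%E.
    rewrite (le_lt_trans (C1_norm_le ee0 pe))// lte_fin mulrC -ltr_pdivlMr//.
    by move: ee; rewrite !lt_min => /andP[].
  have [|y [S [_ uni hy pat]]] := H p _ pn.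
    by split => //; rewrite (lt_trans pn)// ltry.
  have [|v [S' [pv vT near gv vx]]] := HA p.
    by apply: C1_small_le pe; move: ee; rewrite !lt_min => /andP[/andP[/ltW]].
  have [|SS vy] := uni v S'.
    split => //; last first.
      apply/close; rewrite (lt_trans (vx t0 _))//; first by rewrite subrr normr0.
      by rewrite mulrDl mul1r ltrDl.
    split; first by rewrite (lt_le_trans vT)// (le_trans _ rAd)// mulrDl mul1r lerDl ltW.
    move=> t; have [s sx] := near t; exists s; apply/close.
    by rewrite (lt_trans sx)// mulrDl mul1r ltrDl.
  have {}vy : v = y by apply/funext.
  subst v S'; exists y, S; split.
  - by exists e.
  - by split => //; apply: vx; rewrite subrr normr0.
  - by move=> t tt; apply: pat; rewrite (lt_le_trans tt)// ge_min lexx.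
  - by move=> v' S' /uni[-> vv]; split => //; exact/funext.
pose Kset (v : R -> state R k) :=
  [set c | `[< forall t, `|t - t0| < tau -> fcoord (v t) c = fcoord (v t0) c >]]%SET.
have [n /asboolP[p0 [y [S0 [[[e0 [e00 e0e ap0 p0e]] [hy yT ynear gy yx] ysync _] <-]]]] min] :
    exists2 n, `[< exists p v S, full p v S /\ #|Kset v| = n >] &
      forall n', `[< exists p v S, full p v S /\ #|Kset v| = n' >] -> (n <= n')%N.
  have [v [S fu]] := ex _ 0 (lexx _) e10 (@admissible0 R G k) (C1_small0 _ (lexx _)).
  have exn : exists n, `[< exists p v S, full p v S /\ #|Kset v| = n >].
    by exists #|Kset v|; apply/asboolP; exists (fun=> 0), v, S.
  by case: (ex_minnP exn) => n Hn Hmin; exists n.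
have aF := admissible_add af ap0.
have [[dy _ _ _] _] := hy.
have gap c : exists gc : R, 0 < gc /\ (c \notin Kset y -> exists2 t, `|t - t0| < tau &
    gc <= `|fcoord (y t) c - fcoord (y t0) c|).
  have [cK|] := boolP (c \in Kset y); first by exists 1.
  rewrite inE => /asboolP/existsNP[t /not_implyP[tt /eqP ne]].
  by exists `|fcoord (y t) c - fcoord (y t0) c|; rewrite normr_gt0 subr_eq0; split => // _; exists t.
have [gc Hgc] := choice gap; have [gm gm0 gml] := fin_min (fun c => (Hgc c).1).
apply: (@robust_balanced R G k hk col (f \+ p0) y t0 tau (Kset y)) => //.
  by move=> c; rewrite inE; split => [/asboolP|h]//; exact/asboolP.
(* Within gm / 2 of [y], a node that moves by at least [gm] along [y] still moves, so [Kset] can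
   only shrink; minimality then makes it stay the same. *)
move=> rho rho0; pose rB := Num.min (Num.min rho rA) (gm / 2).
have rB0 : 0 < rB by rewrite lt_min divr_gt0 ?andbT// lt_min rho0 rA0.
(* The section chosen at [x t0] must serve again at [y t0], now for the field with [p0] added, since
   uniqueness refers to this section. *)
have dgy : 'd g (y t0) ((f \+ p0) (y t0)) <> 0.
  apply: Hr; first exact: lt_le_trans rAr.
  have [_ pb _] := p0e; rewrite (le_lt_trans (pb _))// (lt_le_trans e0e)//.
  by rewrite !ge_min lexx orbT.
have [epsB eB0 HB] := hyperbolic_persistence aF.1 hy sg gy dgy rB0.
have ee0 : 0 < (e1 - e0) / 2 by rewrite divr_gt0// subr_gt0.
pose eta := Num.min epsB ((e1 - e0) / 2).
have eta0 : 0 < eta by rewrite lt_min eB0.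
have etae : eta <= (e1 - e0) / 2 by rewrite ge_min lexx orbT.
exists eta => // q aq qe.
have [|v [S [pv vS vnear gv vy]]] := HB q; first by apply: C1_small_le qe; rewrite ge_min lexx.
pose p x := p0 x + q x.
have Fp : (f \+ p0) \+ q = f \+ p by apply/funext => a; rewrite /p /= addrA.
have ee : 0 <= e0 + eta by rewrite addr_ge0// ltW.
have ee1 : e0 + eta < e1 by move: etae e0e; clear; lra.
have [w [Sw fw]] := ex p _ ee ee1 (admissible_add ap0 aq) (C1_smallD p0e qe).
have [_ _ wsync uni] := fw.
have vyB t : `|t - t0| < tau -> `|v t - y t| < rB.
  by move=> tt; apply: vy; rewrite ltW// (lt_le_trans tt)// ge_min lexx orbT.
have rBA : rB <= rA by rewrite /rB ge_min ge_min lexx orbT.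
have t00 : `|t0 - t0| < tau by rewrite subrr normr0.
(* Persistence makes [v] close to [y], rigidity gives the synchronies of [w]; uniqueness near [x]
   makes the two orbits equal. *)
have [|SS vw] := uni v S.
  split => //; first by rewrite -Fp.
  - split.
      have := ler_normD (S - S0) (S0 - T); rewrite subrKA.
      by move: vS yT rBA rAd; clear; lra.
    move=> t; have [s vs] := vnear t; have [s' ys] := ynear s; exists s'; apply/close.
    have := ler_normD (v t - y s) (y s - x s'); rewrite subrKA.
    by move: vs ys rBA; clear; lra.
  - apply/close; have := ler_normD (v t0 - y t0) (y t0 - x t0); rewrite subrKA.
    by have := vyB _ t00; move: yx rBA; clear; lra.
subst w Sw; have [dv _ _ _] := pv.
exists v; split => //.
- by move=> t /vyB vt; rewrite (lt_le_trans vt)// !ge_min lexx.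
move=> c cK; have sub : Kset v \subset Kset y.
  apply/fintype.subsetP => a; rewrite inE => /asboolP va; apply: contrapT => /negP/(Hgc a).2[t tt ga].
  have gma := gml a.
  have h1 := le_lt_trans (fcoord_norm_le (v t - y t) a) (vyB _ tt).
  have h2 := le_lt_trans (fcoord_norm_le (v t0 - y t0) a) (vyB _ t00).
  have rBg : rB <= gm / 2 by rewrite !ge_min lexx orbT.
  have := ler_normB (fcoord (v t0 - y t0) a) (fcoord (v t - y t) a).
  rewrite !fcoordB (va _ tt) opprB addrC subrKA.
  by move: h1 h2 ga gma rBg gm0; rewrite !fcoordB (va _ tt); clear; lra.
have : Kset v = Kset y.
  apply/eqP; rewrite eqEcard sub min//; apply/asboolP.
  by exists p, v, S.
by move=> KK t tt; move: cK; rewrite -KK inE => /asboolP; exact.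
Qed.

Theorem theorem9p2 (R : realType) (G : network) (k : node G -> nat)
    (hG : irredundant G) (hk : node_spaces k)
    (f : state R k -> state R k) (hf : admissible f)
    (x : R -> state R k) (T : R) (hx : periodic_orbit f x T)
    (hsh : strongly_hyperbolic f x T)
    (J : set R) (hJ : is_interval J) (hJo : open J) (hJ0 : J !=set0)
    (col : rel (node G)) (hcol : colouring col)
    (hrig : forall t0 : R, J t0 -> locally_rigid f x T col t0) :
  balanced col.
Proof.
have [t0 /hrig rig] := hJ0; have [hyp _] := hsh col hcol.
exact: rigid_balanced rig.
Qed.
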